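(* Let $m,n$ be positive integers and let $\mathcal M$ be an $m\times m$ matrix such that $2\mathcal M$ is a symmetric positive definite, unimodular even integral matrix. Define $\Theta_{\mathcal M}:\mathbb H_n\to\mathbb C$ by $$\Theta_{\mathcal M}(\Omega)=\sum_{\xi\in\mathbb Z^{(m,n)}}e^{2\pi i\,\sigma(\mathcal M\,\xi\,\Omega\,{}^t\xi)}.$$ Then there is a character $\rho_{\mathcal M}$ of $\Gamma_n=Sp(n,\mathbb Z)$, with $|\rho_{\mathcal M}(\gamma)|^8=1$ for all $\gamma\in\Gamma_n$, such that for every $\gamma=\begin{pmatrix}A&B\\C&D\end{pmatrix}\in\Gamma_n$, $$\Theta_{\mathcal M}\bigl((A\Omega+B)(C\Omega+D)^{-1}\bigr)=\rho_{\mathcal M}(\gamma)\,\det(C\Omega+D)^{\frac m2}\,\Theta_{\mathcal M}(\Omega),\qquad\Omega\in\mathbb H_n.$$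
   Context: $\sigma$ denotes the trace, ${}^t\xi$ the transpose, $\mathbb H_n$ the Siegel upper half plane of symmetric complex $n\times n$ matrices with positive definite imaginary part. A symmetric integral matrix $S$ is even if ${}^t\xi S\xi\in2\mathbb Z$ for all integral column vectors $\xi$; unimodular means determinant $1$ (such a matrix has degree $m$ divisible by $8$, so $\det(C\Omega+D)^{m/2}$ is an integral power). *)

(* Defs.v *)
From mathcomp Require Import all_boot all_order all_algebra.
From mathcomp Require Import all_classical all_reals all_analysis.
From mathcomp Require Import finmap complex.
From mathcomp.analysis.showcase Require summability.

Set Implicit Arguments.
Unset Strict Implicit.
Unset Printing Implicit Defensive.

Import Order.TTheory GRing.Theory Num.Theory.
Import numFieldNormedType.Exports.

Local Open Scope classical_set_scope.
Local Open Scope ring_scope.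
Local Open Scope complex_scope.

(* e^(x + iy) = e^x (cos y + i sin y) *)
Definition cexp (R : realType) (z : R[i]) : R[i] :=
  (expR (complex.Re z))%:C *
    (cos (complex.Im z) +i* sin (complex.Im z)).

Definition posdefmx (R : realType) (n : nat) (A : 'M[R]_n) : Prop :=
  forall x : 'cV[R]_n, x != 0 -> 0 < (x^T *m A *m x) 0 0.

Definition siegel (R : realType) (n : nat) : set 'M[R[i]]_n :=
  [set Omega | Omega^T = Omega /\
     posdefmx (map_mx (@complex.Im R) Omega)].

Definition even_mx (m : nat) (S : 'M[int]_m) : Prop :=
  forall xi : 'cV[int]_m, (2 %| ((xi^T *m S *m xi) 0 0)%R)%Z.

Definition even_unimodular_posdef (R : realType) (m : nat)
    (S : 'M[int]_m) : Prop :=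
  [/\ S^T = S, posdefmx (map_mx intr S : 'M[R]_m), even_mx S & \det S = 1].

Definition symplectic_form (n : nat) : 'M[int]_(n + n) :=
  block_mx 0 1%:M (- 1%:M) 0.

Definition Sp_int (n : nat) : {pred 'M[int]_(n + n)} :=
  [pred g | g^T *m symplectic_form n *m g == symplectic_form n].

(* Only the values of rho on Sp(n,Z) are meaningful; there rho is a
   homomorphism into the multiplicative group of nonzero complex numbers. *)
Definition Sp_character (R : realType) (n : nat)
    (rho : 'M[int]_(n + n) -> R[i]) : Prop :=
  {in @Sp_int n, forall g, rho g != 0} /\
  {in @Sp_int n &, forall g h, rho (g *m h) = rho g * rho h}.

Definition theta_term (R : realType) (m n : nat) (M : 'M[R[i]]_m)
    (Omega : 'M[R[i]]_n) (xi : 'M[int]_(m, n)) : (R[i])^o :=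
  let X : 'M[R[i]]_(m, n) := map_mx intr xi in
  cexp (2 * pi%:C * 'i * \tr (M *m X *m Omega *m X^T)).

(* The sum over all integral m x n matrices is unconditional: the limit of the
   finite partial sums along the directed set of finite sets of matrices. *)
Definition theta_summable (R : realType) (m n : nat) (M : 'M[R[i]]_m)
    (Omega : 'M[R[i]]_n) : Prop :=
  cvg (summability.partial_sum (theta_term M Omega) @ summability.totally).

Definition Theta (R : realType) (m n : nat) (M : 'M[R[i]]_m)
    (Omega : 'M[R[i]]_n) : R[i] :=
  summability.sum (theta_term M Omega).

(* Main.v *)
(* The law is multiplicative in the symplectic matrix, so it suffices to check it on generators,
   with a constant of modulus 1 each time: translations Omega + S, congruences U Omega U^t, and
   the inversion of a single variable.  Since S = 2 M is even and unimodular, m is even, so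
   det(C Omega + D)^(m/2) is an honest cocycle and no square root has to be chosen.

   The first two generators act by termwise identities.  The inversion of one variable is
   Poisson summation on Z^m for the form z S with Re z > 0, the other columns of xi being
   frozen.  By completing squares (Schur complements) this reduces to one variable.

   On the line, finite Fourier analysis on (1/N)Z/NZ writes the theta series exactly as a sum over
   N frequencies of Riemann sums of Gaussians.  As N grows, each Riemann sum may be moved from the
   complex line alpha t + beta to the real line, because the form exp(-pi u^2) du is closed;
   dominated convergence (two summations by parts) then gives Poisson's formula up to a
   constant, which is 1 because the formula is self-dual at alpha = 1.

   Sp(n,Z) is generated by these elements by a Euclidean algorithm on its first column and
   induction on n. *)
Require Import Defs.
From mathcomp Require Import all_boot all_order all_algebra.
From mathcomp Require Import all_classical all_reals all_analysis.
From mathcomp Require Import finmap complex.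
From mathcomp Require Import perm ring lra zify.
Set Implicit Arguments.
Unset Strict Implicit.
Unset Printing Implicit Defensive.

Import Order.TTheory GRing.Theory Num.Theory.
Import numFieldNormedType.Exports.

Local Open Scope classical_set_scope.
Local Open Scope ring_scope.
Local Open Scope complex_scope.

(** No integral is evaluated and no Fourier transform is defined. The only analytic limit is that of
    the Riemann sums of exp(-pi u^2) over (1/N)Z, and the same sums appear for every direction,
    shift, phase and frequency, so that they factor out of the whole frequency sum.

    Gaussians are written with scalar alpha^2, where |Im alpha| < Re alpha. This sector is where
    exp(-pi u^2) decays along lines of direction alpha. It is convex, so the segment from 1 to
    alpha, along which the line is moved, stays inside it; it is stable under inversion, so both
    sides of Poisson's formula are of the same kind; and every z with Re z > 0 has a square root in
    it.

    Poisson's formula carries a real shift b and a real phase c throughout. Freezing the other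
    columns of xi displaces the first one by a complex vector w. Since 1 and omega form a real basis
    of C when Im omega > 0, w splits into a real shift and a multiple of omega, and the latter
    becomes a real phase. *)

Notation Re := (@complex.Re _).
Notation Im := (@complex.Im _).

(** * Unconditional sums of complex families *)

Notation cabs := ComplexField.Normc.normc.
Arguments ComplexField.Normc.normc {R} x : simpl never.

Section ComplexModulus.
Variable R : realType.
Implicit Types x y z : R[i].

Lemma normc_cabs z : `|z| = (cabs z)%:C.
Proof. by []. Qed.

Lemma cabs_ge0 z : 0 <= cabs z.
Proof. by case: z => a b; exact: sqrtr_ge0. Qed.

Lemma cabsM x y : cabs (x * y) = cabs x * cabs y.
Proof. exact: ComplexField.Normc.normcM. Qed.

Lemma cabsV x : cabs x^-1 = (cabs x)^-1.
Proof. exact: ComplexField.Normc.normcV. Qed.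

Lemma cabs0 : cabs (0 : R[i]) = 0.
Proof. exact: ComplexField.Normc.normc0. Qed.

Lemma cabs1 : cabs (1 : R[i]) = 1.
Proof. exact: ComplexField.Normc.normc1. Qed.

Lemma cabs_eq0 z : (cabs z == 0) = (z == 0).
Proof.
apply/eqP/eqP => [/ComplexField.Normc.eq0_normc//|->]; exact: cabs0.
Qed.

Lemma cabs_gt0 z : (0 < cabs z) = (z != 0).
Proof. by rewrite lt_def cabs_ge0 andbT cabs_eq0. Qed.

Lemma cabsD x y : cabs (x + y) <= cabs x + cabs y.
Proof. exact: le_normcD. Qed.

Lemma cabsN x : cabs (- x) = cabs x.
Proof. exact: normcN. Qed.

Lemma cabsB x y : cabs (x - y) <= cabs x + cabs y.
Proof. by rewrite -[cabs y]cabsN; exact: cabsD. Qed.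

Lemma cabsC x y : cabs (x - y) = cabs (y - x).
Proof. by rewrite -cabsN opprB. Qed.

Lemma cabsX x n : cabs (x ^+ n) = cabs x ^+ n.
Proof. by elim: n => [|n IH]; rewrite ?expr0 ?cabs1// !exprS cabsM IH. Qed.

Lemma realCD (a b : R) : (a + b)%:C = a%:C + b%:C.
Proof. exact: rmorphD. Qed.

Lemma realCN (a : R) : (- a)%:C = - a%:C.
Proof. exact: rmorphN. Qed.

Lemma realCM (a b : R) : (a * b)%:C = a%:C * b%:C.
Proof. exact: rmorphM. Qed.

Lemma realCX (a : R) n : (a ^+ n)%:C = a%:C ^+ n.
Proof. exact: rmorphXn. Qed.

Lemma realCV (a : R) : (a^-1)%:C = a%:C^-1.
Proof. exact: fmorphV. Qed.

Lemma realC_nat n : (n%:R)%:C = n%:R :> R[i].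
Proof. exact: rmorph_nat. Qed.

Lemma cabs_real (a : R) : cabs a%:C = `|a|.
Proof. by rewrite /ComplexField.Normc.normc /= expr0n /= addr0 sqrtr_sqr. Qed.

Lemma cabs_i : cabs ('i : R[i]) = 1.
Proof. by rewrite /ComplexField.Normc.normc /= expr0n /= add0r expr1n sqrtr1. Qed.

Lemma sqr_cabs z : cabs z ^+ 2 = Re z ^+ 2 + Im z ^+ 2.
Proof.
by case: z => a b; rewrite /ComplexField.Normc.normc /= sqr_sqrtr// addr_ge0// sqr_ge0.
Qed.

Lemma normr_Re_le z : `|Re z| <= cabs z.
Proof.
rewrite -(@ler_pXn2r _ 2) ?nnegrE ?cabs_ge0 ?normr_ge0//.
by rewrite sqr_cabs real_normK ?num_real// lerDl sqr_ge0.
Qed.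

Lemma normr_Im_le z : `|Im z| <= cabs z.
Proof.
rewrite -(@ler_pXn2r _ 2) ?nnegrE ?cabs_ge0 ?normr_ge0//.
by rewrite sqr_cabs real_normK ?num_real// lerDr sqr_ge0.
Qed.

Lemma cabs_le_ReIm z : cabs z <= `|Re z| + `|Im z|.
Proof.
rewrite [X in cabs X](complexE z) (le_trans (cabsD _ _))// cabsM cabs_i mul1r.
by rewrite !cabs_real.
Qed.

Lemma cabs_sum (I : Type) (s : seq I) (P : pred I) (F : I -> R[i]) :
  cabs (\sum_(i <- s | P i) F i) <= \sum_(i <- s | P i) cabs (F i).
Proof.
elim/big_ind2: _ => [|x1 x2 y1 y2 h1 h2|//]; first by rewrite cabs0.
by rewrite (le_trans (cabsD _ _))// lerD.
Qed.

End ComplexModulus.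

Section UnconditionalSums.
Variable R : realType.
Local Open Scope fset_scope.
Local Open Scope ring_scope.
Implicit Types (I J : choiceType).

(** The directed limit behind [summability.sum], with the error measured by the real modulus [cabs],
    so that all estimates live in [R]; [has_sum_cvg] is the bridge. *)
Definition has_sum I (f : I -> R[i]) (s : R[i]) :=
  forall e : R, 0 < e -> exists A : {fset I}, forall B : {fset I},
    A `<=` B -> cabs (\sum_(i <- B) f i - s) < e.

(** The default value 0 for a divergent family is what lets [csumZ_neq0] hold without
    summability. *)
Definition csum I (f : I -> R[i]) : R[i] := xget 0 [set s | has_sum f s]%classic.

Definition asum I (f : I -> R[i]) :=
  exists K : R, forall A : {fset I}, \sum_(i <- A) cabs (f i) <= K.

Lemma has_sum_uniq I (f : I -> R[i]) s t : has_sum f s -> has_sum f t -> s = t.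
Proof.
move=> hs ht; apply/eqP; rewrite -subr_eq0 -cabs_eq0.
case: (eqVneq (cabs (s - t)) 0) => // h.
have e0 : 0 < cabs (s - t) / 2 by rewrite divr_gt0// lt_def h cabs_ge0.
have [A hA] := hs _ e0; have [B hB] := ht _ e0.
have := hA _ (fsubsetUl A B); have := hB _ (fsubsetUr A B).
set X := \sum_(i <- _) _ => h1 h2.
have : cabs (s - t) <= cabs (X - t) + cabs (X - s).
  by rewrite (_ : s - t = (X - t) - (X - s)) ?cabsB//; ring.
lra.
Qed.

Lemma has_sum_csum I (f : I -> R[i]) s : has_sum f s -> csum f = s.
Proof.
move=> hs; apply: (@has_sum_uniq _ f) => //.
by apply: (@xgetPex _ 0 [set s | has_sum f s]%classic); exists s.
Qed.

Lemma has_sumD I (f g : I -> R[i]) s t :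
  has_sum f s -> has_sum g t -> has_sum (fun i => f i + g i) (s + t).
Proof.
move=> hf hg e e0.
have [A hA] := hf (e / 2) ltac:(lra); have [B hB] := hg (e / 2) ltac:(lra).
exists (A `|` B) => D; rewrite fsubUset => /andP[/hA h1 /hB h2].
rewrite big_split /= (_ : _ - _ = (\sum_(i <- D) f i - s) + (\sum_(i <- D) g i - t)).
  by have := cabsD (\sum_(i <- D) f i - s) (\sum_(i <- D) g i - t); lra.
ring.
Qed.

Lemma has_sumZ I (f : I -> R[i]) s c :
  has_sum f s -> has_sum (fun i => c * f i) (c * s).
Proof.
move=> hf e e0.
have c0 : 0 < cabs c + 1 by rewrite ltr_wpDl// cabs_ge0.
have [A hA] := hf (e / (cabs c + 1)) (divr_gt0 e0 c0).
exists A => B /hA; rewrite ltr_pdivlMr// => h.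
rewrite -mulr_sumr -mulrBr cabsM; apply: le_lt_trans h.
by rewrite mulrC ler_wpM2l ?cabs_ge0// lerDl.
Qed.

Lemma has_sum_bound I (f : I -> R[i]) s (K : R) :
  (forall A : {fset I}, cabs (\sum_(i <- A) f i) <= K) -> has_sum f s -> cabs s <= K.
Proof.
move=> hK hs; rewrite leNgt; apply/negP => h.
have [A hA] := hs (cabs s - K) ltac:(lra).
have := hA _ (fsubset_refl A); set X := \sum_(i <- _) _ => h1.
have : cabs s <= cabs X + cabs (X - s).
  by rewrite -{1}(subKr X s) cabsB.
by have := hK A; rewrite -/X; lra.
Qed.

Lemma eq_csum I (f g : I -> R[i]) : f =1 g -> csum f = csum g.
Proof. by move=> /funext ->. Qed.

Lemma ler_sum_fset I (A B : {fset I}) (g : I -> R) :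
  (forall i, 0 <= g i) -> A `<=` B -> \sum_(i <- A) g i <= \sum_(i <- B) g i.
Proof.
move=> g0 AB; rewrite [leRHS](big_fsetID _ (mem A)) /=.
rewrite (_ : [fset x in B | x \in A] = A); first by rewrite lerDl sumr_ge0.
by apply/fsetP => x; rewrite !inE /= andb_idl//; exact: (fsubsetP AB).
Qed.

Lemma asum_le I (f g : I -> R[i]) (K : R) :
  0 <= K -> (forall i, cabs (f i) <= K * cabs (g i)) -> asum g -> asum f.
Proof.
move=> K0 h [L hL]; exists (K * L) => A.
apply: le_trans (ler_wpM2l K0 (hL A)); rewrite mulr_sumr.
by apply: ler_sum.
Qed.

Lemma asum_le1 I (f g : I -> R[i]) :
  (forall i, cabs (f i) <= cabs (g i)) -> asum g -> asum f.
Proof. by move=> h; apply: (asum_le (K := 1)) => // i; rewrite mul1r. Qed.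

Lemma nonneg_has_sum I (g : I -> R) : (forall i, 0 <= g i) ->
  asum (fun i => (g i)%:C) -> exists s : R, has_sum (fun i => (g i)%:C) s%:C.
Proof.
move=> g0 [K hK].
pose S := [set x | exists A : {fset I}, x = \sum_(i <- A) g i]%classic.
have hS : has_sup S.
  split; first by exists 0, fset0; rewrite big_seq_fset0.
  exists K => _ [A ->]; apply: le_trans (hK A); apply: ler_sum => i _.
  by rewrite cabs_real ger0_norm.
exists (sup S) => e e0.
have [_ [A ->] hA] := sup_adherent e0 hS.
exists A => B AB; rewrite -rmorph_sum -rmorphB cabs_real.
have h1 := ler_sum_fset g0 AB.
have h2 : \sum_(i <- B) g i <= sup S by apply: ub_le_sup; [case: hS|exists B].
by rewrite ler0_norm; lra.
Qed.

(** The real and the imaginary part are treated separately; a real family is [(|u| + u) - |u|], a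
    difference of nonnegative families, whose sums are suprema. *)
Lemma asum_has_sum I (f : I -> R[i]) : asum f -> has_sum f (csum f).
Proof.
move=> af; suff [s hs] : exists s, has_sum f s by rewrite (has_sum_csum hs).
have real_case (u : I -> R) : (forall i, `|u i| <= cabs (f i)) ->
    exists s : R[i], has_sum (fun i => (u i)%:C) s.
  move=> hu.
  have [||s hs] := @nonneg_has_sum _ (fun i => `|u i| + u i).
  - by move=> i; have := ler_norm (- u i); rewrite normrN; lra.
  - apply: asum_le af => [|i]; first exact: (ler0n _ 2).
    rewrite cabs_real; have := hu i; have := ler_normD `|u i| (u i).
    by rewrite normr_id; lra.
  have [||t ht] := @nonneg_has_sum _ (fun i => `|u i|) => //.
    by apply: asum_le1 af => i; rewrite cabs_real normr_id.
  have := has_sumD hs (has_sumZ (-1) ht) => h.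
  exists (s%:C + -1 * t%:C); congr has_sum: h.
  by apply/funext => i; rewrite rmorphD /=; ring.
have [s hs] := real_case (fun i => Re (f i)) (fun i => normr_Re_le _).
have [t ht] := real_case (fun i => Im (f i)) (fun i => normr_Im_le _).
have := has_sumD hs (has_sumZ 'i ht) => h.
exists (s + 'i * t); congr has_sum: h.
by apply/funext => i; rewrite [RHS]complexE.
Qed.

Lemma csumZ I (f : I -> R[i]) c : asum f -> csum (fun i => c * f i) = c * csum f.
Proof. by move=> /asum_has_sum /(has_sumZ c) /has_sum_csum. Qed.

Lemma asumD I (f g : I -> R[i]) : asum f -> asum g -> asum (fun i => f i + g i).
Proof.
move=> [K hK] [L hL]; exists (K + L) => A.
apply: le_trans (lerD (hK A) (hL A)); rewrite -big_split /=.
by apply: ler_sum => i _; exact: cabsD.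
Qed.

Lemma asumB I (f g : I -> R[i]) : asum f -> asum g -> asum (fun i => f i - g i).
Proof.
move=> [K hK] [L hL]; exists (K + L) => A.
apply: le_trans (lerD (hK A) (hL A)); rewrite -big_split /=.
by apply: ler_sum => i _; exact: cabsB.
Qed.

Lemma csumD I (f g : I -> R[i]) : asum f -> asum g ->
  csum (fun i => f i + g i) = csum f + csum g.
Proof.
by move=> /asum_has_sum hf /asum_has_sum /(has_sumD hf) /has_sum_csum.
Qed.

Lemma csumB I (f g : I -> R[i]) : asum f -> asum g ->
  csum (fun i => f i - g i) = csum f - csum g.
Proof.
move=> /asum_has_sum hf /asum_has_sum /(has_sumZ (-1)) hg.
have /has_sum_csum := has_sumD hf hg; rewrite mulN1r => <-.
by apply: eq_csum => i; rewrite mulN1r.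
Qed.

Lemma asumZ I (f : I -> R[i]) c : asum f -> asum (fun i => c * f i).
Proof.
by apply: (asum_le (K := cabs c)) => [|i]; rewrite ?cabs_ge0// cabsM.
Qed.

Lemma cabs_sum_le I (f : I -> R[i]) (A : {fset I}) :
  cabs (\sum_(i <- A) f i) <= \sum_(i <- A) cabs (f i).
Proof. exact: cabs_sum. Qed.

Lemma csum_bound I (f : I -> R[i]) (K : R) :
  (forall A : {fset I}, \sum_(i <- A) cabs (f i) <= K) -> cabs (csum f) <= K.
Proof.
move=> hK; apply: (@has_sum_bound _ f) => [A|]; last by apply: asum_has_sum; exists K.
exact: le_trans (cabs_sum_le _ _) (hK A).
Qed.

(** The condition [h (g j) != j] says that [j] lies outside the image of [h]. This removes the
    points of (1/N)Z that are not integers in [finite_fourier]. *)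
Lemma has_sum_inj I J (h : I -> J) (g : J -> I) (f : J -> R[i]) s :
  cancel h g -> (forall j, h (g j) != j -> f j = 0) ->
  has_sum (f \o h) s -> has_sum f s.
Proof.
move=> hK f0 hs e e0; have [A hA] := hs e e0.
exists (h @` A) => B hB.
have gi : {in [fset j in B | h (g j) == j] &, injective g}.
  by move=> x y; rewrite !inE /= => /andP[_ /eqP <-] /andP[_ /eqP <-]; rewrite !hK => ->.
have -> : \sum_(i <- B) f i = \sum_(i <- g @` [fset j in B | h (g j) == j]) (f \o h) i.
  rewrite big_imfset //= (big_fsetID _ (fun j => h (g j) == j)) /=.
  rewrite [X in _ + X]big_seq_cond [X in _ + X]big1 ?addr0.
    rewrite big_seq [RHS]big_seq; apply: eq_bigr => i.
    by rewrite !inE /= => /andP[_ /eqP ->].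
  by move=> i; rewrite !inE /= andbT => /andP[_]; exact: f0.
apply: hA; apply/fsubsetP => x xA; apply/imfsetP; exists (h x); rewrite /= ?hK//.
rewrite !inE /= hK eqxx andbT.
by apply: (fsubsetP hB); apply/imfsetP; exists x.
Qed.

Lemma has_sum_reindex I J (h : I -> J) (f : J -> R[i]) s :
  bijective h -> has_sum (f \o h) s -> has_sum f s.
Proof.
by move=> [k hk kh]; apply: (has_sum_inj hk) => j; rewrite kh eqxx.
Qed.

Lemma asum_reindex I J (h : I -> J) (f : J -> R[i]) :
  injective h -> asum f -> asum (f \o h).
Proof.
move=> hi [K hK]; exists K => A; apply: le_trans (hK (h @` A)).
by rewrite big_imfset //= => x y _ _ /hi.
Qed.

Lemma csum_reindex I J (h : I -> J) (f : J -> R[i]) :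
  bijective h -> asum f -> csum (f \o h) = csum f.
Proof.
move=> bh af; symmetry; apply: has_sum_csum; apply: (has_sum_reindex bh).
by apply: asum_has_sum; apply: asum_reindex => //; exact: bij_inj.
Qed.

Lemma asum_slice I J (f : I * J -> R[i]) i : asum f -> asum (fun j => f (i, j)).
Proof. by move=> /(@asum_reindex _ _ (pair i)); apply => x y []. Qed.

(** An error [e] is shared among the elements of [A]; the [+ 1] keeps each share positive when [A]
    is empty. *)
Lemma sum_const_fset I (A : {fset I}) (e : R) : 0 <= e ->
  \sum_(i <- A) e / (#|` A|%:R + 1) <= e.
Proof.
move=> e0; rewrite -mulr_suml big_const_seq count_predT iter_addr_0.
rewrite ler_pdivrMr ?ltr_wpDl// -[e *+ _]mulr_natr.
by rewrite ler_wpM2l// lerDl.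
Qed.

Lemma sum_fsetM (V : nmodType) I J (A : {fset I}) (B : {fset J}) (F : I * J -> V) :
  \sum_(p <- A `*` B) F p = \sum_(i <- A) \sum_(j <- B) F (i, j).
Proof. by rewrite big_imfset2 //= => -[x y] [u v] _ _ /= [-> ->]. Qed.

Lemma has_sum_fubini I J (f : I * J -> R[i]) s (t : I -> R[i]) :
  has_sum f s -> (forall i, has_sum (fun j => f (i, j)) (t i)) -> has_sum t s.
Proof.
move=> hs ht e e0.
have [A hA] := hs (e / 2) ltac:(lra).
exists (fst @` A) => B hB.
pose d := e / 2 / (#|` B|%:R + 1).
have d0 : 0 < d by rewrite divr_gt0 ?ltr_wpDl//; lra.
have /boolp.choice [D hD] : forall i, exists Di : {fset J}, forall E : {fset J},
    Di `<=` E -> cabs (\sum_(j <- E) f (i, j) - t i) < d.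
  by move=> i; exact: ht.
(* [E] is large enough both for [B * E] to contain [A] and for every row over [B] to be within [d]
   of its own sum. *)
pose E := (snd @` A) `|` \bigcup_(i <- B) D i.
have hE i : i \in B -> cabs (\sum_(j <- E) f (i, j) - t i) < d.
  move=> iB; apply: hD; rewrite fsubsetU//; apply/orP; right.
  exact: bigfcup_sup.
have AE : A `<=` B `*` E.
  apply/fsubsetP => -[x y] xyA; rewrite in_fsetM /=; apply/andP; split.
    by apply: (fsubsetP hB); apply/imfsetP; exists (x, y).
  by rewrite inE; apply/orP; left; apply/imfsetP; exists (x, y).
have h1 := hA _ AE.
have e1 : \sum_(p <- B `*` E) f p = \sum_(i <- B) \sum_(j <- E) f (i, j).
  exact: sum_fsetM.
rewrite e1 in h1.
have h2 : cabs (\sum_(i <- B) (\sum_(j <- E) f (i, j) - t i)) <= e / 2.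
  apply: le_trans (cabs_sum_le _ _) _.
  apply: (@le_trans _ _ (\sum_(i <- B) d)).
    by rewrite big_seq [leRHS]big_seq; apply: ler_sum => i /hE /ltW.
  by apply: sum_const_fset; lra.
have -> : \sum_(i <- B) t i - s = (\sum_(i <- B) \sum_(j <- E) f (i, j) - s)
    - \sum_(i <- B) (\sum_(j <- E) f (i, j) - t i).
  by rewrite big_split /= sumrN; ring.
by apply: le_lt_trans (cabsB _ _) _; lra.
Qed.

Lemma csum_fubini I J (f : I * J -> R[i]) : asum f ->
  csum (fun i => csum (fun j => f (i, j))) = csum f.
Proof.
move=> af; apply: has_sum_csum.
apply: (has_sum_fubini (asum_has_sum af)) => i.
by apply: asum_has_sum; exact: asum_slice.
Qed.

Lemma csum_fubiniC I J (f : I * J -> R[i]) : asum f ->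
  csum (fun j => csum (fun i => f (i, j))) = csum f.
Proof.
move=> af; have bs : bijective (fun p : J * I => (p.2, p.1)).
  by exists (fun p : I * J => (p.2, p.1)) => -[].
rewrite -(csum_reindex bs af) -csum_fubini//.
by apply: asum_reindex => //; exact: bij_inj.
Qed.

Lemma asum_prod I J (f : I -> R[i]) (g : J -> R[i]) :
  asum f -> asum g -> asum (fun p : I * J => f p.1 * g p.2).
Proof.
move=> [K hK] [L hL]; exists (K * L) => A.
have AE : A `<=` (fst @` A) `*` (snd @` A).
  apply/fsubsetP => -[x y] xyA; rewrite in_fsetM /=; apply/andP; split.
    by apply/imfsetP; exists (x, y).
  by apply/imfsetP; exists (x, y).
apply: le_trans (ler_sum_fset _ AE) _ => [i|]; first exact: cabs_ge0.
rewrite sum_fsetM /=.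
under eq_bigr => i _ do (under eq_bigr => j _ do rewrite cabsM; rewrite -mulr_sumr).
rewrite -mulr_suml ler_pM ?sumr_ge0// => i _; exact: cabs_ge0.
Qed.

Lemma sum_fsetU (V : nmodType) I (A B : {fset I}) (F : I -> V) : [disjoint A & B] ->
  \sum_(i <- A `|` B) F i = \sum_(i <- A) F i + \sum_(i <- B) F i.
Proof.
move=> dAB; rewrite (big_fsetID _ (mem A)) /=; congr (_ + _).
  by apply: eq_fbigl => x; rewrite !inE /=; case: (x \in A); rewrite ?andbF.
apply: eq_fbigl => x; rewrite !inE /= andbC; case: (boolP (x \in A)) => //= xA.
by have := fdisjointP dAB _ xA => /negbTE ->.
Qed.

(** Both [A] and [A] together with [B] have partial sums within [e / 2] of the total, so [B] alone
    contributes at most [e]. *)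
Lemma asum_tail I (g : I -> R[i]) (e : R) : asum g -> 0 < e ->
  exists A : {fset I}, forall B : {fset I}, [disjoint A & B] ->
    \sum_(i <- B) cabs (g i) <= e.
Proof.
move=> [K hK] e0.
have [|s hs] := @nonneg_has_sum _ (fun i => cabs (g i)) (fun i => cabs_ge0 _).
  by exists K => A; under eq_bigr => i _ do rewrite cabs_real ger0_norm ?cabs_ge0//.
have [A hA] := hs (e / 2) ltac:(lra); exists A => B dAB.
have h1 := hA _ (fsubset_refl A); have h2 := hA _ (fsubsetUl A B).
move: h1 h2; rewrite -!rmorph_sum -!rmorphB !cabs_real.
rewrite (sum_fsetU _ dAB).
by rewrite !ltr_norml; lra.
Qed.

(* Tannery's theorem for series tending to zero. *)
Lemma csum_dominated I (d : nat -> I -> R[i]) (g : I -> R[i]) :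
  asum g -> (forall N i, cabs (d N i) <= cabs (g i)) ->
  (forall i (e : R), 0 < e -> exists N0, forall N, (N0 <= N)%N -> cabs (d N i) < e) ->
  forall e : R, 0 < e -> exists N0, forall N, (N0 <= N)%N -> cabs (csum (d N)) < e.
Proof.
move=> ag dg hd e e0.
have [A hA] := asum_tail ag (divr_gt0 e0 (ltr0n _ 4)).
pose h := e / 4 / (#|` A|%:R + 1).
have h0 : 0 < h by rewrite divr_gt0 ?ltr_wpDl//; lra.
have /boolp.choice [D hD] : forall i, exists Di, forall N, (Di <= N)%N ->
    cabs (d N i) < h.
  by move=> i; exact: hd.
exists (\max_(i <- A) D i)%N => N hN.
suff : cabs (csum (d N)) <= e / 2 by lra.
apply: csum_bound => B; rewrite (big_fsetID _ (mem A)) /=.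
have : \sum_(i <- [fset x in B | x \notin A]) cabs (d N i) <= e / 4.
  apply: le_trans (hA [fset x in B | x \notin A] _).
    by apply: ler_sum.
  by apply/fdisjointP => x xA; rewrite !inE /= xA andbF.
suff : \sum_(i <- [fset x in B | x \in A]) cabs (d N i) <= e / 4 by lra.
apply: le_trans (ler_sum_fset (B := A) _ _) _ => [i||]; first exact: cabs_ge0.
  by apply/fsubsetP => x; rewrite !inE /= => /andP[].
apply: (@le_trans _ _ (\sum_(i <- A) h)).
  rewrite big_seq [leRHS]big_seq; apply: ler_sum => i iA; apply/ltW/hD.
  apply: leq_trans hN; by apply: (leq_bigmax_seq (P := xpredT)).
by apply: sum_const_fset; lra.
Qed.

Lemma finite_has_sum I (f : I -> R[i]) (A : {fset I}) :
  (forall i, i \notin A -> f i = 0) -> has_sum f (\sum_(i <- A) f i).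
Proof.
move=> hf e e0; exists A => B AB.
rewrite (big_fset_incl _ AB) ?subrr ?cabs0// => x _; exact: hf.
Qed.

Lemma has_sum_bigsum I (K : Type) (r : seq K) (f : K -> I -> R[i]) (s : K -> R[i]) :
  (forall k, has_sum (f k) (s k)) ->
  has_sum (fun i => \sum_(k <- r) f k i) (\sum_(k <- r) s k).
Proof.
move=> hf; elim: r => [|k r IH].
  rewrite big_nil; have := finite_has_sum (f := fun i => \sum_(k <- [::]) f k i) (A := fset0).
  by rewrite big_seq_fset0; apply => i _; rewrite big_nil.
rewrite big_cons (_ : (fun i => _) = (fun i => f k i + \sum_(k <- r) f k i)).
  exact: has_sumD.
by apply/funext => i; rewrite big_cons.
Qed.

(** Theta series at purely imaginary points are of this kind; it provides the nonzero values by
    which unknown constants are later divided out. *)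
Lemma nonneg_sum_neq0 I (g : I -> R) (i0 : I) (s : R[i]) :
  (forall i, 0 <= g i) -> 0 < g i0 -> has_sum (fun i => (g i)%:C) s -> s != 0.
Proof.
move=> g0 gi hs; apply/eqP => s0; rewrite s0 in hs.
have [A hA] := hs _ gi; have := hA _ (fsubsetUr [fset i0] A).
rewrite subr0 -rmorph_sum cabs_real ger0_norm ?sumr_ge0//.
have := ler_sum_fset g0 (fsubsetUl [fset i0] A); rewrite big_seq_fset1; lra.
Qed.

End UnconditionalSums.

(** * The complex exponential *)

Section ComplexExponential.
Variable R : realType.
Implicit Types x y t : R.

Lemma cexpD (z w : R[i]) : cexp (z + w) = cexp z * cexp w.
Proof.
case: z w => a b [c d]; rewrite /cexp /= expRD cosD sinD.
by apply/eqP; rewrite eq_complex /=; apply/andP; split; apply/eqP; ring.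
Qed.

Lemma cexp0 : cexp (0 : R[i]) = 1.
Proof. by rewrite /cexp /= expR0 cos0 sin0 mul1r. Qed.

Lemma cabs_cexp (z : R[i]) : cabs (cexp z) = expR (Re z).
Proof.
rewrite /cexp cabsM cabs_real ger0_norm ?expR_ge0//.
by rewrite /ComplexField.Normc.normc cos2Dsin2 sqrtr1 mulr1.
Qed.

Lemma cexp_neq0 (z : R[i]) : cexp z != 0.
Proof. by rewrite -cabs_gt0 cabs_cexp expR_gt0. Qed.

Lemma cexpN (z : R[i]) : cexp (- z) = (cexp z)^-1.
Proof.
by apply: (mulfI (cexp_neq0 z)); rewrite divff ?cexp_neq0// -cexpD subrr cexp0.
Qed.

Lemma cexp_real x : cexp x%:C = (expR x)%:C.
Proof. by rewrite /cexp /= cos0 sin0 -[RHS]mulr1. Qed.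

Definition unit_exp x : R[i] := cexp (2 * pi%:C * 'i * x%:C).

Lemma unit_expE x : unit_exp x = cos (2 * pi * x) +i* sin (2 * pi * x).
Proof.
rewrite /unit_exp (_ : 2 * _ * _ * _ = 0 +i* (2 * pi * x)); last first.
  by apply/eqP; rewrite eq_complex /=; apply/andP; split; apply/eqP; ring.
by rewrite /cexp /= expR0 mul1r.
Qed.

Lemma unit_expD x y : unit_exp (x + y) = unit_exp x * unit_exp y.
Proof.
rewrite /unit_exp -cexpD; congr cexp.
by rewrite (_ : (x + y)%:C = x%:C + y%:C) ?mulrDr// -rmorphD.
Qed.

Lemma unit_exp0 : unit_exp 0 = 1.
Proof. by rewrite /unit_exp mulr0 cexp0. Qed.

Lemma unit_expN x : unit_exp (- x) = (unit_exp x)^-1.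
Proof. by rewrite /unit_exp rmorphN mulrN cexpN. Qed.

Lemma cabs_unit_exp x : cabs (unit_exp x) = 1.
Proof. by rewrite unit_expE /ComplexField.Normc.normc cos2Dsin2 sqrtr1. Qed.

Lemma unit_exp_nat n : unit_exp n%:R = 1.
Proof.
elim: n => [|n IH]; first exact: unit_exp0.
rewrite -addn1 natrD unit_expD IH mul1r unit_expE mulr1 mulr_natl.
by rewrite cos2pi sin2pi.
Qed.

Lemma unit_exp_int (n : int) : unit_exp n%:~R = 1.
Proof.
case: n => n; first exact: unit_exp_nat.
by rewrite NegzE mulrNz unit_expN unit_exp_nat invr1.
Qed.

Lemma unit_expX x n : unit_exp x ^+ n = unit_exp (n%:R * x).
Proof.
elim: n => [|n IH]; first by rewrite mul0r unit_exp0.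
by rewrite exprS IH -unit_expD -{1}[x]mul1r -mulrDl -natr1 addrC.
Qed.

Lemma sin_abs_le x : `|sin x| <= `|x|.
Proof.
wlog x0 : x / 0 <= x.
  move=> h; case: (leP 0 x) => [/h//|x0].
  by have := h (- x); rewrite sinN !normrN; apply; lra.
move: x0; rewrite le_eqVlt => /orP[/eqP <-|x0]; first by rewrite sin0.
have [|c _] := @MVT R sin cos 0 x x0 (fun y _ => is_derive_sin y).
  by apply: continuous_subspaceT => y; exact: continuous_sin.
rewrite sin0 !subr0 => ->; rewrite normrM ler_piMl//; exact: cos_max.
Qed.

Lemma one_sub_cos x : 1 - cos x = 2 * sin (x / 2) ^+ 2.
Proof.
rewrite -{1}[x](divfK (_ : 2 != 0))// mulr_natr cos_mulr2n cos2sin2.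
by rewrite mulr2n; ring.
Qed.

Lemma one_sub_cos_le x : 1 - cos x <= x ^+ 2 / 2.
Proof.
rewrite one_sub_cos -(real_normK (num_real (sin _))).
have := @sin_abs_le (x / 2); rewrite normrM (ger0_norm (_ : 0 <= 2^-1)) ?invr_ge0//.
have := normr_ge0 (sin (x / 2)); have := real_normK (num_real x).
by move: `|x| `|sin _| => a b <- b0 hb; nra.
Qed.

Lemma one_sub_cos_le1 x : `|1 - cos x| <= `|x|.
Proof.
have := one_sub_cos_le x; have := cos_le1 x; have := cos_geN1 x => h1 h2 h3.
rewrite ger0_norm; last lra.
have := real_normK (num_real x); have := normr_ge0 x => h4 h5.
have [h|h] := leP 2 `|x|; first lra.
by rewrite (le_trans h3)// -h5; nra.
Qed.

Lemma sin_sub_le x : `|sin x - x| <= x ^+ 2.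
Proof.
wlog x0 : x / 0 <= x.
  move=> h; case: (leP 0 x) => [/h//|x0].
  have := h (- x); rewrite sinN sqrrN -opprD normrN; apply; lra.
move: x0; rewrite le_eqVlt => /orP[/eqP <-|x0].
  by rewrite sin0 subrr normr0 expr0n.
have [|c /[!in_itv]/= /andP[c0 cx]] := @MVT R sin cos 0 x x0 (fun y _ => is_derive_sin y).
  by apply: continuous_subspaceT => y; exact: continuous_sin.
rewrite sin0 !subr0 => ->.
have -> : cos c * x - x = - ((1 - cos c) * x) by ring.
have := one_sub_cos_le1 c; rewrite normrN normrM !(gtr0_norm c0) (gtr0_norm x0).
have := normr_ge0 (1 - cos c); move: `|1 - cos c| => d; nra.
Qed.

(** The inequality [1 + y <= e^y] at [y = - x] gives [e^x - 1 <= x e^x], an upper bound for either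
    sign of [x]. *)
Lemma expR_taylor1 x : `|expR x - 1 - x| <= x ^+ 2 * (1 + expR x).
Proof.
have h1 := expR_ge1Dx x; rewrite ger0_norm; last lra.
have e0 := expR_gt0 x.
have h2 : (1 - x) * expR x <= 1.
  have := expR_ge1Dx (- x); rewrite expRN => h.
  have := ler_wpM2r (ltW e0) h; rewrite mulVf; first lra.
  by rewrite gt_eqF.
have [x0|x0] := leP 0 x; first nra.
have e1 : expR x < 1 by rewrite expR_lt1.
nra.
Qed.

Lemma expR_sub1 x : `|expR x - 1| <= `|x| * (1 + expR x).
Proof.
have h1 := expR_ge1Dx x; have e0 := expR_gt0 x.
have h2 : (1 - x) * expR x <= 1.
  have := expR_ge1Dx (- x); rewrite expRN => h.
  have := ler_wpM2r (ltW e0) h; rewrite mulVf; first lra.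
  by rewrite gt_eqF.
have [x0|x0] := leP 0 x.
  rewrite (ger0_norm x0) ger0_norm; nra.
have e1 : expR x < 1 by rewrite expR_lt1.
rewrite (ltr0_norm x0) ltr0_norm; nra.
Qed.

(** The factor [1 + expR (Re w)] replaces any smallness assumption on [w]: multiplied by the modulus
    of a Gaussian at one end of a step, it becomes the sum of the moduli at both ends. *)
Lemma cexp_taylor1 (w : R[i]) :
  cabs (cexp w - 1 - w) <= 6 * cabs w ^+ 2 * (1 + expR (Re w)).
Proof.
rewrite sqr_cabs; apply: le_trans (cabs_le_ReIm _) _; case: w => x y /=.
set E := expR x; have E0 : 0 < E := expR_gt0 x.
have h1 : `|E * cos y - 1 - x| <= x ^+ 2 * (1 + E) + E * y ^+ 2.
  have -> : E * cos y - 1 - x = (E - 1 - x) - E * (1 - cos y) by ring.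
  apply: le_trans (ler_normB _ _) _; apply: lerD; first exact: expR_taylor1.
  rewrite normrM gtr0_norm// ler_pM2l// ger0_norm.
    by apply: le_trans (one_sub_cos_le _) _; have := sqr_ge0 y; lra.
  by have := cos_le1 y; lra.
have h2 : `|E * sin y - y| <= E * y ^+ 2 + `|y| * (`|x| * (1 + E)).
  have -> : E * sin y - y = E * (sin y - y) + y * (E - 1) by ring.
  apply: le_trans (ler_normD _ _) _; rewrite !normrM (gtr0_norm E0); apply: lerD.
    by rewrite ler_pM2l//; exact: sin_sub_le.
  by rewrite ler_wpM2l//; exact: expR_sub1.
have h3 : `|y| * `|x| <= x ^+ 2 + y ^+ 2.
  rewrite -(real_normK (num_real x)) -(real_normK (num_real y)).
  by move: `|x| `|y| => a b; nra.
have h4 : `|y| * (`|x| * (1 + E)) <= (x ^+ 2 + y ^+ 2) * (1 + E).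
  by rewrite mulrA ler_wpM2r//; lra.
rewrite (_ : E * sin y + 0 * cos y - 0 - y = E * sin y - y); last by ring.
rewrite (_ : E * cos y - 0 * sin y - 1 - x = E * cos y - 1 - x); last by ring.
have := sqr_ge0 x; have := sqr_ge0 y; move: (x ^+ 2) (y ^+ 2) h1 h2 h4 => a b; nra.
Qed.

(** Up to 1 the mean value theorem gives [sin y >= y / 2], since the cosine is at least 1/2 there;
    beyond 1, monotonicity gives [sin x >= 1 / 2], and [x <= pi / 2 < 2]. *)
Lemma sin_ge_quarter x : 0 <= x -> x <= pi / 2 -> x / 4 <= sin x.
Proof.
rewrite le_eqVlt => /orP[/eqP <-|x0] xpi; first by rewrite sin0 mul0r.
have small y : 0 < y -> y <= 1 -> y / 2 <= sin y.
  move=> y0 y1.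
  have [|c /[!in_itv]/= /andP[c0 cx]] := @MVT R sin cos 0 y y0 (fun y _ => is_derive_sin y).
    by apply: continuous_subspaceT => z; exact: continuous_sin.
  rewrite sin0 !subr0 => ->; have := one_sub_cos_le c; nra.
have p2 := @pihalf_lt2 R; have p1 := @pihalf_ge1 R.
have [x1|x1] := leP x 1; first by have := small x x0 x1; lra.
have : sin 1 < sin x by rewrite ltr_sin// in_itv /=; lra.
by have := small 1 ltr01 (lexx _); lra.
Qed.

(** A second difference multiplies a Fourier coefficient by this chord, [- 4 sin^2 (pi x)]. Its
    lower bound on [|x| <= 1/2] is why the frequencies are later centred at 0. *)
Lemma unit_exp_chord x : `|x| <= 1 / 2 ->
  x ^+ 2 <= cabs (unit_exp x + unit_exp (- x) - 2).
Proof.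
move=> hx.
have -> : unit_exp x + unit_exp (- x) - 2 = (- (4 * sin (pi * x) ^+ 2))%:C.
  rewrite !unit_expE mulrN cosN sinN.
  have := one_sub_cos (2 * pi * x); rewrite (_ : 2 * pi * x / 2 = pi * x) => [h|]; last by lra.
  apply/eqP; rewrite eq_complex /=; apply/andP; split; apply/eqP; lra.
have s0 := sqr_ge0 (sin (pi * x)).
rewrite cabs_real normrN ger0_norm; last lra.
move=> {s0}; wlog x0 : x hx / 0 <= x.
  move=> h; case: (leP 0 x) => [/(h _ hx)//|x0].
  by have := h (- x); rewrite normrN mulrN sinN !sqrrN; apply=> //; lra.
rewrite ger0_norm// in hx.
have p2 := @pi_ge2 R.
have := @sin_ge_quarter (pi * x) ltac:(nra) ltac:(nra) => h.
have : x / 2 <= sin (pi * x) by nra.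
nra.
Qed.

End ComplexExponential.

(** * Gaussians in a complex direction *)

Section Gaussian.
Variable R : realType.
Implicit Types (x y t h s : R) (u e : R[i]).

Definition gauss (u : R[i]) : R[i] := cexp (- (pi%:C * u ^+ 2)).

Lemma cabs_gauss u : cabs (gauss u) = expR (- (pi * (Re u ^+ 2 - Im u ^+ 2))).
Proof. by rewrite cabs_cexp; case: u => a b /=; congr expR; ring. Qed.

(** From [y^3 / 3! <= e^y] at [y = d (1 + t^2)] and [(1 + |t|)^6 <= 8 (1 + t^2)^3], whence 48 = 8 *
    3!. Of the six powers, the Taylor remainders below use up to four, and two remain as a summable
    weight. *)
Lemma gauss_poly (d : R) : 0 < d ->
  exists2 K, 0 < K & forall t, (1 + `|t|) ^+ 6 * expR (- (d * t ^+ 2)) <= K.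
Proof.
move=> d0; exists (48 * expR d / d ^+ 3) => [|t].
  by rewrite divr_gt0 ?mulr_gt0 ?expR_gt0 ?exprn_gt0.
have y0 : 0 <= d * (1 + t ^+ 2) by rewrite mulr_ge0 ?ltW// ltr_wpDr ?sqr_ge0.
have := expR_ge1Dxn 2 y0; rewrite mulrDr mulr1 expRD => h.
rewrite expRN ler_pdivrMr ?expR_gt0// mulrAC ler_pdivlMr ?exprn_gt0//.
have h1 : (1 + `|t|) ^+ 6 <= 8 * (1 + t ^+ 2) ^+ 3.
  have : (1 + `|t|) ^+ 2 <= 2 * (1 + t ^+ 2).
    by rewrite -(real_normK (num_real t)); have := sqr_ge0 (1 - `|t|); nra.
  move=> h2; have t2 := sqr_ge0 t; have t3 := sqr_ge0 (1 + `|t|).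
  have : ((1 + `|t|) ^+ 2) ^+ 3 <= (2 * (1 + t ^+ 2)) ^+ 3.
    by rewrite lerXn2r// nnegrE//; nra.
  rewrite -exprM exprMn; lra.
have h2 : (d + d * t ^+ 2) ^+ 3 = (1 + t ^+ 2) ^+ 3 * d ^+ 3 by ring.
have h3 : (1 + `|t|) ^+ 6 * d ^+ 3 <= 8 * ((1 + t ^+ 2) ^+ 3 * d ^+ 3).
  by rewrite mulrA ler_pM2r ?exprn_gt0.
move: h; rewrite h2 => h.
have f3 : (3`!%:R : R) = 6 by [].
rewrite f3 in h.
by rewrite -mulrA; lra.
Qed.

(* The sector |Im alpha| < Re alpha is where Re (alpha ^ 2) > 0, so that the Gaussian decays
   along every line of direction alpha. *)
Lemma gauss_sector (k L r : R) : 0 < k ->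
  exists2 K, 0 < K & forall (al be : R[i]) t,
    k <= Re al - Im al -> k <= Re al + Im al -> Re al - Im al <= L -> Re al + Im al <= L ->
    `|Re be| + `|Im be| <= r ->
    (1 + `|t|) ^+ 6 * cabs (gauss (al * t%:C + be)) <= K.
Proof.
move=> k0; have p0 := @pi_gt0 R.
have [K K0 hK] := @gauss_poly (pi * (k ^+ 2 / 2)) ltac:(rewrite mulr_gt0// divr_gt0 ?exprn_gt0//).
exists (K * expR (pi * (2 * (L * r / k) ^+ 2 + r ^+ 2))); first by rewrite mulr_gt0 ?expR_gt0.
move=> [a b] [p q] t /= h1 h2 h3 h4 h5.
rewrite cabs_gauss /=.
set x := a * t - b * 0 + p; set y := a * 0 + b * t + q.
apply: (@le_trans _ _ ((1 + `|t|) ^+ 6 * (expR (- (pi * (k ^+ 2 / 2) * t ^+ 2)) *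
   expR (pi * (2 * (L * r / k) ^+ 2 + r ^+ 2))))); last first.
  by rewrite [leLHS]mulrA ler_pM2r ?expR_gt0.
rewrite ler_wpM2l ?exprn_ge0 ?addr_ge0// -expRD ler_expR.
rewrite -[pi * _ * _]mulrA -2![- (pi * _)]mulrN -mulrDr ler_pM2l//.
(* The exponent factors into two linear functions of [t] with slopes [Re al - Im al] and
   [Re al + Im al]; this is why the hypotheses bound these two numbers. *)
have -> : x ^+ 2 - y ^+ 2 = ((a - b) * t + (p - q)) * ((a + b) * t + (p + q)).
  by rewrite /x /y; ring.
have hm : `|p - q| <= r by apply: le_trans h5; exact: ler_normB.
have hp : `|p + q| <= r by apply: le_trans h5; exact: ler_normD.
have r0 : 0 <= r by apply: le_trans hp.
move: {a b p q x y h5} (a - b) (a + b) (p - q) (p + q) h1 h2 h3 h4 hm hp => A B P Q h1 h2 h3 h4 hm hp.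
have -> : (A * t + P) * (B * t + Q) = A * B * t ^+ 2 + (A * Q + B * P) * t + P * Q by ring.
have e1 : k ^+ 2 * t ^+ 2 <= A * B * t ^+ 2.
  by rewrite ler_wpM2r ?sqr_ge0//; nra.
have e2 : `|(A * Q + B * P) * t| <= 2 * L * r * `|t|.
  rewrite normrM ler_wpM2r//; apply: le_trans (ler_normD _ _) _; rewrite !normrM.
  rewrite (gtr0_norm (_ : 0 < A)); last lra.
  rewrite (gtr0_norm (_ : 0 < B)); last lra.
  have := normr_ge0 P; have := normr_ge0 Q; nra.
have e3 : `|P * Q| <= r ^+ 2.
  by rewrite normrM; have := normr_ge0 P; have := normr_ge0 Q; nra.
(* The cross term is absorbed by half of the quadratic term, which leaves the rate [k ^+ 2 / 2] fed
   to [gauss_poly]. *)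
have e4 : 2 * L * r * `|t| <= k ^+ 2 / 2 * t ^+ 2 + 2 * (L * r / k) ^+ 2.
  rewrite -[t ^+ 2](real_normK (num_real t)).
  have := sqr_ge0 (k * `|t| - 2 * (L * r / k)).
  have -> : (k * `|t| - 2 * (L * r / k)) ^+ 2 =
     k ^+ 2 * `|t| ^+ 2 - 4 * (L * r * `|t|) + 4 * (L * r / k) ^+ 2.
    by field; rewrite gt_eqF.
  lra.
move: e2 e3; rewrite !ler_norml => /andP[e2 _] /andP[e3 _].
by lra.
Qed.

(** Here 24 pi^2 = 6 (2 pi)^2: the 6 of [cexp_taylor1] times the square of the factor [2 pi] in the
    bound on the exponent increment. The last [pi] pays for the term [pi e^2] that the linear
    approximation drops. *)
Definition gauss_const : R := 24 * pi ^+ 2 + pi.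

Lemma gauss_const_gt0 : 0 < gauss_const.
Proof. by rewrite ltr_wpDl ?pi_gt0// mulr_ge0 ?sqr_ge0. Qed.

Lemma gauss_taylor u e :
  cabs (gauss (u + e) - gauss u * (1 - 2 * pi%:C * u * e)) <=
  gauss_const * cabs e ^+ 2 * (1 + cabs u + cabs e) ^+ 2 *
    (cabs (gauss u) + cabs (gauss (u + e))).
Proof.
pose w : R[i] := - (pi%:C * (2 * u * e + e ^+ 2)).
have E : gauss (u + e) = gauss u * cexp w.
  by rewrite /gauss -cexpD; congr cexp; rewrite /w; ring.
have -> : gauss (u + e) - gauss u * (1 - 2 * pi%:C * u * e) =
    gauss u * (cexp w - 1 - w) - gauss u * (pi%:C * e ^+ 2).
  by rewrite E /w; ring.
apply: le_trans (cabsB _ _) _; have p0 : 0 < pi :> R := pi_gt0 R.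
rewrite 2!(cabsM (gauss u)) (cabsM pi%:C) cabsX cabs_real gtr0_norm//.
rewrite E cabsM cabs_cexp.
have hw : cabs w <= 2 * pi * cabs e * (1 + cabs u + cabs e).
  rewrite /w cabsN cabsM cabs_real gtr0_norm//.
  have u0 := cabs_ge0 u; have e0 := cabs_ge0 e.
  apply: (@le_trans _ _ (pi * (2 * cabs u * cabs e + cabs e ^+ 2))).
    rewrite ler_pM2l//; apply: le_trans (cabsD _ _) _; rewrite cabsX !cabsM.
    by rewrite -[2 : R[i]](rmorph_nat (real_complex R)) cabs_real normr_nat.
  have := mulr_ge0 (ltW p0) e0; have := mulr_ge0 (ltW p0) (sqr_ge0 (cabs e)).
  lra.
have h := cexp_taylor1 w.
have g0 : 0 < cabs (gauss u) by rewrite cabs_cexp expR_gt0.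
set X := expR (Re w) in h *; have X0 : 0 < X := expR_gt0 _.
set D := (1 + cabs u + cabs e) in hw *.
have D1 : 1 <= D by rewrite /D -addrA lerDl addr_ge0// cabs_ge0.
have w2 : cabs w ^+ 2 <= 4 * pi ^+ 2 * cabs e ^+ 2 * D ^+ 2.
  apply: (@le_trans _ _ ((2 * pi * cabs e * D) ^+ 2)); last by rewrite !exprMn (_ : 2 ^+ 2 = 4) // -natrX.
  by rewrite lerXn2r// nnegrE ?cabs_ge0// (le_trans _ hw)// cabs_ge0.
have e0 := sqr_ge0 (cabs e).
have h2 : cabs (cexp w - 1 - w) <= 24 * pi ^+ 2 * cabs e ^+ 2 * D ^+ 2 * (1 + X).
  apply: le_trans h _; rewrite ler_wpM2r//; first lra.
  by rewrite -!mulrA in w2 *; lra.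
have h3 : pi * cabs e ^+ 2 <= pi * cabs e ^+ 2 * D ^+ 2 * (1 + X).
  have d2 : 1 <= D ^+ 2 by rewrite exprn_ege1.
  by rewrite -[leRHS]mulrA ler_peMr//; [exact: mulr_ge0 (ltW p0) e0|nra].
rewrite /gauss_const (_ : cabs (gauss u) + cabs (gauss u) * X = cabs (gauss u) * (1 + X)); last by ring.
apply: (@le_trans _ _ (cabs (gauss u) * (24 * pi ^+ 2 * cabs e ^+ 2 * D ^+ 2 * (1 + X))
  + cabs (gauss u) * (pi * cabs e ^+ 2 * D ^+ 2 * (1 + X)))).
  by rewrite lerD// ler_pM2l.
by rewrite le_eqVlt; apply/orP; left; apply/eqP; ring.
Qed.

Lemma sqr_sum_le9 (a b : R) : 0 <= a -> a <= b -> 1 <= b -> (1 + b + a) ^+ 2 <= 9 * b ^+ 2.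
Proof.
move=> a0 ab b1; rewrite (_ : 9 * _ = (3 * b) ^+ 2); last by ring.
by rewrite lerXn2r ?nnegrE; lra.
Qed.

Lemma gauss_taylor_le u e (a b g : R) :
  cabs e <= a -> cabs u <= b -> cabs (gauss u) <= g -> cabs (gauss (u + e)) <= g ->
  cabs (gauss (u + e) - gauss u * (1 - 2 * pi%:C * u * e)) <=
  gauss_const * a ^+ 2 * (1 + b + a) ^+ 2 * (2 * g).
Proof.
move=> he hu h1 h2; apply: le_trans (gauss_taylor _ _) _.
have c0 := gauss_const_gt0; have := cabs_ge0 e; have := cabs_ge0 u => u0 e0.
apply: ler_pM.
- by rewrite mulr_ge0 ?exprn_ge0//; [rewrite mulr_ge0 ?exprn_ge0// ltW|lra].
- by rewrite addr_ge0 ?cabs_ge0.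
- apply: ler_pM.
  + by rewrite mulr_ge0 ?exprn_ge0// ltW.
  + by rewrite exprn_ge0//; lra.
  + by rewrite ler_pM2l// lerXn2r// nnegrE//; lra.
  + by rewrite lerXn2r ?nnegrE//; lra.
- by lra.
Qed.

End Gaussian.

(** * Riemann sums over hZ, with bounds uniform in the mesh h *)

Section RiemannSums.
Variable R : realType.
Implicit Types (x t h s : R) (y : int).

Lemma sum_int_le (g : int -> R) (K : R) : (forall y, 0 <= g y) ->
  (forall n, \sum_(i < n) g (Posz i) + \sum_(i < n) g (Negz i) <= K) ->
  forall A : {fset int}, \sum_(y <- A) g y <= K.
Proof.
move=> g0 hK A; pose n := (\max_(y <- A) `|y|%N).+1.
apply: le_trans (hK n).
pose P := [fset Posz (nat_of_ord i) | i in 'I_n]%fset.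
pose Q := [fset Negz (nat_of_ord i) | i in 'I_n]%fset.
have dPQ : [disjoint P & Q]%fset.
  by apply/fdisjointP => y /imfsetP[i _ ->]; apply/negP => /imfsetP[j].
have AB : (A `<=` P `|` Q)%fset.
  apply/fsubsetP => y yA; rewrite !inE.
  have yn : (`|y| < n)%N by rewrite ltnS; apply: (leq_bigmax_seq (P := xpredT)).
  case: y yA yn => k kA kn; apply/orP; [left|right]; apply/imfsetP.
    by exists (Ordinal kn).
  by exists (Ordinal (ltnW kn : (k < n)%N)).
apply: le_trans (ler_sum_fset g0 AB) _; rewrite sum_fsetU//.
rewrite !big_imfset /=; try by move=> i j _ _ [] /val_inj.
by rewrite !big_enum.
Qed.

Definition riemann_wt h (y : int) : R := h / (1 + `|y%:~R * h|) ^+ 2.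

Lemma riemann_wt_ge0 h y : 0 <= h -> 0 <= riemann_wt h y.
Proof. by move=> h0; rewrite divr_ge0// exprn_ge0// addr_ge0. Qed.

(** The negative half telescopes: with [a = 1 + n h], [h / (a + h)^2 <= 1 / a - 1 / (a + h)], so it
    is at most 1. A term of the other half is at most 4 times its neighbour in the negative half,
    because [a + h <= 2 a]. Hence 5 = 1 + 4, independently of [h]. *)
Lemma riemann_wt_sum h (A : {fset int}) : 0 < h -> h <= 1 ->
  \sum_(y <- A) riemann_wt h y <= 5.
Proof.
move=> h0 h1; apply: sum_int_le => [y|n]; first exact/riemann_wt_ge0/ltW.
have hneg : \sum_(i < n) riemann_wt h (Negz i) <= 1 - (1 + n%:R * h)^-1.
  elim: n => [|n IH]; first by rewrite big_ord0 mul0r addr0 invr1 subrr.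
  rewrite big_ord_recr /=; apply: le_trans (lerD IH (lexx _)) _.
  rewrite /riemann_wt NegzE mulrNz mulNr normrN ger0_norm; last first.
    by apply: mulr_ge0; [rewrite ler0z|exact: ltW].
  rewrite -pmulrn -natr1.
  have n0 : 0 <= n%:R * h by rewrite mulr_ge0// ltW.
  set a := 1 + n%:R * h; have a1 : 1 <= a by rewrite /a; lra.
  have -> : 1 + (n%:R + 1) * h = a + h by rewrite /a; ring.
  rewrite -subr_ge0 (_ : _ - _ = h ^+ 2 / (a * (a + h) ^+ 2)).
    apply: divr_ge0; first exact: sqr_ge0.
    by apply: mulr_ge0; [lra|exact: sqr_ge0].
  by field; rewrite !gt_eqF//; lra.
have hpos : \sum_(i < n) riemann_wt h (Posz i) <= 4 * \sum_(i < n) riemann_wt h (Negz i).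
  rewrite mulr_sumr; apply: ler_sum => -[i _] _ /=.
  rewrite /riemann_wt NegzE mulrNz mulNr normrN !ger0_norm; try by apply: mulr_ge0; [rewrite ler0z|exact: ltW].
  have -> : (Posz i.+1)%:~R = i%:R + 1 :> R by rewrite -pmulrn natr1.
  have -> : (Posz i)%:~R = i%:R :> R by rewrite -pmulrn.
  have n0 : 0 <= i%:R * h by rewrite mulr_ge0// ltW.
  set a := 1 + i%:R * h; have a1 : 1 <= a by rewrite /a; lra.
  have -> : 1 + (i%:R + 1) * h = a + h by rewrite /a; ring.
  rewrite mulrCA ler_pM2l// -ler_pdivrMl// -invfM.
  have a0 : 0 < a by lra.
  have ah0 : 0 < a + h by lra.
  rewrite lef_pV2 ?posrE; [nra|by rewrite mulr_gt0// exprn_gt0|exact: exprn_gt0].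
have : 0 < (1 + n%:R * h)^-1 by rewrite invr_gt0 ltr_pwDl// mulr_ge0// ltW.
lra.
Qed.

Lemma riemann_sum_bound (f : int -> R[i]) h (C : R) : 0 < h -> h <= 1 -> 0 <= C ->
  (forall y, cabs (f y) <= C * riemann_wt h y) ->
  asum f /\ cabs (csum f) <= 5 * C.
Proof.
move=> h0 h1 C0 hf.
have hA (A : {fset int}) : \sum_(y <- A) cabs (f y) <= 5 * C.
  apply: (@le_trans _ _ (\sum_(y <- A) C * riemann_wt h y)); first exact: ler_sum.
  by rewrite -mulr_sumr mulrC ler_wpM2r// riemann_wt_sum.
by split; [exists (5 * C)|exact: csum_bound].
Qed.

End RiemannSums.

(** * Moving a Riemann sum from a complex line to the real line *)

Section ContourRotation.
Variables (R : realType) (al be : R[i]).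
Hypothesis al_sector : `|Im al| < Re al.
Implicit Types (t h s : R).

(** [pt] interpolates between the real line ([s = 0]) and the line [al t + be] ([s = 1]).
    [Ep dt + Vp ds] is the pullback of exp(-pi u^2) du along [pt], so closedness reads: the
    s-derivative of [Ep] equals the t-derivative of [Vp]. *)
Let dal : R[i] := al - 1.
Let alp s : R[i] := 1 + s%:C * dal.
Let pt s t : R[i] := alp s * t%:C + s%:C * be.
Let Ep s t : R[i] := alp s * gauss (pt s t).
Let Vp s t : R[i] := (dal * t%:C + be) * gauss (pt s t).

(** Both 1 and [al] lie in the convex sector with margin [k], hence so does every direction [alp s],
    and the constant is uniform in [s]. *)
Lemma gauss_path : exists2 K, 0 < K & forall s t, 0 <= s <= 1 ->
  (1 + `|t|) ^+ 6 * cabs (gauss (pt s t)) <= K.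
Proof.
pose k := Num.min 1 (Re al - `|Im al|).
have k0 : 0 < k by rewrite lt_min ltr01 subr_gt0.
have [k1 k2] : k <= 1 /\ k <= Re al - `|Im al|.
  by split; rewrite ge_min lexx ?orbT.
have [K K0 hK] := @gauss_sector R k (1 + Re al + `|Im al|) (`|Re be| + `|Im be|) k0.
exists K => // s t /andP[s0 s1]; apply: hK.
all: rewrite /alp /dal; move: k1 k2; case: (al) => a b /=;
  have := ler_norm b; have := ler_norm (- b); rewrite normrN; move: `|b| k k0 => c k k0 b1 b2 k1 k2.
- nra.
- nra.
- nra.
- nra.
- case: (be) => p q /=; rewrite !mul0r subr0 addr0 !normrM ger0_norm//.
  by have := normr_ge0 p; have := normr_ge0 q; nra.
Qed.

(** A discrete form of closedness: the two first differences agree up to second order, with a bound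
    summable in [t]. *)
Lemma contour_rotation_step : exists2 C, 0 < C & forall s h t,
  0 <= s -> 0 < h -> s + h <= 1 ->
  cabs (Ep (s + h) t - Ep s t - Vp s (t + h) + Vp s t) <= h ^+ 2 * C / (1 + `|t|) ^+ 2.
Proof.
have [K K0 hK] := gauss_path.
pose M := 1 + cabs dal + cabs be.
have dal0 := cabs_ge0 dal; have be0 := cabs_ge0 be.
(* 64 = 2^6: since [h <= 1], [1 + |t| <= 2 (1 + |t + h|)], so that one bound [g] serves at [t] and
   at [t + h]. *)
pose K' := 64 * K; have K'0 : 0 < K' by rewrite mulr_gt0.
have p0 : 0 < pi :> R := pi_gt0 R.
have c0 := gauss_const_gt0 R.
have M1 : 1 <= M by rewrite /M; lra.
have M0 : 0 < M by lra.
exists (72 * gauss_const R * M ^+ 5 * K' + 4 * pi * M ^+ 3 * K').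
  by rewrite addr_gt0// !mulr_gt0 ?exprn_gt0.
move=> s h t s0 h0 sh1.
set T := 1 + `|t|.
have T1 : 1 <= T by rewrite lerDl.
have T0 : 0 < T by lra.
pose g := K' / T ^+ 6.
have g0 : 0 < g by rewrite divr_gt0 ?exprn_gt0.
have gT : g * T ^+ 6 = K' by rewrite /g divfK// gt_eqF ?exprn_gt0.
have gle (G : R) : T ^+ 6 * G <= K' -> G <= g.
  by rewrite /g ler_pdivlMr ?exprn_gt0// mulrC.
pose u := pt s t; pose a := alp s; pose l := dal * t%:C + be.
have G0 : cabs (gauss u) <= g.
  by apply: gle; rewrite /K'; have := hK s t ltac:(lra); rewrite -/u -/T; lra.
have e1 : pt (s + h) t = u + h%:C * l.
  by rewrite /u /l /pt /alp !realCD; ring.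
have e2 : pt s (t + h) = u + h%:C * a.
  by rewrite /u /a /pt /alp !realCD; ring.
have e3 : alp (s + h) = a + h%:C * dal by rewrite /a /alp !realCD; ring.
have G1 : cabs (gauss (u + h%:C * l)) <= g.
  apply: gle; rewrite /K'; have := hK (s + h) t ltac:(lra); rewrite e1 -/T; lra.
have G2 : cabs (gauss (u + h%:C * a)) <= g.
  apply: gle; have := hK s (t + h) ltac:(lra); rewrite e2.
  have : T ^+ 6 <= 64 * (1 + `|t + h|) ^+ 6.
    have := ler_normB (t + h) h; rewrite addrK (gtr0_norm h0) => hT.
    apply: (@le_trans _ _ ((2 * (1 + `|t + h|)) ^+ 6)).
      have x1 := normr_ge0 (t + h); have x2 := normr_ge0 t.
      by rewrite lerXn2r ?nnegrE /T//; lra.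
    by rewrite exprMn -natrX.
  have := cabs_ge0 (gauss (u + h%:C * a)) => x0 hT hh.
  apply: le_trans (ler_wpM2r x0 hT) _; rewrite -mulrA /K'; lra.
(* Replacing each Gaussian by its linear approximation at [u] cancels the terms of order 0 and 1 in
   [h]. Two Taylor remainders and one explicit term of order [h ^+ 2] are left. *)
have ->: Ep (s + h) t - Ep s t - Vp s (t + h) + Vp s t =
   (a + h%:C * dal) * (gauss (u + h%:C * l) - gauss u * (1 - 2 * pi%:C * u * (h%:C * l)))
   - (l + h%:C * dal) * (gauss (u + h%:C * a) - gauss u * (1 - 2 * pi%:C * u * (h%:C * a)))
   + (h ^+ 2)%:C * (2 * pi)%:C * (u * dal * (a - l)) * gauss u.
  rewrite /Ep /Vp e1 e2 e3 -/u -/a (_ : dal * (t + h)%:C + be = l + h%:C * dal); last first.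
    by rewrite /l !realCD; ring.
  by rewrite realCM realCX realC_nat -/l; ring.
have a_le : cabs a <= M.
  apply: le_trans (cabsD _ _) _; rewrite cabs1 cabsM cabs_real ger0_norm//.
  by rewrite /M; nra.
have l_le : cabs l <= M * T.
  apply: le_trans (cabsD _ _) _; rewrite cabsM cabs_real /M /T.
  by have := normr_ge0 t; nra.
have u_le : cabs u <= M * T.
  apply: le_trans (cabsD _ _) _; rewrite !cabsM !cabs_real (ger0_norm s0).
  have := normr_ge0 t; rewrite /T => t0.
  have : s * cabs be <= M by rewrite /M; nra.
  by have := ler_wpM2r t0 a_le; rewrite -/a; lra.
have hM : 0 <= h * M by rewrite mulr_ge0// ltW.
have MT : M <= M * T by rewrite ler_peMr//; lra.
have hh : h <= 1 by lra.
have MT0 : 0 <= M * T by lra.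
have hMT : h * M * T <= M * T by rewrite -mulrA ler_piMl.
have r1 := @gauss_taylor_le R u (h%:C * l) (h * M * T) (M * T) g _ u_le G0 G1.
have {}r1 := r1 ltac:(by rewrite cabsM cabs_real gtr0_norm// -mulrA ler_pM2l).
have r2 := @gauss_taylor_le R u (h%:C * a) (h * M) (M * T) g _ u_le G0 G2.
have {}r2 := r2 ltac:(by rewrite cabsM cabs_real gtr0_norm// ler_pM2l).
have hdal : cabs (h%:C * dal) <= M.
  by rewrite cabsM cabs_real gtr0_norm// /M; nra.
have hMT0 : 0 <= h * M * T by rewrite mulr_ge0// ltW.
have hM1 : h * M <= M by rewrite ler_piMl// ltW.
have q1 := sqr_sum_le9 hMT0 hMT (le_trans M1 MT).
have q2 := sqr_sum_le9 hM (le_trans hM1 MT) (le_trans M1 MT).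
have b1 : cabs ((a + h%:C * dal) * (gauss (u + h%:C * l) -
    gauss u * (1 - 2 * pi%:C * u * (h%:C * l)))) <=
    (2 * M) * (gauss_const R * (h * M * T) ^+ 2 * (9 * (M * T) ^+ 2) * (2 * g)).
  rewrite (cabsM (a + _)); apply: ler_pM; rewrite ?cabs_ge0//.
    by apply: le_trans (cabsD _ _) _; lra.
  apply: le_trans r1 _; rewrite ler_wpM2r//; first lra.
  by rewrite ler_wpM2l// mulr_ge0 ?sqr_ge0// ltW.
have b2 : cabs ((l + h%:C * dal) * (gauss (u + h%:C * a) -
    gauss u * (1 - 2 * pi%:C * u * (h%:C * a)))) <=
    (2 * (M * T)) * (gauss_const R * (h * M) ^+ 2 * (9 * (M * T) ^+ 2) * (2 * g)).
  rewrite (cabsM (l + _)); apply: ler_pM; rewrite ?cabs_ge0//.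
    by apply: le_trans (cabsD _ _) _; lra.
  apply: le_trans r2 _; rewrite ler_wpM2r//; first lra.
  by rewrite ler_wpM2l// mulr_ge0 ?sqr_ge0// ltW.
have b3 : cabs ((h ^+ 2)%:C * (2 * pi)%:C * (u * dal * (a - l)) * gauss u) <=
    h ^+ 2 * (2 * pi) * (M * T * M * (2 * (M * T))) * g.
  rewrite (cabsM _ (gauss u)) (cabsM (_ * _)) (cabsM (h ^+ 2)%:C) !cabs_real.
  rewrite (ger0_norm (sqr_ge0 h)) (ger0_norm (_ : 0 <= 2 * pi)) ?mulr_ge0 ?pi_ge0//.
  have hp : 0 <= h ^+ 2 * (2 * pi).
    by apply: mulr_ge0; [exact: sqr_ge0|rewrite mulr_ge0// ltW].
  apply: ler_pM => //; rewrite ?cabs_ge0//; first by rewrite mulr_ge0// cabs_ge0.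
  apply: ler_wpM2l => //.
  rewrite (cabsM (_ * _)) (cabsM u); apply: ler_pM; rewrite ?cabs_ge0//.
  - by rewrite mulr_ge0// cabs_ge0.
  - by apply: ler_pM; rewrite ?cabs_ge0// /M; lra.
  - by apply: le_trans (cabsB _ _) _; lra.
rewrite ler_pdivlMr ?exprn_gt0//.
have T2 := exprn_gt0 2 T0.
apply: le_trans (ler_wpM2r (ltW T2) (le_trans (cabsD _ _)
  (lerD (le_trans (cabsB _ _) (lerD b1 b2)) b3))) _.
have T31 : g * T ^+ 5 <= K'.
  by rewrite -gT ler_pM2l// ler_weXn2l.
have T41 : g * T ^+ 4 <= K'.
  by rewrite -gT ler_pM2l// ler_weXn2l.
rewrite (_ : _ * T ^+ 2 = 36 * gauss_const R * M ^+ 5 * h ^+ 2 * (g * T ^+ 6)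
   + 36 * gauss_const R * M ^+ 5 * h ^+ 2 * (g * T ^+ 5)
   + 4 * pi * M ^+ 3 * h ^+ 2 * (g * T ^+ 4)); last by ring.
rewrite gT (_ : h ^+ 2 * _ = 36 * gauss_const R * M ^+ 5 * h ^+ 2 * K'
  + 36 * gauss_const R * M ^+ 5 * h ^+ 2 * K' + 4 * pi * M ^+ 3 * h ^+ 2 * K'); last by ring.
by rewrite !lerD// ler_wpM2l// !mulr_ge0 ?exprn_ge0 ?ltW.
Qed.


Lemma gauss_path2 : exists2 K, 0 < K & forall s t, 0 <= s <= 1 ->
  cabs (Ep s t) <= K / (1 + `|t|) ^+ 2 /\ cabs (Vp s t) <= K / (1 + `|t|) ^+ 2.
Proof.
have [K K0 hK] := gauss_path.
pose M := 1 + cabs dal + cabs be.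
have dal0 := cabs_ge0 dal; have be0 := cabs_ge0 be.
have M1 : 1 <= M by rewrite /M; lra.
exists (M * K) => [|s t s01]; first by rewrite mulr_gt0//; lra.
have {hK} := hK s t s01; set T := 1 + `|t|; set G := gauss _ => hK.
have T1 : 1 <= T by rewrite lerDl.
have T0 : 0 < T by lra.
have G0 := cabs_ge0 G.
have pw n : (n <= 6)%N -> T ^+ n * cabs G <= K.
  by move=> n6; apply: le_trans hK; rewrite ler_wpM2r// ler_weXn2l.
rewrite !ler_pdivlMr ?exprn_gt0//; split.
  rewrite /Ep cabsM -/G -mulrA [_ * T ^+ 2]mulrC; apply: ler_pM; rewrite ?cabs_ge0//.
  - by rewrite mulr_ge0 ?exprn_ge0// ltW.
  - apply: le_trans (cabsD _ _) _; rewrite cabs1 cabsM cabs_real.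
    have /andP[s0 s1] := s01; rewrite (ger0_norm s0) /M; nra.
  - exact: pw.
rewrite /Vp cabsM -/G; apply: (@le_trans _ _ (M * (T ^+ 3 * cabs G))); last first.
  by rewrite ler_wpM2l//; [lra|exact: pw].
rewrite (_ : M * _ = (M * T) * cabs G * T ^+ 2); last by ring.
apply: ler_wpM2r; first by rewrite exprn_ge0// ltW.
apply: ler_wpM2r => //.
apply: le_trans (cabsD _ _) _; rewrite cabsM cabs_real /M /T.
by have := normr_ge0 t; nra.
Qed.

Let wtE (K h : R) (y : int) : K / (1 + `|y%:~R * h|) ^+ 2 * h = K * riemann_wt h y.
Proof. by rewrite /riemann_wt -mulrA; congr (_ * _); rewrite mulrC. Qed.

Lemma path_asum h s : 0 < h -> h <= 1 -> 0 <= s <= 1 ->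
  asum (fun y : int => h%:C * Ep s (y%:~R * h)) /\
  asum (fun y : int => h%:C * Vp s (y%:~R * h)).
Proof.
move=> h0 h1 s01; have [K K0 hK] := gauss_path2.
have hc (F : R -> R[i]) : (forall t, cabs (F t) <= K / (1 + `|t|) ^+ 2) ->
    asum (fun y : int => h%:C * F (y%:~R * h)).
  move=> hF; apply: (proj1 (riemann_sum_bound h0 h1 (ltW K0) _)) => y.
  by rewrite cabsM cabs_real gtr0_norm// -wtE mulrC ler_pM2r.
by split; apply: hc => t; have [] := hK s t s01.
Qed.

(** The parameter [s] advances by the mesh [h] itself. Each of the [N] steps costs a Riemann sum of
    size [h ^+ 2], so the total error is of order [N h^2 = h]. *)
Lemma contour_rotation : exists2 C, 0 < C & forall N h, (0 < N)%N ->
  h = N%:R^-1 ->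
  cabs (csum (fun y : int => h%:C * (al * gauss (al * (y%:~R * h)%:C + be)))
        - csum (fun y : int => h%:C * gauss (y%:~R * h)%:C)) <= C * h.
Proof.
have [C C0 hC] := contour_rotation_step.
exists (5 * C) => [|N h N0 hN]; first by rewrite mulr_gt0.
have h0 : 0 < h by rewrite hN invr_gt0 ltr0n.
have h1 : h <= 1 by rewrite hN invf_le1 ?ltr0n// ler1n.
pose W s := csum (fun y : int => h%:C * Ep s (y%:~R * h)).
have step s : 0 <= s -> s + h <= 1 -> cabs (W (s + h) - W s) <= 5 * (h ^+ 2 * C).
  move=> s0 sh.
  have [a1 _] := path_asum h0 h1 (s := s + h) ltac:(lra).
  have [a2 a3] := path_asum h0 h1 (s := s) ltac:(lra).
  pose V1 y := h%:C * Vp s (y%:~R * h).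
  have bj : bijective (fun y : int => y + 1).
    by exists (fun y => y - 1) => y; rewrite ?addrK ?subrK.
  have a4 : asum (V1 \o (fun y : int => y + 1)).
    by apply: asum_reindex => //; exact: bij_inj.
  (* Differences of [Vp] between neighbouring mesh points sum to zero over all integers, so
     subtracting them is free. *)
  have v0 : csum (fun y => (V1 \o (fun y : int => y + 1)) y - V1 y) = 0.
    by rewrite csumB// csum_reindex// subrr.
  have a12 : asum (fun y : int => h%:C * Ep (s + h) (y%:~R * h) - h%:C * Ep s (y%:~R * h)).
    exact: asumB.
  have a34 : asum (fun y => (V1 \o (fun y : int => y + 1)) y - V1 y) by exact: asumB.
  have -> : W (s + h) - W s = csum (fun y : int =>
      h%:C * Ep (s + h) (y%:~R * h) - h%:C * Ep s (y%:~R * h)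
      - ((V1 \o (fun y : int => y + 1)) y - V1 y)).
    by rewrite csumB// v0 subr0 csumB.
  apply: (proj2 (riemann_sum_bound h0 h1 _ _)) => [|y].
    by rewrite mulr_ge0 ?sqr_ge0// ltW.
  rewrite -wtE /V1 /= intrD mulrDl mul1r.
  set t := y%:~R * h.
  rewrite (_ : _ - _ = h%:C * (Ep (s + h) t - Ep s t - Vp s (t + h) + Vp s t)); last by ring.
  by rewrite cabsM cabs_real gtr0_norm// mulrC ler_pM2r// hC.
have steps k : (k <= N)%N -> cabs (W (k%:R * h) - W 0) <= k%:R * (5 * (h ^+ 2 * C)).
  elim: k => [|k IH] kN; first by rewrite !mul0r subrr cabs0.
  have k0 : 0 <= k%:R * h by rewrite mulr_ge0// ltW.
  have kh : k%:R * h + h <= 1.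
    have : k.+1%:R * h <= 1 by rewrite hN ler_pdivrMr ?ltr0n// mul1r ler_nat.
    by rewrite -natr1 mulrDl mul1r.
  have := step _ k0 kh; have {IH} := IH (ltnW kN) => IH st.
  rewrite -natr1 [(_ + 1) * h]mulrDl mul1r.
  rewrite -(subrKA (W (k%:R * h))) [leRHS]mulrDl mul1r [leRHS]addrC.
  exact: le_trans (cabsD _ _) (lerD st IH).
have := steps N (leqnn N); rewrite (_ : N%:R * h = 1); last by rewrite hN divff// pnatr_eq0 -lt0n.
rewrite (_ : N%:R * (5 * (h ^+ 2 * C)) = N%:R * h * (5 * C * h)); last by ring.
rewrite (_ : N%:R * h = 1); last by rewrite hN divff// pnatr_eq0 -lt0n.
rewrite mul1r => e; apply: le_trans e; rewrite le_eqVlt; apply/orP; left; apply/eqP.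
congr (cabs (_ - _)); apply: eq_csum => y.
  rewrite /Ep /pt /alp /dal !mul1r; congr (_ * (_ * gauss (_ * _ + _))); ring.
by rewrite /Ep /pt /alp !mul0r addr0 !mul1r addr0.
Qed.

Lemma gauss_line_bound : exists2 K, 0 < K &
  forall t, cabs (gauss (al * t%:C + be)) <= K / (1 + `|t|) ^+ 2.
Proof.
have [K K0 hK] := gauss_path; exists K => // t.
have := hK 1 t ltac:(by rewrite ler01 lexx); rewrite /pt /alp /dal !mul1r subrKC => h.
have T1 : 1 <= 1 + `|t| by rewrite lerDl.
have T0 : 0 < 1 + `|t| by lra.
rewrite ler_pdivlMr ?exprn_gt0//.
apply: le_trans h; rewrite mulrC ler_wpM2r ?cabs_ge0// ler_weXn2l//.
Qed.

(** The linear Taylor terms for [h] and [- h] cancel, leaving two remainders of order [h ^+ 2]. This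
    drives the decay of the discrete Fourier coefficients. *)
Lemma gauss_second_difference : exists2 C, 0 < C & forall h t, 0 < h -> h <= 1 ->
  cabs (gauss (al * (t + h)%:C + be) + gauss (al * (t - h)%:C + be)
        - 2 * gauss (al * t%:C + be)) <= h ^+ 2 * C / (1 + `|t|) ^+ 2.
Proof.
have [K K0 hK] := gauss_path.
pose M := 1 + cabs al + cabs be.
have al0 := cabs_ge0 al; have be0 := cabs_ge0 be.
pose K' := 64 * K; have K'0 : 0 < K' by rewrite mulr_gt0.
have c0 := gauss_const_gt0 R.
have M1 : 1 <= M by rewrite /M; lra.
have M0 : 0 < M by lra.
exists (36 * gauss_const R * M ^+ 4 * K').
  by rewrite !mulr_gt0 ?exprn_gt0.
move=> h t h0 h1.
set T := 1 + `|t|.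
have T1 : 1 <= T by rewrite lerDl.
have T0 : 0 < T by lra.
pose g := K' / T ^+ 6.
have g0 : 0 < g by rewrite divr_gt0 ?exprn_gt0.
have gT : g * T ^+ 6 = K' by rewrite /g divfK// gt_eqF ?exprn_gt0.
have near t' : `|t' - t| <= 1 -> cabs (gauss (al * t'%:C + be)) <= g.
  move=> tt; rewrite /g ler_pdivlMr ?exprn_gt0// mulrC.
  have := hK 1 t' ltac:(by rewrite ler01 lexx); rewrite /pt /alp /dal !mul1r subrKC => hh.
  have hT : T ^+ 6 <= 64 * (1 + `|t'|) ^+ 6.
    have x1 := normr_ge0 t'; have x2 := normr_ge0 t.
    have x3 : `|t| <= `|t'| + 1.
      by have := ler_normB t' (t' - t); rewrite subKr; lra.
    apply: (@le_trans _ _ ((2 * (1 + `|t'|)) ^+ 6)).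
      by rewrite lerXn2r ?nnegrE /T//; lra.
    by rewrite exprMn -natrX.
  have x0 := cabs_ge0 (gauss (al * t'%:C + be)).
  by apply: le_trans (ler_wpM2r x0 hT) _; rewrite -mulrA /K'; lra.
pose u := al * t%:C + be.
have e1 : al * (t + h)%:C + be = u + h%:C * al by rewrite /u realCD; ring.
have e2 : al * (t - h)%:C + be = u + - (h%:C * al) by rewrite /u realCD realCN; ring.
have G0 : cabs (gauss u) <= g by apply: near; rewrite subrr normr0.
have G1 : cabs (gauss (u + h%:C * al)) <= g.
  by rewrite -e1; apply: near; rewrite addrAC subrr add0r gtr0_norm.
have G2 : cabs (gauss (u + - (h%:C * al))) <= g.
  by rewrite -e2; apply: near; rewrite addrAC subrr add0r normrN gtr0_norm.
have u_le : cabs u <= M * T.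
  apply: le_trans (cabsD _ _) _; rewrite !cabsM !cabs_real.
  by have := normr_ge0 t; rewrite /T /M => t0; nra.
have ha : cabs (h%:C * al) <= h * M.
  by rewrite cabsM cabs_real gtr0_norm// ler_pM2l// /M; lra.
have r1 := gauss_taylor_le ha u_le G0 G1.
have r2 := gauss_taylor_le (_ : cabs (- (h%:C * al)) <= h * M) u_le G0 G2.
have {}r2 := r2 ltac:(by rewrite cabsN).
rewrite e1 e2 (_ : _ - _ = (gauss (u + h%:C * al) - gauss u * (1 - 2 * pi%:C * u * (h%:C * al)))
  + (gauss (u + - (h%:C * al)) - gauss u * (1 - 2 * pi%:C * u * - (h%:C * al)))); last by ring.
have hM : 0 <= h * M by rewrite mulr_ge0// ltW.
have MT : M <= M * T by rewrite ler_peMr//; lra.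
have hM1 : h * M <= M by rewrite ler_piMl// ltW.
have q2 := sqr_sum_le9 hM (le_trans hM1 MT) (le_trans M1 MT).
set r := gauss_const R * _ * _ * _ in r1 r2.
have r_le : r <= gauss_const R * (h * M) ^+ 2 * (9 * (M * T) ^+ 2) * (2 * g).
  rewrite /r ler_wpM2r//; first lra.
  by rewrite ler_wpM2l// mulr_ge0 ?sqr_ge0// ltW.
rewrite ler_pdivlMr ?exprn_gt0//.
have T2 := exprn_gt0 2 T0.
apply: le_trans (ler_wpM2r (ltW T2) (le_trans (cabsD _ _)
  (lerD (le_trans r1 r_le) (le_trans r2 r_le)))) _.
have T41 : g * T ^+ 4 <= K'.
  by rewrite -gT ler_pM2l// ler_weXn2l.
rewrite (_ : _ * T ^+ 2 = 36 * gauss_const R * M ^+ 4 * h ^+ 2 * (g * T ^+ 4)); last by ring.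
rewrite (_ : h ^+ 2 * _ = 36 * gauss_const R * M ^+ 4 * h ^+ 2 * K'); last by ring.
by rewrite ler_wpM2l// !mulr_ge0 ?exprn_ge0 ?ltW.
Qed.

End ContourRotation.

(** * Poisson summation on the line *)

Section PoissonLine.
Variable R : realType.
Implicit Types (t h b c q l : R).

(* The quadratic form value [q] and the phase [l] are real numbers; all the complex
   dependence sits in the scalar [z]. *)
Definition gexp (z : R[i]) q l : R[i] := cexp (- (pi%:C * z * q%:C)) * unit_exp l.

Lemma gexpD z q1 q2 l1 l2 : gexp z (q1 + q2) (l1 + l2) = gexp z q1 l1 * gexp z q2 l2.
Proof.
by rewrite /gexp unit_expD realCD mulrDr opprD cexpD mulrACA.
Qed.

Lemma cabs_gexp z q l : cabs (gexp z q l) = expR (- (pi * Re z * q)).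
Proof.
rewrite /gexp cabsM cabs_unit_exp mulr1 cabs_cexp; congr expR.
by case: z => a b /=; ring.
Qed.

Lemma sector_neq0 (al : R[i]) : `|Im al| < Re al -> al != 0.
Proof. by apply: contraTneq => ->; rewrite /= normr0 ltxx. Qed.

Lemma sectorV (al : R[i]) : `|Im al| < Re al -> `|Im al^-1| < Re al^-1.
Proof.
case: al => a b /= h; have a0 : 0 < a by apply: le_lt_trans h.
have d0 : 0 < a ^+ 2 + b ^+ 2 by rewrite ltr_pwDl ?exprn_gt0 ?sqr_ge0.
rewrite -?mulNr.
by rewrite mulNr normrN normrM (gtr0_norm (_ : 0 < _^-1)) ?invr_gt0// ltr_pM2r ?invr_gt0.
Qed.

Lemma sector1 : `|Im (1 : R[i])| < Re (1 : R[i]).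
Proof. by rewrite /= normr0. Qed.

(** Completing the square turns the linear phase into an imaginary displacement of the line. The
    factor in front is already the Gaussian of the dual side. *)
Lemma gexp_gauss (al : R[i]) t b (ka : R) : al != 0 ->
  gexp (al ^+ 2) ((t + b) ^+ 2) (ka * (t + b)) =
  cexp (- (pi%:C * (ka ^+ 2)%:C / al ^+ 2)) *
  gauss (al * t%:C + (al * b%:C - 'i * ka%:C / al)).
Proof.
move=> al0; rewrite /gexp /gauss /unit_exp -!cexpD; congr cexp.
have i2 : ('i : R[i]) ^+ 2 = -1 by exact: sqr_i.
rewrite !realCX !realCM realCD.
have -> : (al * t%:C + (al * b%:C - 'i * ka%:C / al)) ^+ 2 =
   (al * (t%:C + b%:C)) ^+ 2 - 2 * 'i * ka%:C * (t%:C + b%:C)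
     + 'i ^+ 2 * ka%:C ^+ 2 / al ^+ 2 by field.
by rewrite i2; field.
Qed.

Lemma riemann_wt1 (k : int) : riemann_wt 1 k = (1 + `|k%:~R|) ^- 2 :> R.
Proof. by rewrite /riemann_wt mulr1 mul1r. Qed.

Lemma asum_riemann_wt1 (C : R) : 0 <= C -> asum (fun k : int => (C * riemann_wt 1 k)%:C).
Proof.
move=> C0; apply: (proj1 (riemann_sum_bound ltr01 (lexx 1) C0 _)) => k.
by rewrite cabs_real ger0_norm// mulr_ge0// riemann_wt_ge0.
Qed.

Lemma gexp_line_bound (al : R[i]) b (ka : R) : `|Im al| < Re al ->
  exists2 K, 0 < K & forall t,
  cabs (gexp (al ^+ 2) ((t + b) ^+ 2) (ka * (t + b))) <= K / (1 + `|t|) ^+ 2.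
Proof.
move=> sal; have al0 := sector_neq0 sal.
have [K K0 hK] := gauss_line_bound (al * b%:C - 'i * ka%:C / al) sal.
set X := cexp (- (pi%:C * (ka ^+ 2)%:C / al ^+ 2)).
have X0 : 0 < cabs X by rewrite cabs_gt0 cexp_neq0.
exists (cabs X * K) => [|t]; first by rewrite mulr_gt0.
by rewrite gexp_gauss// (cabsM X) -[leRHS]mulrA ler_pM2l.
Qed.

Lemma gexp_sum_bound (al : R[i]) b (ka : R) : `|Im al| < Re al ->
  exists2 K, 0 < K & forall h, 0 < h -> h <= 1 ->
  asum (fun y : int => h%:C * gexp (al ^+ 2) ((y%:~R * h + b) ^+ 2) (ka * (y%:~R * h + b)))
  /\ cabs (csum (fun y : int =>
    h%:C * gexp (al ^+ 2) ((y%:~R * h + b) ^+ 2) (ka * (y%:~R * h + b)))) <= K.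
Proof.
move=> sal; have [K K0 hK] := gexp_line_bound b ka sal.
exists (5 * K) => [|h h0 h1]; first by rewrite mulr_gt0.
apply: (riemann_sum_bound h0 h1) => [|y]; first exact: ltW.
by rewrite cabsM cabs_real gtr0_norm// /riemann_wt [leRHS]mulrCA ler_pM2l.
Qed.

Lemma gexp_asum (al : R[i]) b (l : int -> R) : `|Im al| < Re al ->
  asum (fun x : int => gexp (al ^+ 2) ((x%:~R + b) ^+ 2) (l x)).
Proof.
move=> sal; have [K K0 hK] := gexp_sum_bound b 0 sal.
have [h _] := hK 1 ltr01 (lexx _); apply: asum_le1 h => x.
by rewrite mul1r mulr1 !cabs_gexp.
Qed.

Lemma unit_exp_neq1 x : 0 < x < 1 -> unit_exp x != 1 :> R[i].
Proof.
move=> /andP[x0 x1]; rewrite unit_expE; apply/eqP => -[h _].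
have p0 := pi_gt0 R.
have := one_sub_cos (2 * pi * x); rewrite h (_ : 2 * pi * x / 2 = pi * x); last by lra.
have : 0 < sin (pi * x) by apply: sin_gt0_pi; rewrite mulr_gt0//= gtr_pMr.
by nra.
Qed.

(** Orthogonality of the characters of Z/N. With [N] odd the frequencies [j - M] are symmetric about
    0 and smaller than [N / 2] in absolute value, as [unit_exp_chord] requires. *)
Lemma root_sum (M : nat) (y : int) : let N := M.*2.+1 in
  \sum_(j < N) unit_exp (- ((j%:R - M%:R) * (y%:~R / N%:R))) =
  (if (N %| y)%Z then N%:R else 0) :> R[i].
Proof.
move=> N; have N0 : N%:R != 0 :> R by rewrite pnatr_eq0.
pose z : R[i] := unit_exp (- (y%:~R / N%:R)).
have -> : \sum_(j < N) unit_exp (- ((j%:R - M%:R) * (y%:~R / N%:R))) =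
    unit_exp (M%:R * (y%:~R / N%:R)) * \sum_(j < N) z ^+ j.
  rewrite mulr_sumr; apply: eq_bigr => j _; rewrite /z unit_expX -unit_expD.
  by congr unit_exp; ring.
case: ifPn => [/dvdzP[q yq]|ndiv].
  have yN : y%:~R / N%:R = q%:~R :> R.
    by rewrite yq intrM -pmulrn mulfK.
  have z1 : z = 1 by rewrite /z yN -mulrNz unit_exp_int.
  rewrite z1 (eq_bigr (fun=> 1)) => [|j _]; last by rewrite expr1n.
  rewrite sumr_const card_ord yN.
  by rewrite (_ : M%:R * q%:~R = (M%:Z * q)%:~R) ?unit_exp_int ?mul1r// intrM -pmulrn.
have zN : z ^+ N = 1.
  rewrite /z unit_expX mulrN mulrC divfK// unit_expN.
  by rewrite unit_exp_int invr1.
have z1 : z != 1.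
  have e := divz_eq y N; have r0 := modz_ge0 y (_ : N%:Z != 0).
  have rN := ltz_pmod y (_ : 0 < N%:Z).
  have {}r0 := r0 isT; have {}rN := rN isT.
  have rne : (y %% N)%Z != 0 by apply: contraNneq ndiv => h; apply/dvdz_mod0P.
  set r := (y %% N)%Z in e r0 rN rne.
  rewrite /z e intrD intrM mulrDl -pmulrn mulfK// opprD unit_expD -mulrNz unit_exp_int mul1r.
  rewrite unit_expN invr_eq1; apply: unit_exp_neq1; apply/andP; split.
    by rewrite divr_gt0 ?ltr0n// ltr0z lt_neqAle eq_sym rne.
  by rewrite ltr_pdivrMr ?ltr0n// mul1r pmulrn ltr_int.
have := subrX1 z N; rewrite zN subrr => /eqP; rewrite eq_sym mulf_eq0 subr_eq0 (negbTE z1) /=.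
by move=> /eqP ->; rewrite mulr0.
Qed.

(* Conversion must not unfold these into power series. *)
Local Opaque cexp unit_exp gauss.

Section Fixed.
Variables (al : R[i]) (b c : R).
Hypothesis sal : `|Im al| < Re al.

Let al0 : al != 0. Proof. exact: sector_neq0. Qed.
Let f t := gexp (al ^+ 2) (t ^+ 2) (c * t).
(** [S N k] is the Riemann sum of mesh 1/N for the Fourier integral of [f] at frequency [k], [L N]
    the one for the real Gaussian, and [H k] the dual term expected in the limit. *)
Let S (N : nat) (k : int) := csum (fun y : int =>
  (N%:R^-1)%:C * gexp (al ^+ 2) ((y%:~R * N%:R^-1 + b) ^+ 2) ((c - k%:~R) * (y%:~R * N%:R^-1 + b))).
Let L (N : nat) := csum (fun y : int => (N%:R^-1)%:C * gauss (y%:~R * N%:R^-1)%:C : R[i]).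
Let H (k : int) := al^-1 * gexp (al^-1 ^+ 2) ((k%:~R - c) ^+ 2) (k%:~R * b).

Let invN (N : nat) : (0 < N)%N -> 0 < (N%:R^-1 : R) /\ (N%:R^-1 : R) <= 1.
Proof. by move=> N0; rewrite invr_gt0 ltr0n N0 invf_le1 ?ltr0n// ler1n. Qed.

Let freq (M : nat) (j : 'I_(M.*2.+1)) : int := Posz j - Posz M.

(** Averaging over all [N] frequencies annihilates the points of (1/N)Z outside Z, so the identity
    is exact for each [N]. *)
Lemma finite_fourier (M : nat) :
  csum (fun x : int => f (x%:~R + b)) =
  \sum_(j < M.*2.+1) unit_exp ((freq j)%:~R * b) * S M.*2.+1 (freq j).
Proof.
set N := M.*2.+1; have [h0 h1] := @invN N isT.
set h := N%:R^-1 in h0 h1.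
have Nh : N%:R * h = 1 :> R by rewrite divff// pnatr_eq0.
have hs (j : 'I_N) : has_sum (fun y : int => unit_exp ((freq j)%:~R * b) *
    (h%:C * gexp (al ^+ 2) ((y%:~R * h + b) ^+ 2) ((c - (freq j)%:~R) * (y%:~R * h + b))))
    (unit_exp ((freq j)%:~R * b) * S N (freq j)).
  apply: has_sumZ; apply: asum_has_sum.
  have [K _ hK] := gexp_sum_bound b (c - (freq j)%:~R) sal.
  by have [] := hK h h0 h1.
pose F (y : int) := \sum_(j < N) unit_exp ((freq j)%:~R * b) *
    (h%:C * gexp (al ^+ 2) ((y%:~R * h + b) ^+ 2) ((c - (freq j)%:~R) * (y%:~R * h + b))).
have hF : has_sum F (\sum_(j < N) unit_exp ((freq j)%:~R * b) * S N (freq j)).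
  exact: has_sum_bigsum.
apply: has_sum_csum.
have FE y : F y = f (y%:~R * h + b) * (if (N %| y)%Z then 1 else 0).
  rewrite (_ : (if _ then 1 else 0) = h%:C * (if (N %| y)%Z then N%:R else 0)); last first.
    by case: ifP; rewrite ?mulr0// -(realC_nat R N) -realCM mulrC Nh.
  rewrite -root_sum mulrCA !mulr_sumr /F; apply: eq_bigr => j _.
  have key : unit_exp ((freq j)%:~R * b) * unit_exp ((c - (freq j)%:~R) * (y%:~R * h + b)) =
      unit_exp (c * (y%:~R * h + b)) * unit_exp (- ((j%:R - M%:R) * (y%:~R * h))) :> R[i].
    rewrite -!unit_expD; congr unit_exp; rewrite /freq intrD mulrNz -!pmulrn; ring.
  rewrite /f /gexp; move: key.
  set u1 := unit_exp (_ * b); set u2 := unit_exp ((c - _) * _).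
  set u3 := unit_exp (c * _); set u4 := unit_exp (- _); set G := cexp _ => key.
  rewrite (_ : u1 * _ = h%:C * (G * (u1 * u2))); last by ring.
  by rewrite key; ring.
have fsum : asum (fun x : int => f (x%:~R + b)) by exact: gexp_asum.
have Nne : N%:Z != 0 by [].
have fF : has_sum F (csum (fun x : int => f (x%:~R + b))).
  apply: (@has_sum_inj _ _ _ (fun x : int => x * N%:Z) (fun y => (y %/ N)%Z)).
  - by move=> x; rewrite mulzK.
  - move=> y yne; rewrite FE ifN ?mulr0//; apply: contraNN yne => Ny.
    by rewrite divzK.
  - rewrite (_ : F \o _ = (fun x : int => f (x%:~R + b))); first exact: asum_has_sum.
    apply/funext => x; rewrite -[LHS]/(F (x * N%:Z)) FE.
    have -> : (N %| x * N%:Z)%Z = true by apply: dvdz_mull; exact: dvdzz.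
    by rewrite mulr1 intrM -pmulrn -[_ * _ * h]mulrA Nh mulr1.
by rewrite (has_sum_uniq hF fF); exact: asum_has_sum.
Qed.

(** [contour_rotation] after completing the square. The constant depends on [k], so this is only a
    pointwise statement; uniformity is supplied by [fourier_decay]. *)
Lemma riemann_fourier_limit (k : int) : exists2 C, 0 < C & forall N, (0 < N)%N ->
  cabs (unit_exp (k%:~R * b) * S N k - L N * H k) <= C / N%:R.
Proof.
set ka := c - k%:~R.
have [C C0 hC] := contour_rotation (al * b%:C - 'i * ka%:C / al) sal.
pose E := cexp (- (pi%:C * (ka ^+ 2)%:C / al ^+ 2)) / al.
have E0 : 0 < cabs E by rewrite cabs_gt0 mulf_neq0 ?cexp_neq0 ?invr_eq0.
exists (cabs E * C) => [|N N0]; first by rewrite mulr_gt0.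
have [h0 h1] := invN N0.
have := hC N _ N0 erefl; rewrite -/(L N); set X := csum _ => hX.
have Eg (y : int) : (N%:R^-1)%:C * gexp (al ^+ 2) ((y%:~R * N%:R^-1 + b) ^+ 2)
    (ka * (y%:~R * N%:R^-1 + b)) =
    E * ((N%:R^-1)%:C * (al * gauss (al * (y%:~R * N%:R^-1)%:C + (al * b%:C - 'i * ka%:C / al)))).
  rewrite gexp_gauss// /E; move: (cexp _) (gauss _) (_^-1)%:C => Y Z r; field; exact: al0.
have SE : S N k = E * X.
  rewrite /S /X -csumZ; first by apply: eq_csum => y; exact: Eg.
  have [K _ hK] := gexp_sum_bound b ka sal.
  have [/(asumZ E^-1) h _] := hK _ h0 h1; congr asum: h.
  by apply/funext => x; rewrite Eg mulKf// -cabs_eq0 gt_eqF.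
have HE : H k = E * unit_exp (k%:~R * b).
  rewrite /H /E /gexp mulrA [X in X * _ = _]mulrC; congr (cexp _ / _ * _).
  have -> : (k%:~R - c) ^+ 2 = ka ^+ 2 by rewrite -sqrrN opprB.
  by rewrite exprVn mulrAC.
rewrite SE HE (_ : _ - _ = E * (unit_exp (k%:~R * b) * (X - L N))); last by ring.
by rewrite cabsM (cabsM (unit_exp _)) cabs_unit_exp mul1r -mulrA ler_pM2l.
Qed.

(** Summation by parts twice: the second difference of [f] is of order [h ^+ 2], while the chord is
    at least [(k h)^2]. The mesh cancels, which leaves a bound of order 1 / k^2 that does not depend
    on [M]. *)
Lemma fourier_decay : exists2 C, 0 < C & forall (M : nat) (k : int), (`|k| <= M)%N ->
  cabs (S M.*2.+1 k) <= C * riemann_wt 1 k.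
Proof.
have [K K0 hK] := gexp_line_bound b 0 sal.
have [C C0 hC] := gauss_second_difference (al * b%:C - 'i * c%:C / al) sal.
pose X := cexp (- (pi%:C * (c ^+ 2)%:C / al ^+ 2)).
have X0 : 0 < cabs X by rewrite cabs_gt0 cexp_neq0.
(* 10 = 5 * 2: the 5 of [riemann_sum_bound], and 2 from [(1 + |k|)^2 <= 2 (1 + k^2)]. *)
exists (10 * (K + C * cabs X)) => [|M k kM].
  by rewrite mulr_gt0// addr_gt0// mulr_gt0.
set N := M.*2.+1; have [h0 h1] := @invN N isT.
set h := N%:R^-1 in h0 h1.
pose T (y : int) := y%:~R * h + b.
pose g (y : int) := h%:C * (f (T y) * unit_exp (- (k%:~R * T y))).
have gE (y : int) : h%:C * gexp (al ^+ 2) (T y ^+ 2) ((c - k%:~R) * T y) = g y.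
  by rewrite /g /f /gexp mulrBl unit_expD !mulrA.
have SE : S N k = csum g by apply: eq_csum => y; rewrite -gE.
have [ag Sle] : asum g /\ cabs (csum g) <= 5 * K.
  apply: (riemann_sum_bound h0 h1 (ltW K0)) => y.
  rewrite -gE cabsM cabs_real gtr0_norm// /riemann_wt [leRHS]mulrCA ler_pM2l//.
  by apply: le_trans (hK _); rewrite !cabs_gexp.
have bj1 : bijective (fun y : int => y + 1).
  by exists (fun y => y - 1) => y; rewrite ?addrK ?subrK.
have bj2 : bijective (fun y : int => y - 1).
  by exists (fun y => y + 1) => y; rewrite ?addrK ?subrK.
have ag1 : asum (g \o (fun y : int => y + 1)) by apply: asum_reindex => //; exact: bij_inj.
have ag2 : asum (g \o (fun y : int => y - 1)) by apply: asum_reindex => //; exact: bij_inj.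
pose u := unit_exp (k%:~R * h) : R[i]; pose v := unit_exp (- (k%:~R * h)) : R[i].
(* Shifting the summation variable leaves [csum g] unchanged. The weights [u] and [v] undo the phase
   change caused by the shifts, so the same sum is one of second differences of [f]. *)
have cD : csum (fun y => u * (g \o (fun y : int => y + 1)) y
     + v * (g \o (fun y : int => y - 1)) y - 2 * g y) = (u + v - 2) * csum g.
  rewrite csumB; [|by apply: asumD; exact: asumZ|exact: asumZ].
  rewrite csumD; [|exact: asumZ|exact: asumZ].
  rewrite (csumZ u ag1) (csumZ v ag2) (csumZ 2 ag) (csum_reindex bj1 ag) (csum_reindex bj2 ag).
  by ring.
have Dle : cabs ((u + v - 2) * csum g) <= 5 * (h ^+ 2 * (C * cabs X)).
  rewrite -cD; apply: (proj2 (riemann_sum_bound h0 h1 _ _)) => [|y].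
    by rewrite mulr_ge0 ?sqr_ge0// mulr_ge0 ?cabs_ge0// ltW.
  set t := y%:~R * h.
  have T1 : T (y + 1) = (t + h) + b by rewrite /T intrD mulrDl mul1r.
  have T2 : T (y - 1) = (t - h) + b by rewrite /T intrB mulrBl mul1r.
  have eu : u * unit_exp (- (k%:~R * T (y + 1))) = unit_exp (- (k%:~R * T y)).
    by rewrite /u -unit_expD T1 /T -/t; congr unit_exp; ring.
  have ev : v * unit_exp (- (k%:~R * T (y - 1))) = unit_exp (- (k%:~R * T y)).
    by rewrite /v -unit_expD T2 /T -/t; congr unit_exp; ring.
  rewrite /= /g.
  rewrite (_ : _ - _ = unit_exp (- (k%:~R * T y)) *
    (h%:C * (f (T (y + 1)) + f (T (y - 1)) - 2 * f (T y)))); last first.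
    rewrite mulrCA [u * (f _ * _)]mulrCA eu.
    rewrite [v * (h%:C * _)]mulrCA [v * (f _ * _)]mulrCA ev; ring.
  rewrite (cabsM (unit_exp _)) cabs_unit_exp mul1r (cabsM h%:C) cabs_real gtr0_norm//.
  rewrite /riemann_wt [leRHS]mulrCA ler_pM2l// T1 T2 /T -/t /f !gexp_gauss//.
  rewrite -/X (_ : _ - _ = X * (gauss (al * (t + h)%:C + (al * b%:C - 'i * c%:C / al))
     + gauss (al * (t - h)%:C + (al * b%:C - 'i * c%:C / al))
     - 2 * gauss (al * t%:C + (al * b%:C - 'i * c%:C / al)))); last by ring.
  rewrite (cabsM X); apply: le_trans (ler_wpM2l (ltW X0) (hC h t h0 h1)) _.
  by rewrite le_eqVlt; apply/orP; left; apply/eqP; ring.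
have kh : `|k%:~R * h| <= 1 / 2.
  rewrite normrM (gtr0_norm h0) /h ler_pdivrMr ?ltr0n// -intr_norm.
  rewrite (_ : 1 / 2 * N%:R = M%:R + 1 / 2); last first.
    have -> : N%:R = 2 * M%:R + 1 :> R by rewrite /N -addn1 natrD -mul2n natrM.
    by field.
  apply: (@le_trans _ _ M%:R); last by rewrite lerDl.
  by rewrite -abszE -pmulrn ler_nat.
have := unit_exp_chord kh; rewrite -/u -/v => chord.
have Sk : k%:~R ^+ 2 * cabs (csum g) <= 5 * (C * cabs X).
  have h2 : 0 < h ^+ 2 by rewrite exprn_gt0.
  rewrite -(ler_pM2l h2); have := ler_wpM2r (cabs_ge0 (csum g)) chord.
  rewrite -cabsM exprMn; move: Dle; lra.
rewrite SE riemann_wt1 ler_pdivlMr ?exprn_gt0 ?ltr_pwDl//.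
have : (1 + `|k%:~R|) ^+ 2 <= 2 * (1 + k%:~R ^+ 2) :> R.
  by rewrite -(real_normK (num_real k%:~R)); have := sqr_ge0 (1 - `|k%:~R : R|); nra.
by have := cabs_ge0 (csum g); move: (cabs (csum g)) Sk Sle => s Sk Sle s0; nra.
Qed.

(** Tannery's theorem applied to the frequency sum. Boundedness of [L] suffices here; its limit is
    determined only in [poisson_line]. *)
Lemma poisson_asymptotic (e : R) : 0 < e -> exists M0, forall M, (M0 <= M)%N ->
  cabs (csum (fun x : int => f (x%:~R + b)) - L M.*2.+1 * csum H) < e.
Proof.
have [C C0 hC] := fourier_decay.
have [KL KL0 hL] := gauss_line_bound 0 sector1.
have Lle N : (0 < N)%N -> cabs (L N) <= 5 * KL.
  move=> N0; have [h0 h1] := invN N0.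
  apply: (proj2 (riemann_sum_bound h0 h1 (ltW KL0) _)) => y.
  rewrite cabsM cabs_real gtr0_norm// /riemann_wt [leRHS]mulrCA ler_pM2l//.
  by have := hL (y%:~R / N%:R); rewrite mul1r addr0.
have [KH KH0 hH] := gexp_line_bound (- c) 0 (sectorV sal).
have Hle k : cabs (H k) <= cabs al^-1 * KH * riemann_wt 1 k.
  rewrite /H cabsM -mulrA ler_wpM2l ?cabs_ge0// riemann_wt1.
  by have := hH k%:~R; rewrite !cabs_gexp.
have a0 := cabs_ge0 al^-1.
have Has : asum H.
  apply: asum_le1 (asum_riemann_wt1 (C := cabs al^-1 * KH) _) => [k|].
    by rewrite cabs_real ger0_norm// mulr_ge0 ?riemann_wt_ge0// mulr_ge0// ltW.
  by rewrite mulr_ge0// ltW.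
(* The range of frequencies grows with [M], so each finite sum is extended by zero to a family over
   all integers. *)
pose d M k := (if (`|k| <= M)%N then unit_exp (k%:~R * b) * S M.*2.+1 k else 0)
  - L M.*2.+1 * H k.
pose D := C + 5 * KL * (cabs al^-1 * KH).
have D0 : 0 <= D by rewrite /D addr_ge0 ?mulr_ge0// ltW.
have Ple M k : cabs (if (`|k| <= M)%N then unit_exp (k%:~R * b) * S M.*2.+1 k else 0)
    <= C * riemann_wt 1 k.
  case: ifP => [kM|_]; last by rewrite cabs0 mulr_ge0 ?riemann_wt_ge0// ltW.
  by rewrite cabsM cabs_unit_exp mul1r hC.
have csumd M : csum (d M) = csum (fun x : int => f (x%:~R + b)) - L M.*2.+1 * csum H.
  rewrite csumB; [|apply: asum_le1 (asum_riemann_wt1 (ltW C0)) => k|exact: asumZ]; last first.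
    by rewrite cabs_real ger0_norm// mulr_ge0 ?riemann_wt_ge0// ltW.
  rewrite csumZ// (finite_fourier M); congr (_ - _).
  pose A := [fset @freq M j | j in 'I_(M.*2.+1)]%fset.
  rewrite (_ : \sum_(j < _) _ = \sum_(k <- A)
      (if (`|k| <= M)%N then unit_exp (k%:~R * b) * S M.*2.+1 k else 0)); last first.
    rewrite big_imfset /=; last first.
      by move=> i j _ _ /addIr [] /val_inj.
    rewrite big_enum; apply: eq_bigr => j _; rewrite ifT//.
    have := ltn_ord j; rewrite /freq; lia.
  apply: has_sum_csum; apply: finite_has_sum => k.
  case: ifP => // kM /negP[]; apply/imfsetP.
  have kN : (absz (k + M%:Z)%R < M.*2.+1)%N by lia.
  by exists (Ordinal kN) => //=; rewrite /freq /=; lia.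
move=> e0; under eq_exists => M0 do under eq_forall => M do rewrite -csumd.
apply: (csum_dominated (asum_riemann_wt1 D0)) => // [M k|k e' e'0].
  rewrite [leRHS]cabs_real ger0_norm ?mulr_ge0 ?riemann_wt_ge0//.
  apply: le_trans (cabsB _ _) _; rewrite /D mulrDl; apply: lerD => //.
  by rewrite cabsM -[leRHS]mulrA; apply: ler_pM; rewrite ?cabs_ge0//; exact: Lle.
have [B B0 hB] := riemann_fourier_limit k.
(* The first entry puts [k] inside the range of frequencies, the second makes the pointwise error
   small. *)
exists (maxn `|k|%N (Num.bound (B / e'))) => M; rewrite geq_max => /andP[kM BM].
rewrite /d kM; apply: le_lt_trans (hB M.*2.+1 isT) _.
rewrite ltr_pdivrMr ?ltr0n// mulrC -ltr_pdivrMr//.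
apply: lt_le_trans (archi_boundP (divr_ge0 (ltW B0) (ltW e'0))) _.
by rewrite ler_nat (leq_trans BM)// ltnW// ltnS -addnn leq_addr.
Qed.

End Fixed.

Theorem poisson_line (al : R[i]) (b c : R) : `|Im al| < Re al ->
  csum (fun x : int => gexp (al ^+ 2) ((x%:~R + b) ^+ 2) (c * (x%:~R + b))) =
  al^-1 * csum (fun k : int => gexp (al^-1 ^+ 2) ((k%:~R - c) ^+ 2) (k%:~R * b)).
Proof.
move=> sal; rewrite -csumZ; last exact: (gexp_asum (- c) _ (sectorV sal)).
pose L (N : nat) := csum (fun y : int => (N%:R^-1)%:C * gauss (y%:~R * N%:R^-1)%:C : R[i]).
have L1 e : 0 < e -> exists M0, forall M, (M0 <= M)%N -> cabs (1 - L M.*2.+1) < e.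
  move=> e0.
  pose th := csum (fun x : int => gexp 1 (x%:~R ^+ 2) 0 : R[i]).
  have th0 : th != 0.
    apply: (@nonneg_sum_neq0 _ _ (fun x : int => expR (- (pi * x%:~R ^+ 2))) 0).
    - by move=> x; exact: expR_ge0.
    - exact: expR_gt0.
    - rewrite (_ : (fun x => _) = (fun x : int => gexp 1 ((x%:~R + 0) ^+ 2) 0 : R[i])).
        rewrite /th; under eq_csum => x do rewrite -[x%:~R]addr0.
        apply: asum_has_sum; have := gexp_asum 0 (fun=> 0) sector1.
        by rewrite expr1n.
      apply/funext => x; rewrite /gexp unit_exp0 !mulr1 addr0 -cexp_real.
      by rewrite realCN realCM.
  have e1 : 0 < e * cabs th by rewrite mulr_gt0// cabs_gt0.
  have [M0 hM0] := poisson_asymptotic 0 0 sector1 e1.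
  exists M0 => M /hM0; rewrite -/(L _) invr1 expr1n.
  under eq_csum => x do rewrite addr0 mul0r.
  rewrite -/th; under [X in _ - _ * X]eq_csum => x do rewrite mul1r subr0 mulr0.
  rewrite -/th -[X in X - _]mul1r -mulrBl cabsM.
  by rewrite ltr_pM2r// cabs_gt0.
apply/eqP; rewrite -subr_eq0 -cabs_eq0; set F := csum _; set H := csum _.
case: (eqVneq (cabs (F - H)) 0) => // h.
have e0 : 0 < cabs (F - H) / 2 by rewrite divr_gt0// lt_def h cabs_ge0.
have H0 : 0 < cabs H + 1 by rewrite ltr_wpDl// cabs_ge0.
have [M1 h1] := poisson_asymptotic b c sal e0.
have [M2 h2] := L1 _ (divr_gt0 e0 H0).
have := h1 _ (leq_maxl M1 M2); have := h2 _ (leq_maxr M1 M2).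
rewrite -/F -/H -/(L _); set N := _.+1; rewrite ltr_pdivlMr// => i2 i1.
have : cabs (F - H) <= cabs (F - L N * H) + cabs (1 - L N) * cabs H.
  rewrite -cabsM; apply: le_trans (cabsB _ _).
  by rewrite (_ : F - H = F - L N * H - (1 - L N) * H)//; ring.
have := cabs_ge0 (1 - L N); lra.
Qed.

End PoissonLine.

(** * Real quadratic forms *)

Section QuadraticForms.
Variable R : realType.

Definition qf m (S : 'M[R]_m) (x : 'cV[R]_m) : R := (x^T *m S *m x) 0 0.
Definition lf m (c x : 'cV[R]_m) : R := (c^T *m x) 0 0.
Definition frob2 m n (X : 'M[R]_(m, n)) : R := \sum_i \sum_j X i j ^+ 2.

Lemma lfDl m (c d x : 'cV[R]_m) : lf (c + d) x = lf c x + lf d x.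
Proof. by rewrite /lf linearD /= mulmxDl mxE. Qed.

Lemma lfZl m (a : R) (c x : 'cV[R]_m) : lf (a *: c) x = a * lf c x.
Proof. by rewrite /lf linearZ /= -scalemxAl mxE. Qed.

Lemma lf_col_mx m (a b : R) (c d : 'cV[R]_m) :
  lf (col_mx a%:M c) (col_mx b%:M d) = a * b + lf c d.
Proof. by rewrite /lf tr_col_mx mul_row_col mxE tr_scalar_mx -scalar_mxM mxE eqxx. Qed.

Lemma frob2_trace m n (X : 'M[R]_(m, n)) : \tr (X *m X^T) = frob2 X.
Proof.
apply: eq_bigr => i _; rewrite mxE; apply: eq_bigr => j _.
by rewrite mxE expr2.
Qed.

Lemma frob2_ge0 m n (X : 'M[R]_(m, n)) : 0 <= frob2 X.
Proof. by apply: sumr_ge0 => i _; apply: sumr_ge0 => j _; exact: sqr_ge0. Qed.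

Lemma frob2_eq0 m n (X : 'M[R]_(m, n)) : frob2 X = 0 -> X = 0.
Proof.
move=> h; apply/matrixP => i j; rewrite mxE; apply/eqP; rewrite -sqrf_eq0.
have hi : \sum_j X i j ^+ 2 = 0.
  apply: (psumr_eq0P _ h) => // k _; apply: sumr_ge0 => l _; exact: sqr_ge0.
by apply/eqP; apply: (psumr_eq0P _ hi) => // k _; exact: sqr_ge0.
Qed.

Lemma frob2_tr m n (X : 'M[R]_(m, n)) : frob2 X^T = frob2 X.
Proof.
rewrite /frob2 exchange_big /=; apply: eq_bigr => i _; apply: eq_bigr => j _.
by rewrite mxE.
Qed.

Lemma cauchy_schwarz_sum (I : finType) (a b : I -> R) :
  (\sum_i a i * b i) ^+ 2 <= (\sum_i a i ^+ 2) * (\sum_i b i ^+ 2).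
Proof.
set A := \sum_i a i ^+ 2; set B := \sum_i b i ^+ 2; set C := \sum_i a i * b i.
have B0 : 0 <= B by apply: sumr_ge0 => i _; exact: sqr_ge0.
have h : 0 <= \sum_i (B * a i - C * b i) ^+ 2 by apply: sumr_ge0 => i _; exact: sqr_ge0.
have e : \sum_i (B * a i - C * b i) ^+ 2 = B * (A * B - C ^+ 2).
  rewrite (eq_bigr (fun i => B ^+ 2 * a i ^+ 2 - 2 * B * C * (a i * b i) + C ^+ 2 * b i ^+ 2)).
    rewrite big_split /= sumrB -!mulr_sumr -/A -/B -/C; ring.
  by move=> i _; ring.
rewrite e in h; have [B1|B1] := ltP 0 B; first by rewrite pmulr_rge0// subr_ge0 in h.
have Bz : B = 0 by apply/eqP; rewrite eq_le B1 B0.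
rewrite Bz mulr0 /C big1 ?expr0n// => i _.
have /eqP := psumr_eq0P (fun i _ => sqr_ge0 (b i)) Bz (i := i) isT.
by rewrite sqrf_eq0 => /eqP ->; rewrite mulr0.
Qed.

Lemma frob2_mul m n p (A : 'M[R]_(m, n)) (X : 'M[R]_(n, p)) :
  frob2 (A *m X) <= frob2 A * frob2 X.
Proof.
rewrite -[frob2 X]frob2_tr /frob2 mulr_suml; apply: ler_sum => i _.
rewrite mulr_sumr; apply: ler_sum => j _; rewrite mxE.
apply: le_trans (cauchy_schwarz_sum _ _) _; rewrite le_eqVlt; apply/orP; left.
by apply/eqP; congr (_ * _); apply: eq_bigr => k _; rewrite mxE.
Qed.

Lemma posdef_unit m (S : 'M[R]_m) : posdefmx S -> S \in unitmx.
Proof.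
move=> pS; rewrite unitmxE unitfE; apply/negP => /det0P[v v0 vS].
have := pS v^T; rewrite trmx_eq0 v0 trmxK vS mul0mx mxE ltxx.
by move=> /(_ isT).
Qed.

Lemma qf_congr m (S L : 'M[R]_m) x : qf (L^T *m S *m L) x = qf S (L *m x).
Proof. by rewrite /qf trmx_mul !mulmxA. Qed.

Lemma posdef_ge0 m (S : 'M[R]_m) x : posdefmx S -> 0 <= qf S x.
Proof.
move=> pS; have [->|x0] := eqVneq x 0; first by rewrite /qf mulmx0 mxE.
exact/ltW/pS.
Qed.

Lemma posdef_inv m (S : 'M[R]_m) : S^T = S -> posdefmx S -> posdefmx (invmx S).
Proof.
move=> sS pS x x0; have uS := posdef_unit pS.
have -> : (x^T *m invmx S *m x) 0 0 = qf S (invmx S *m x).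
  by rewrite -qf_congr trmx_inv sS mulVmx// mul1mx.
apply: pS; apply: contra_neq x0 => h.
by rewrite -[x]mul1mx -(mulmxV uS) -mulmxA h mulmx0.
Qed.

(** * Splitting off the first variable of a quadratic form *)

Section Schur.
Variables (m : nat) (S : 'M[R]_(1 + m)).
Hypotheses (sS : S^T = S) (pS : posdefmx S).

Definition schur_pivot : R := S 0 0.
Definition schur_shift : 'cV[R]_m := schur_pivot^-1 *: dlsubmx S.
Definition schur_compl : 'M[R]_m :=
  drsubmx S - schur_pivot *: (schur_shift *m schur_shift^T).
Let s := schur_pivot.
Let be := schur_shift.
Let S' := schur_compl.

Lemma schur_pivot_gt0 : 0 < s.
Proof.
have := pS (x := delta_mx 0 0).
have d0 : delta_mx 0 0 != 0 :> 'cV[R]_(1 + m).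
  by apply/eqP => /matrixP/(_ 0 0); rewrite !mxE eqxx; apply/eqP; rewrite oner_eq0.
move=> /(_ d0); rewrite -mulmxA -colE trmx_delta -rowE.
by rewrite !mxE.
Qed.

Let s0 : s != 0. Proof. exact: lt0r_neq0 schur_pivot_gt0. Qed.

Definition schur_L : 'M[R]_(1 + m) := block_mx 1%:M be^T 0 1%:M.
Definition schur_Linv : 'M[R]_(1 + m) := block_mx 1%:M (- be^T) 0 1%:M.

Lemma schur_LK : schur_L *m schur_Linv = 1%:M.
Proof.
rewrite /schur_L /schur_Linv mulmx_block !mulmx1 !mul1mx !mul0mx !mulmx0 !addr0 add0r.
by rewrite addNr -scalar_mx_block.
Qed.

Lemma schur_decomp : S = schur_L^T *m block_mx s%:M 0 0 S' *m schur_L.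
Proof.
have dS : dlsubmx S = s *: be by rewrite scalerA mulfV// scale1r.
have uS : ursubmx S = s *: be^T by rewrite -linearZ /= -dS trmx_dlsub sS.
have lS : ulsubmx S = s%:M.
  apply/matrixP => i j; rewrite !mxE !ord1 eqxx mulr1n /s /schur_pivot.
  by congr (S _ _); apply/val_inj.
rewrite -[LHS]submxK dS uS lS /schur_L tr_block_mx !trmx1 trmx0 trmxK.
rewrite !mulmx_block !mul1mx !mul0mx !mulmx0 !mulmx1 !addr0 !add0r.
congr block_mx.
- by rewrite mul_scalar_mx.
- by rewrite mul_mx_scalar.
- by rewrite mul_mx_scalar -scalemxAl /S' /schur_compl -/s -/be addrC subrK.
Qed.

Lemma schur_sym : S'^T = S'.
Proof.
rewrite /S' /schur_compl linearB linearZ /= trmx_mul trmxK.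
by rewrite trmx_drsub sS.
Qed.

Lemma qf_block (a k : R) (T : 'M[R]_m) (y : 'cV[R]_m) :
  qf (block_mx a%:M 0 0 T) (col_mx k%:M y) = a * k ^+ 2 + qf T y.
Proof.
rewrite /qf tr_col_mx mul_row_block !mulmx0 addr0 add0r mul_row_col mxE.
rewrite tr_scalar_mx -!scalar_mxM mxE eqxx mulr1n; congr (_ + _); ring.
Qed.

Lemma schur_L_col (k : R) (y : 'cV[R]_m) :
  schur_L *m col_mx k%:M y = col_mx (k + lf be y)%:M y.
Proof.
rewrite /schur_L mul_block_col !mul1mx mul0mx add0r; congr col_mx.
by rewrite raddfD /=; congr (_ + _); rewrite [LHS]mx11_scalar.
Qed.

Lemma schur_Linv_col (k : R) (y : 'cV[R]_m) :
  schur_Linv^T *m col_mx k%:M y = col_mx k%:M (y - k *: be).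
Proof.
rewrite /schur_Linv tr_block_mx !trmx1 trmx0 linearN /= trmxK.
by rewrite mul_block_col !mul1mx mul0mx addr0 mulNmx mul_mx_scalar addrC.
Qed.

Lemma schur_qf (k : R) (y : 'cV[R]_m) :
  qf S (col_mx k%:M y) = s * (k + lf be y) ^+ 2 + qf S' y.
Proof. by rewrite [in LHS]schur_decomp qf_congr schur_L_col qf_block. Qed.

Lemma schur_posdef : posdefmx S'.
Proof.
move=> y y0; have := pS (x := col_mx (- lf be y)%:M y).
rewrite -/(qf S _) schur_qf addNr expr0n mulr0 add0r; apply.
by apply: contra_neq y0 => /(congr1 dsubmx); rewrite col_mxKd linear0.
Qed.

Lemma schur_det : \det S = s * \det S'.
Proof.
rewrite [in LHS]schur_decomp !det_mulmx det_tr /schur_L !det_ublock !det1 det_scalar1.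
by rewrite !mul1r mulr1.
Qed.

Lemma schur_inv : invmx S = schur_Linv *m block_mx s^-1%:M 0 0 (invmx S') *m schur_Linv^T.
Proof.
have uS := posdef_unit pS; have uS' := posdef_unit schur_posdef.
set T := _ *m schur_Linv^T; suff ST : S *m T = 1%:M.
  by rewrite -[T]mul1mx -(mulVmx uS) -mulmxA ST mulmx1.
rewrite {1}schur_decomp /T.
have LLt : schur_L^T *m schur_Linv^T = 1%:M.
  by rewrite -trmx_mul (mulmx1C schur_LK) trmx1.
rewrite -!mulmxA [schur_L *m (_ *m _)]mulmxA schur_LK mul1mx.
rewrite [block_mx s%:M _ _ _ *m _]mulmxA mulmx_block.
rewrite !mulmx0 !mul0mx !addr0 !add0r -scalar_mxM mulfV// mulmxV//.
by rewrite -scalar_mx_block mul1mx LLt.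
Qed.

(** In [S] the vector [be] shifts the first variable; in the inverse form it shifts the other ones.
    This is the exchange that Poisson summation in the first variable performs, and it makes the
    induction of [poisson_lattice] close up. *)
Lemma schur_qf_inv (k : R) (y : 'cV[R]_m) :
  qf (invmx S) (col_mx k%:M y) = s^-1 * k ^+ 2 + qf (invmx S') (y - k *: be).
Proof.
by rewrite schur_inv -{1}[schur_Linv]trmxK qf_congr schur_Linv_col qf_block.
Qed.

End Schur.

Lemma cholesky m (S : 'M[R]_m) : S^T = S -> posdefmx S -> exists P : 'M[R]_m, S = P^T *m P.
Proof.
elim: m S => [|m IH] S sS pS; first by exists 0; rewrite [LHS]thinmx0 mulmx0.
have [P hP] := IH _ (schur_sym sS) (schur_posdef sS pS).
have s0 := schur_pivot_gt0 pS.
exists (block_mx (Num.sqrt (schur_pivot S))%:M 0 0 P *m schur_L S).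
rewrite [LHS](schur_decomp sS pS) trmx_mul -!mulmxA; congr (_ *m _).
rewrite !mulmxA; congr (_ *m _).
rewrite (@tr_block_mx _ 1 m 1 m) !trmx0 (@mulmx_block _ 1 m 1 m 1 m) !mulmx0 !mul0mx !addr0 add0r -hP.
by rewrite tr_scalar_mx -scalar_mxM -expr2 sqr_sqrtr// ltW.
Qed.

(** Cholesky factors turn the trace into the squared Frobenius norm of [P X Q^T], and [X] is
    recovered through the inverse factors. Submultiplicativity then gives an explicit lower
    constant. *)
Lemma trace_form_lower m n (S : 'M[R]_m) (Y : 'M[R]_n) :
  S^T = S -> posdefmx S -> Y^T = Y -> posdefmx Y ->
  exists2 c, 0 < c & forall X : 'M[R]_(m, n), c * frob2 X <= \tr (S *m X *m Y *m X^T).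
Proof.
move=> sS pS sY pY; have [P SP] := cholesky sS pS; have [Q YQ] := cholesky sY pY.
have uP : P \in unitmx.
  by have := posdef_unit pS; rewrite SP unitmx_mul => /andP[].
have uQ : Q \in unitmx.
  by have := posdef_unit pY; rewrite YQ unitmx_mul => /andP[].
(* The [+ 1] keeps [K] positive also in size 0. *)
pose K := frob2 (invmx P) * frob2 (invmx Q) + 1.
have K0 : 0 < K by rewrite ltr_wpDl// mulr_ge0// frob2_ge0.
exists K^-1 => [|X]; first by rewrite invr_gt0.
pose Z := P *m X *m Q^T.
have -> : \tr (S *m X *m Y *m X^T) = frob2 Z.
  rewrite -frob2_trace SP YQ /Z !trmx_mul trmxK -!mulmxA mxtrace_mulC.
  by rewrite !mulmxA.
rewrite mulrC ler_pdivrMr//.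
have -> : X = invmx P *m Z *m (invmx Q)^T.
  rewrite /Z trmx_inv !mulmxA mulVmx// mul1mx -mulmxA.
  by rewrite mulmxV ?unitmx_tr// mulmx1.
apply: le_trans (frob2_mul _ _) _; rewrite frob2_tr.
apply: (@le_trans _ _ (frob2 (invmx P) * frob2 Z * frob2 (invmx Q))).
  by rewrite ler_wpM2r ?frob2_ge0// frob2_mul.
by rewrite mulrAC [leRHS]mulrC ler_wpM2r ?frob2_ge0// lerDl.
Qed.

Lemma qf_lower m (S : 'M[R]_m) : S^T = S -> posdefmx S ->
  exists2 c, 0 < c & forall x : 'cV[R]_m, c * frob2 x <= qf S x.
Proof.
move=> sS pS; have [] := @trace_form_lower m 1 S 1%:M sS pS (trmx1 _ _).
  move=> x x0; rewrite mulmx1 mxE big_ord1 mxE -expr2 lt_def sqr_ge0 andbT sqrf_eq0.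
  by apply: contra_neq x0 => h; apply/matrixP => i j; rewrite !ord1 h mxE.
move=> c c0 h; exists c => // x; apply: le_trans (h x) _.
by rewrite mulmx1 mxtrace_mulC /qf mulmxA trace_mx11.
Qed.

End QuadraticForms.

(** * Poisson summation on a lattice *)

(* Unification must not unfold the exponentials. *)
Local Opaque cexp unit_exp.

Section GaussianSummability.
Variable R : realType.

Definition splitcol m (p : int * 'cV[int]_m) : 'cV[int]_(1 + m) := col_mx p.1%:M p.2.

Lemma splitcol_bij m : bijective (@splitcol m).
Proof.
exists (fun v => (usubmx v 0 0, dsubmx v)) => [[k y]|v]; rewrite /splitcol /=.
  by rewrite col_mxKu col_mxKd mxE eqxx mulr1n.
by rewrite -[_%:M]mx11_scalar vsubmxK.
Qed.

Lemma map_splitcol m k (y : 'cV[int]_m) :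
  map_mx intr (splitcol (k, y)) = col_mx (k%:~R)%:M (map_mx intr y) :> 'cV[R]_(1 + m).
Proof. by rewrite map_col_mx map_scalar_mx. Qed.

Lemma frob2_col_mx m1 m2 n (A : 'M[R]_(m1, n)) (B : 'M[R]_(m2, n)) :
  frob2 (col_mx A B) = frob2 A + frob2 B.
Proof.
rewrite /frob2 big_split_ord /=; congr (_ + _); apply: eq_bigr => i _;
  apply: eq_bigr => j _; first by rewrite col_mxEu.
by rewrite col_mxEd.
Qed.

Lemma asum_bij (I J : choiceType) (h : I -> J) (f : J -> R[i]) :
  bijective h -> asum (f \o h) -> asum f.
Proof.
move=> [k hk kh] /(@asum_reindex _ _ _ k) -/(_ (can_inj kh)).
by congr asum; apply/funext => j /=; rewrite kh.
Qed.

Lemma has_sum_singleton (I : choiceType) (f : I -> R[i]) (i0 : I) :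
  (forall i, i = i0) -> has_sum f (f i0).
Proof.
move=> h; have := @finite_has_sum R I f [fset i0]%fset.
by rewrite big_seq_fset1; apply => i; rewrite (h i) inE eqxx.
Qed.

Lemma asum_singleton (I : choiceType) (f : I -> R[i]) (i0 : I) :
  (forall i, i = i0) -> asum f.
Proof.
move=> h; exists (cabs (f i0)) => A.
have AB : (A `<=` [fset i0])%fset by apply/fsubsetP => i _; rewrite (h i) inE.
apply: le_trans (ler_sum_fset _ AB) _ => [i|]; first exact: cabs_ge0.
by rewrite big_seq_fset1.
Qed.

Lemma asum_gauss_col m (d : R) : 0 < d ->
  asum (fun x : 'cV[int]_m => (expR (- (d * frob2 (map_mx intr x : 'cV[R]_m))))%:C).
Proof.
move=> d0; elim: m => [|m IH].
  by apply: (@asum_singleton _ _ 0) => x; exact: flatmx0.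
apply: (asum_bij (@splitcol_bij m)).
have p0 : 0 < pi :> R := pi_gt0 R.
(* With [al^2 = d / pi] the one-variable term of [gexp_asum] has exponent exactly [- d x^2]. *)
have r0 : 0 < Num.sqrt (d / pi) by rewrite sqrtr_gt0 divr_gt0.
have sr : `|Im (Num.sqrt (d / pi))%:C| < Re (Num.sqrt (d / pi))%:C by rewrite /= normr0.
have h1 := gexp_asum 0 (fun=> 0) sr.
apply: asum_le1 (asum_prod h1 IH) => -[k y] /=.
rewrite cabsM cabs_gexp !cabs_real !gtr0_norm ?expR_gt0// -expRD ler_expR.
rewrite -realCX sqr_sqrtr; last by rewrite ltW// divr_gt0.
rewrite /= addr0 -opprD lerN2 map_splitcol (@frob2_col_mx 1 m 1) mulrDr.
rewrite le_eqVlt; apply/orP; left; apply/eqP; congr (_ + _).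
rewrite /frob2 !big_ord1 mxE eqxx mulr1n [pi * (_ / _)]mulrC divfK//.
by rewrite gt_eqF.
Qed.

Lemma asum_gauss_mx m n (d : R) : 0 < d ->
  asum (fun X : 'M[int]_(m, n) => (expR (- (d * frob2 (map_mx intr X : 'M[R]_(m, n)))))%:C).
Proof.
move=> d0; have := @asum_reindex R _ _ (fun X : 'M[int]_(m, n) => (mxvec X)^T) _ _
  (@asum_gauss_col (m * n) d d0).
have inj : injective (fun X : 'M[int]_(m, n) => (mxvec X)^T).
  by move=> X Y /trmx_inj /(can_inj mxvecK).
move=> /(_ inj); congr asum; apply/funext => X /=; congr (expR (- (_ * _)))%:C.
rewrite -?map_trmx frob2_tr map_mxvec /frob2 big_ord1 pair_big /=.
rewrite (reindex _ (curry_mxvec_bij m n)) /=; apply: eq_bigr => -[i j] _.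
by rewrite mxvecE.
Qed.

Lemma sector_sqr_gt0 (al : R[i]) : `|Im al| < Re al -> 0 < Re (al ^+ 2).
Proof.
case: al => a b /= h; rewrite subr_gt0 -!expr2 -(real_normK (num_real b)).
by rewrite ltr_pXn2r// nnegrE ?(le_trans _ (ltW h)).
Qed.

Lemma frob2_shift m n (X B : 'M[R]_(m, n)) : frob2 X / 2 - frob2 B <= frob2 (X + B).
Proof.
rewrite /frob2 mulr_suml -sumrB; apply: ler_sum => i _.
rewrite mulr_suml -sumrB; apply: ler_sum => j _; rewrite mxE.
have := sqr_ge0 (X i j + 2 * B i j); lra.
Qed.

Lemma gexp_qf_asum m (S : 'M[R]_m) (al : R[i]) (b : 'cV[R]_m) (l : 'cV[int]_m -> R) :
  `|Im al| < Re al -> S^T = S -> posdefmx S ->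
  asum (fun x => gexp (al ^+ 2) (qf S (map_mx intr x + b)) (l x)).
Proof.
move=> sal sS pS; have [c c0 hc] := qf_lower sS pS.
have a0 := sector_sqr_gt0 sal; have p0 : 0 < pi :> R := pi_gt0 R.
set r := pi * Re (al ^+ 2); have r0 : 0 < r by rewrite mulr_gt0.
have d0 : 0 < r * c / 2 by rewrite divr_gt0 ?mulr_gt0.
apply: asum_le (@asum_gauss_col m _ d0) => [|x].
  exact: (expR_ge0 (r * c * frob2 b)).
rewrite cabs_gexp cabs_real gtr0_norm ?expR_gt0// -expRD ler_expR -/r.
set X : 'cV[R]_m := map_mx intr x.
have := le_trans (ler_wpM2l (ltW c0) (frob2_shift X b)) (hc (X + b)).
by rewrite -(ler_pM2l r0); move: (frob2 X) (frob2 b) (qf _ _) => u v q; lra.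
Qed.

Lemma gexp_scale (z : R[i]) (s q l : R) : gexp z (s * q) l = gexp (z * s%:C) q l.
Proof. by rewrite /gexp realCM !mulrA. Qed.

(** One variable at a time. For frozen other variables [y] the first one has a shift depending on
    [y]; the one-variable formula turns this shift into a phase linear in [y], which joins the
    linear form of the remaining variables. This is why the statement carries both [b] and [c]. *)
Theorem poisson_lattice m (S : 'M[R]_m) (al : R[i]) (b c : 'cV[R]_m) :
  `|Im al| < Re al -> S^T = S -> posdefmx S ->
  csum (fun x : 'cV[int]_m =>
    gexp (al ^+ 2) (qf S (map_mx intr x + b)) (lf c (map_mx intr x + b))) =
  (al^-1) ^+ m * (Num.sqrt (\det S))^-1%:C * csum (fun k : 'cV[int]_m =>
    gexp (al^-1 ^+ 2) (qf (invmx S) (map_mx intr k - c)) (lf b (map_mx intr k))).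
Proof.
move=> sal; have sal' := sectorV sal.
elim: m S b c => [|m IH] S b c sS pS.
  have h (f : 'cV[int]_0 -> R[i]) : csum f = f 0.
    by apply: has_sum_csum; apply: has_sum_singleton => x; exact: flatmx0.
  rewrite !h expr0 det_mx00 sqrtr1 invr1 !mul1r /qf /lf.
  have z (u : 'rV[R]_0) (v : 'cV[R]_0) : (u *m v) 0 0 = 0 by rewrite mxE big_ord0.
  by rewrite !z /gexp !mulr0.
move: S b c sS pS; rewrite -[m.+1]/(1 + m)%N => S b c sS pS.
have s0 := schur_pivot_gt0 pS.
have sS' := schur_sym sS; have pS' := schur_posdef sS pS.
set s := schur_pivot S in s0 *; set S' := schur_compl S in sS' pS' *.
set be := schur_shift S.
pose b1 := usubmx b 0 0; pose b' : 'cV[R]_m := dsubmx b.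
pose c1 := usubmx c 0 0; pose c' : 'cV[R]_m := dsubmx c.
have bE : b = col_mx b1%:M b' by rewrite -mx11_scalar vsubmxK.
have cE : c = col_mx c1%:M c' by rewrite -mx11_scalar vsubmxK.
pose r := Num.sqrt s; have r0 : 0 < r by rewrite sqrtr_gt0.
(* The pivot is absorbed into the scalar: [al1 ^+ 2 = al ^+ 2 * s], and a positive real factor keeps
   [al1] in the sector. *)
pose al1 := al * r%:C.
have sal1 : `|Im al1| < Re al1.
  rewrite /al1; case: (al) sal => x y /= h; rewrite !(mulr0, addr0, add0r, subr0).
  by rewrite normrM (gtr0_norm r0) ltr_pM2r.
have al1E : al1 ^+ 2 = al ^+ 2 * s%:C by rewrite exprMn -realCX sqr_sqrtr// ltW.
have al1V : al1^-1 ^+ 2 = al^-1 ^+ 2 * s^-1%:C.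
  by rewrite exprVn al1E invfM exprVn realCV.
(* The mixed sum: dual in the first variable, direct in the others. *)
pose t2 (p : int * 'cV[int]_m) :=
  gexp (al1^-1 ^+ 2) ((p.1%:~R - c1) ^+ 2) (p.1%:~R * b1) *
  gexp (al ^+ 2) (qf S' (map_mx intr p.2 + b'))
    (lf (c' + (p.1%:~R - c1) *: be) (map_mx intr p.2 + b')).
have at2 : asum t2.
  have h1 := gexp_asum (- c1) (fun k => k%:~R * b1) (sectorV sal1).
  have h2 := gexp_qf_asum b' (fun=> 0) sal sS' pS'.
  apply: asum_le1 (asum_prod h1 h2) => p.
  by rewrite [cabs (t2 p)]cabsM [leRHS]cabsM !cabs_gexp.
have step1 : csum (fun x : 'cV[int]_(1 + m) =>
    gexp (al ^+ 2) (qf S (map_mx intr x + b)) (lf c (map_mx intr x + b))) = al1^-1 * csum t2.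
  have a1 := gexp_qf_asum b (fun x => lf c (map_mx intr x + b)) sal sS pS.
  rewrite -(csum_reindex (@splitcol_bij m) a1).
  rewrite -csum_fubiniC; last by apply: asum_reindex a1; exact: bij_inj (@splitcol_bij m).
  rewrite -csumZ// -csum_fubiniC; last exact: asumZ.
  apply: eq_csum => y.
  pose Y := map_mx intr y + b' : 'cV[R]_m; pose B := b1 + lf be Y.
  pose Q := gexp (al ^+ 2) (qf S' Y) (lf (c' - c1 *: be) Y).
  transitivity (Q * csum (fun k : int => gexp (al1 ^+ 2) ((k%:~R + B) ^+ 2) (c1 * (k%:~R + B)))).
    rewrite -csumZ; last exact: gexp_asum.
    apply: eq_csum => k; rewrite /= map_splitcol bE add_col_mx -raddfD /= -/Y.
    rewrite schur_qf// cE lf_col_mx al1E -gexp_scale -/s -/S' -/be.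
    rewrite /Q [RHS]mulrC -[RHS]gexpD.
    have -> : k%:~R + b1 + lf be Y = k%:~R + B by rewrite /B addrA.
    have -> // : c1 * (k%:~R + b1) + lf c' Y = c1 * (k%:~R + B) + lf (c' - c1 *: be) Y.
    by rewrite (lfDl c') -scaleNr (lfZl _ be) /B; ring.
  rewrite poisson_line// mulrCA -csumZ; last exact: gexp_asum (- c1) _ (sectorV sal1).
  rewrite -csumZ; last first.
    by apply: asumZ; exact: gexp_asum (- c1) _ (sectorV sal1).
  apply: eq_csum => k; congr (_ * _); rewrite /t2 /= -/Y /Q mulrC.
  set v := k%:~R - c1; set Bk := k%:~R * B.
  (* The phase produced by the shift [lf be Y] combines with [c1], so that [be] enters with
     coefficient [k - c1]. *)
  have key : unit_exp Bk * unit_exp (lf (c' - c1 *: be) Y) =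
      unit_exp (k%:~R * b1) * unit_exp (lf (c' + v *: be) Y) :> R[i].
    rewrite -!unit_expD; have -> // : Bk + lf (c' - c1 *: be) Y = k%:~R * b1 + lf (c' + v *: be) Y.
    by rewrite !(lfDl c') -scaleNr !(lfZl _ be) /Bk /B /v; ring.
  rewrite /gexp mulrACA key; ring.
pose D : R[i] := (al^-1) ^+ m * (Num.sqrt (\det S'))^-1%:C.
pose t3 (x : 'cV[int]_(1 + m)) :=
  gexp (al^-1 ^+ 2) (qf (invmx S) (map_mx intr x - c)) (lf b (map_mx intr x)).
have at3 : asum t3.
  apply: (gexp_qf_asum (- c)) => //; first by rewrite trmx_inv sS.
  exact: posdef_inv.
have at3' : asum (t3 \o @splitcol m) by apply: asum_reindex at3; exact: bij_inj (@splitcol_bij m).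
have step2 : csum t2 = D * csum t3.
  rewrite -(csum_reindex (@splitcol_bij m) at3) -csumZ// -csum_fubini// -csum_fubini; last exact: asumZ.
  apply: eq_csum => k; rewrite [RHS]csumZ; last exact: (asum_slice k at3').
  rewrite /t2 /= csumZ; last exact: gexp_qf_asum.
  rewrite IH// mulrCA; congr (_ * _).
  rewrite -csumZ; last first.
    apply: (gexp_qf_asum (- _)) => //; first by rewrite trmx_inv sS'.
    exact: posdef_inv.
  apply: eq_csum => y; rewrite /= /t3 map_splitcol {1}cE {1}bE.
  rewrite opp_col_mx -raddfN add_col_mx -raddfD /= schur_qf_inv// lf_col_mx gexpD.
  rewrite al1V -gexp_scale -/s [b1 * _]mulrC.
  have -> // : map_mx intr y - c' - (k%:~R - c1) *: be =
    map_mx intr y - (c' + (k%:~R - c1) *: be) :> 'cV[R]_m by rewrite opprD addrA.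
rewrite step1 step2 mulrA; congr (_ * _).
rewrite /D schur_det// sqrtrM; last exact: ltW.
rewrite -/s -/r -/S' /al1 !realCV realCM !invfM exprS; ring.
Qed.

End GaussianSummability.

(** * Generators of the integral symplectic group *)

Section SymplecticGenerators.

(** The matrix with rows (0, -1) and (1, 0) in the plane spanned by the i-th coordinates of the two
    halves, and the identity elsewhere. *)
Definition partial_inversion n (i : 'I_n) : 'M[int]_(n + n) :=
  block_mx (1%:M - delta_mx i i) (- delta_mx i i) (delta_mx i i) (1%:M - delta_mx i i).

(** Only products are constructors. Inverses are recovered in [sp_gen_inv], so a property of all
    generated matrices has to be checked only on generators and products. *)
Inductive sp_gen n : 'M[int]_(n + n) -> Prop :=
| sp_gen_T (S : 'M[int]_n) : S^T = S -> sp_gen (block_mx 1%:M S 0 1%:M)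
| sp_gen_U (U V : 'M[int]_n) : U *m V = 1%:M -> sp_gen (block_mx U 0 0 V^T)
| sp_gen_J (i : 'I_n) : sp_gen (partial_inversion i)
| sp_gen_mul g h : sp_gen g -> sp_gen h -> sp_gen (g *m h).

Lemma sp_gen1 n : sp_gen (1%:M : 'M[int]_(n + n)).
Proof. by rewrite scalar_mx_block; apply: sp_gen_T; rewrite trmx0. Qed.

Lemma Sp_intP n (A B C D : 'M[int]_n) : block_mx A B C D \in @Sp_int n <->
  [/\ A^T *m C = C^T *m A, B^T *m D = D^T *m B & A^T *m D - C^T *m B = 1%:M].
Proof.
rewrite inE /symplectic_form tr_block_mx !mulmx_block.
rewrite !mulmx0 !mulmxN !mulmx1 !add0r !addr0 !mulNmx.
split=> [/eqP/eq_block_mx[h1 h2 h3 h4]|[h1 h2 h3]].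
  split.
  - by apply/eqP; rewrite -subr_eq0 addrC h1.
  - by apply/eqP; rewrite -subr_eq0 addrC h4.
  - by rewrite addrC h2.
apply/eqP; congr block_mx.
- by rewrite h1 addNr.
- by rewrite addrC h3.
- have <- : D^T *m A - B^T *m C = 1%:M.
    by rewrite -[RHS]trmx1 -h3 linearB /= !trmx_mul !trmxK.
  by rewrite opprB addrC.
- by rewrite h2 addNr.
Qed.

Lemma Sp_int_mul n g h : g \in @Sp_int n -> h \in @Sp_int n -> g *m h \in @Sp_int n.
Proof.
rewrite !inE => /eqP hg /eqP hh; rewrite trmx_mul -!mulmxA [g^T *m _]mulmxA.
by rewrite [_ *m (g *m h)]mulmxA hg [h^T *m _]mulmxA hh.
Qed.

Lemma partial_inversion_idem n (i : 'I_n) :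
  delta_mx i i *m delta_mx i i = delta_mx i i :> 'M[int]_n.
Proof. by rewrite mul_delta_mx. Qed.

Lemma sp_gen_Sp n g : sp_gen g -> g \in @Sp_int n.
Proof.
elim=> [S sS|U V UV|i|g1 g2 _ h1 _ h2]; last exact: Sp_int_mul.
- by apply/Sp_intP; rewrite trmx0 trmx1 sS !mulmx0 !mul0mx !mulmx1 !mul1mx subr0.
- apply/Sp_intP; rewrite !trmx0 !mulmx0 !mul0mx subr0 -trmx_mul.
  by rewrite (mulmx1C UV) trmx1.
- rewrite /partial_inversion; have E2 := partial_inversion_idem i.
  have tE : (delta_mx i i)^T = delta_mx i i :> 'M[int]_n by rewrite trmx_delta.
  move: (delta_mx i i) E2 tE => E E2 tE.
  have t1E : (1%:M - E)^T = 1%:M - E by rewrite linearB /= trmx1 tE.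
  have tNE : (- E)^T = - E by rewrite linearN /= tE.
  apply/Sp_intP; rewrite t1E tNE tE.
  rewrite !(mulmxBl, mulmxBr, mulmxN, mulNmx, mul1mx, mulmx1) E2.
  by split; apply/matrixP => a b; rewrite !mxE; ring.
Qed.

Lemma sp_gen_inv n (g : 'M[int]_(n + n)) : sp_gen g -> exists2 h, sp_gen h & g *m h = 1%:M.
Proof.
elim=> [S sS|U V UV|i|g1 g2 _ [h1 gh1 e1] _ [h2 gh2 e2]].
- exists (block_mx 1%:M (- S) 0 1%:M); first by apply: sp_gen_T; rewrite linearN /= sS.
  rewrite mulmx_block !mulmx0 !mul0mx !mul1mx !mulmx1 !addr0 add0r addNr.
  by rewrite -scalar_mx_block.
- exists (block_mx V 0 0 U^T); first by apply: sp_gen_U; exact: mulmx1C.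
  rewrite mulmx_block !mulmx0 !mul0mx !addr0 add0r UV -trmx_mul UV trmx1.
  by rewrite -scalar_mx_block.
(* The square of a partial inversion changes the sign of the i-th coordinate in both halves. This is
   a congruence of order 2, which therefore corrects the partial inversion into its own inverse. *)
- pose F : 'M[int]_n := 1%:M - delta_mx i i - delta_mx i i.
  suff [F2 J2] : F *m F = 1%:M /\
      partial_inversion i *m partial_inversion i = block_mx F 0 0 F^T.
    exists (partial_inversion i *m block_mx F 0 0 F^T).
      by apply: sp_gen_mul; [exact: sp_gen_J|exact: sp_gen_U].
    rewrite mulmxA J2 mulmx_block !mulmx0 !mul0mx !addr0 add0r -trmx_mul F2 trmx1.
    by rewrite -scalar_mx_block.
  rewrite /partial_inversion /F; have E2 := partial_inversion_idem i.
  have tE : (delta_mx i i)^T = delta_mx i i :> 'M[int]_n by rewrite trmx_delta.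
  move: (delta_mx i i) E2 tE => E E2 tE {F}.
  have tF : (1%:M - E - E)^T = 1%:M - E - E by rewrite !linearB /= trmx1 tE.
  rewrite tF mulmx_block !(mulmxBl, mulmxBr, mulmxN, mulNmx, mul1mx, mulmx1) E2.
  by split; [|congr block_mx]; apply/matrixP => a b; rewrite !mxE; ring.
- exists (h2 *m h1); first exact: sp_gen_mul.
  by rewrite mulmxA -[g1 *m g2 *m h2]mulmxA e2 mulmx1.
Qed.

Lemma sp_gen_cancell n (g x : 'M[int]_(n + n)) : sp_gen g -> sp_gen (g *m x) -> sp_gen x.
Proof.
move=> /sp_gen_inv[h hh e] gx; rewrite -[x]mul1mx -(mulmx1C e) -mulmxA.
exact: sp_gen_mul.
Qed.

Lemma sp_gen_cancelr n (g x : 'M[int]_(n + n)) : sp_gen g -> sp_gen (x *m g) -> sp_gen x.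
Proof.
move=> /sp_gen_inv[h hh e] gx; rewrite -[x]mulmx1 -e mulmxA.
exact: sp_gen_mul.
Qed.

(** * The symplectic group of degree n inside that of degree n + 1 *)

Section Embedding.
Variable n : nat.

Definition sp_embed (g : 'M[int]_(n + n)) : 'M[int]_((1 + n) + (1 + n)) :=
  block_mx (block_mx 1%:M 0 0 (ulsubmx g)) (block_mx 0 0 0 (ursubmx g))
           (block_mx 0 0 0 (dlsubmx g)) (block_mx 1%:M 0 0 (drsubmx g)).

Lemma sp_embed_block A B C D : sp_embed (block_mx A B C D) =
  block_mx (block_mx 1%:M 0 0 A) (block_mx 0 0 0 B) (block_mx 0 0 0 C) (block_mx 1%:M 0 0 D).
Proof. by rewrite /sp_embed block_mxKul block_mxKur block_mxKdl block_mxKdr. Qed.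

Lemma sp_embedM g h : sp_embed (g *m h) = sp_embed g *m sp_embed h.
Proof.
rewrite -[g]submxK -[h]submxK mulmx_block !sp_embed_block !mulmx_block.
by rewrite !mulmx0 !mul0mx !mulmx1 !addr0 !add0r !add_block_mx !addr0 !add0r.
Qed.

Lemma sp_embed_gen g : sp_gen g -> sp_gen (sp_embed g).
Proof.
elim=> [S sS|U V UV|i|g1 g2 _ h1 _ h2].
- rewrite sp_embed_block block_mx0 -!scalar_mx_block; apply: sp_gen_T.
  by rewrite tr_block_mx !trmx0 sS.
- rewrite sp_embed_block !block_mx0.
  rewrite (_ : block_mx 1%:M 0 0 V^T = (block_mx 1%:M 0 0 V)^T); last first.
    by rewrite tr_block_mx !trmx0 trmx1.
  apply: sp_gen_U.
  by rewrite mulmx_block !mulmx0 !mul0mx !mulmx1 !addr0 !add0r UV -scalar_mx_block.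
- suff -> : sp_embed (partial_inversion i) = partial_inversion (rshift 1 i) by exact: sp_gen_J.
  have E : delta_mx (rshift 1 i) (rshift 1 i) = block_mx 0 0 0 (delta_mx i i) :> 'M[int]_(1 + n).
    apply/matrixP => a b; rewrite !mxE.
    case: split_ordP => a' ->; rewrite mxE; case: split_ordP => b' ->; rewrite !mxE.
    + by rewrite eq_lrshift.
    + by rewrite eq_lrshift.
    + by rewrite eq_lrshift andbF.
    + by rewrite !(inj_eq (@rshift_inj _ _)).
  rewrite sp_embed_block /partial_inversion E (scalar_mx_block 1).
  by rewrite opp_block_mx add_block_mx !oppr0 !addr0.
- by rewrite sp_embedM; exact: sp_gen_mul.
Qed.

Lemma sp_embed_Sp g : sp_embed g \in @Sp_int (1 + n) -> g \in @Sp_int n.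
Proof.
rewrite -[g]submxK sp_embed_block => /Sp_intP.
rewrite !tr_block_mx !mulmx_block !trmx0 !trmx1 !mulmx0 !mul0mx !mulmx1 !addr0 !add0r.
rewrite opp_block_mx add_block_mx !oppr0 !addr0 (scalar_mx_block 1).
move=> [/eq_block_mx[_ _ _ h1] /eq_block_mx[_ _ _ h2] /eq_block_mx[_ _ _ h3]].
exact/Sp_intP.
Qed.

End Embedding.

Lemma int_column_reduce n (q : 'cV[int]_n.+1) :
  exists2 W : 'M[int]_n.+1, W \in unitmx & exists d, W *m q = d *: delta_mx 0 0.
Proof.
have [L uL [X uX [d _ e]]] := int_Smith_normal_form q.
exists (invmx L); first by rewrite unitmx_inv.
exists (d`_0 * X 0 0); rewrite e !mulmxA mulVmx// mul1mx.
apply/matrixP => i j; rewrite !mxE big_ord1 !mxE !ord1 eqxx andbT.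
rewrite -val_eqE /=; case: eqP => [->|_]; first by rewrite mulr1n mulr1.
by rewrite mulr0n mul0r mulr0.
Qed.


(** Since [q] is [d] times a column of the inverse of [W], [d] divides every entry of [q]. The size
    bound is the descent of the Euclidean algorithm. *)
Lemma dvdz_column n (W : 'M[int]_n.+1) (q : 'cV[int]_n.+1) d i :
  W \in unitmx -> W *m q = d *: delta_mx 0 0 -> q i 0 != 0 -> d != 0 /\ (absz d <= absz (q i 0)%R)%N.
Proof.
move=> uW e qi.
have qE : q i 0 = d * invmx W i 0.
  by rewrite -[q]mul1mx -(mulVmx uW) -mulmxA e -scalemxAr -colE !mxE.
split; first by apply: contra_neq qi => d0; rewrite qE d0 mul0r.
rewrite dvdn_leq ?absz_gt0// qE abszM; exact: dvdn_mulr.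
Qed.

(* One round of the Euclidean algorithm: translate [p] modulo [d], exchange a nonzero
   remainder into the lower half with a partial inversion, and concentrate the lower half
   again in its first entry, which has become smaller. *)
Lemma sp_column_reduce n (p : 'cV[int]_n.+1) (d : int) : d != 0 ->
  exists2 g, sp_gen g & exists d', g *m col_mx p (d *: delta_mx 0 0) =
    col_mx 0 (d' *: delta_mx 0 0).
Proof.
have [N] := ubnP `|d|%N; elim: N p d => // N IH p d; rewrite ltnS => dN d0.
pose r i := modz (p i 0) d.
(* The lower half is [d] times the first basis vector, so only the first column of [S] acts on it.
   That column holds minus the quotients; its mirror image in the first row makes [S] symmetric. *)
pose S : 'M[int]_n.+1 := \matrix_(i, j)
  (if j == 0 then - divz (p i 0) d else if i == 0 then - divz (p j 0) d else 0).
have sS : S^T = S.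
  by apply/matrixP => i j; rewrite !mxE; case: (eqVneq i 0) => [h|_]; case: (eqVneq j 0) => [k|_] //; rewrite h k.
pose p' : 'cV[int]_n.+1 := \col_i r i.
have step1 : block_mx 1%:M S 0 1%:M *m col_mx p (d *: delta_mx 0 0) =
    col_mx p' (d *: delta_mx 0 0).
  rewrite mul_block_col !mul1mx mul0mx add0r; congr col_mx.
  apply/matrixP => i j; rewrite ord1 -scalemxAr -colE !mxE eqxx /r.
  by rewrite {1}(divz_eq (p i 0) d) mulrN mulrC addrAC subrr add0r.
case: (pickP (fun i => r i != 0)) => [i ri|r0]; last first.
  exists (block_mx 1%:M S 0 1%:M); first exact: sp_gen_T.
  exists d; rewrite step1; congr col_mx; apply/matrixP => i j.
  by rewrite !mxE; have /negbFE/eqP := r0 i.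
pose E := delta_mx i i : 'M[int]_n.+1.
pose q := E *m p' + (1%:M - E) *m (d *: delta_mx 0 0) : 'cV[int]_n.+1.
pose p'' := (1%:M - E) *m p' + - E *m (d *: delta_mx 0 0) : 'cV[int]_n.+1.
have step2 : partial_inversion i *m col_mx p' (d *: delta_mx 0 0) = col_mx p'' q.
  by rewrite mul_block_col.
have Ei (v : 'cV[int]_n.+1) : (E *m v) i 0 = v i 0.
  rewrite mxE (bigD1 i)//= mxE !eqxx mul1r big1 ?addr0// => k /negbTE ki.
  by rewrite mxE ki andbF mul0r.
(* The nonzero remainder is now an entry of the lower half, so the new [d'] divides it and is
   smaller than [d] in absolute value. *)
have qi : q i 0 = r i.
  rewrite /q mulmxBl mul1mx.
  transitivity ((E *m p') i 0 + ((d *: delta_mx 0 0 : 'cV[int]_n.+1) i 0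
      - (E *m (d *: delta_mx 0 0 : 'cV[int]_n.+1)) i 0)).
    by rewrite [LHS]mxE [X in _ + X]mxE [X in _ + (_ + X)]mxE.
  by rewrite !Ei subrr addr0 mxE.
have [W uW [d' We]] := int_column_reduce q.
have [d'0 d'le] := dvdz_column (i := i) uW We ltac:(by rewrite qi).
have UW : (invmx W)^T *m W^T = 1%:M by rewrite -trmx_mul mulmxV// trmx1.
have d'N : (absz d' < N)%N.
  apply: leq_ltn_trans d'le _; rewrite qi; apply: leq_trans dN.
  have := ltz_mod (p i 0) d0; have := modz_ge0 (p i 0) d0; rewrite -/(r i); lia.
have [g gg [d'' e]] := IH ((invmx W)^T *m p'') d' d'N d'0.
exists (g *m (block_mx (invmx W)^T 0 0 W^T^T *m (partial_inversion i *m block_mx 1%:M S 0 1%:M))).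
  apply: sp_gen_mul => //; apply: sp_gen_mul; first exact: sp_gen_U.
  by apply: sp_gen_mul; [exact: sp_gen_J|exact: sp_gen_T].
exists d''; rewrite -e -!mulmxA step1 step2; congr (_ *m _).
by rewrite mul_block_col !mul0mx addr0 add0r trmxK We.
Qed.

Lemma sp_column_first n (v : 'cV[int]_(n.+1 + n.+1)) :
  exists2 g, sp_gen g & exists d, g *m v = d *: delta_mx (lshift _ 0) 0.
Proof.
suff [g gg [d e]] : exists2 g, sp_gen g &
    exists d, g *m v = col_mx 0 (d *: delta_mx 0 0).
  exists (partial_inversion 0 *m g); first by apply: sp_gen_mul => //; exact: sp_gen_J.
  exists (- d); rewrite -mulmxA e mul_block_col !mulmx0 !add0r.
  rewrite mulmxBl mul1mx mulNmx -!scalemxAr mul_delta_mx subrr -scaleNr.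
  apply/matrixP => a b; rewrite !mxE; case: split_ordP => a' ->; rewrite !mxE.
    by rewrite (inj_eq (@lshift_inj _ _)).
  by rewrite eq_rlshift mulr0.
rewrite -[v]vsubmxK; move: (usubmx v) (dsubmx v) => p q {v}.
have start (i : 'I_n.+1) (p1 q1 : 'cV[int]_n.+1) : q1 i 0 != 0 -> exists2 g, sp_gen g &
    exists d, g *m col_mx p1 q1 = col_mx 0 (d *: delta_mx 0 0).
  move=> qi; have [W uW [d We]] := int_column_reduce q1.
  have [d0 _] := dvdz_column uW We qi.
  have UW : (invmx W)^T *m W^T = 1%:M by rewrite -trmx_mul mulmxV// trmx1.
  have [g gg [d' e]] := sp_column_reduce ((invmx W)^T *m p1) d0.
  exists (g *m block_mx (invmx W)^T 0 0 W^T^T).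
    by apply: sp_gen_mul => //; exact: sp_gen_U.
  exists d'; rewrite -e -mulmxA; congr (_ *m _).
  by rewrite mul_block_col !mul0mx addr0 add0r trmxK We.
case: (pickP (fun i => q i 0 != 0)) => [i qi|q0]; first exact: start qi.
have {q0}q0 : q = 0.
  by apply/matrixP => i j; rewrite ord1 mxE; have /negbFE/eqP := q0 i.
case: (pickP (fun i => p i 0 != 0)) => [i pi|p0]; last first.
  exists 1%:M; first exact: sp_gen1.
  exists 0; rewrite mul1mx scale0r q0; congr col_mx.
  by apply/matrixP => i j; rewrite ord1 mxE; have /negbFE/eqP := p0 i.
(* The reduction needs a nonzero lower half. When it vanishes, a partial inversion at a nonzero
   entry of [p] brings that entry down. *)
pose E := delta_mx i i : 'M[int]_n.+1.
have [|g gg [d e]] := start i ((1%:M - E) *m p) (E *m p).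
  rewrite mxE (bigD1 i)//= mxE !eqxx mul1r big1 ?addr0// => k /negbTE ki.
  by rewrite mxE ki andbF mul0r.
exists (g *m partial_inversion i); first by apply: sp_gen_mul => //; exact: sp_gen_J.
by exists d; rewrite -e -mulmxA mul_block_col q0 !mulmx0 !addr0.
Qed.

(** The relation exhibits [- J g^T J] as a left inverse of [g]; a one-sided inverse of a square
    matrix is two-sided. It gives closure under transposition. *)
Lemma Sp_int_dual n g : g \in @Sp_int n ->
  g *m symplectic_form n *m g^T = symplectic_form n.
Proof.
rewrite inE => /eqP h; set J := symplectic_form n in h *.
have J2 : J *m J = - 1%:M.
  rewrite /J /symplectic_form mulmx_block !mulmx0 !mul0mx !mulmxN !mulmx1 !addr0 !add0r.
  by rewrite [in RHS](scalar_mx_block n n) opp_block_mx oppr0.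
have e : g *m - (J *m (g^T *m J)) = 1%:M.
  by apply: mulmx1C; rewrite mulNmx -!mulmxA [g^T *m _]mulmxA h J2 opprK.
rewrite -[LHS]mulmx1 -[1%:M]opprK -J2 mulmxN !mulmxA -[g *m J *m g^T *m J]mulmxA.
by rewrite -[g *m J *m _]mulmxA -mulNmx -mulmxN e mul1mx.
Qed.

Lemma Sp_int_first_column n (g : 'M[int]_(n.+1 + n.+1)) : g \in @Sp_int n.+1 ->
  exists2 u, sp_gen u & u *m g *m col_mx (delta_mx 0 0) 0 = col_mx (delta_mx 0 0) 0 :> 'cV_ _.
Proof.
move=> hg; set e := col_mx _ _.
have eE : e = delta_mx (lshift _ 0) 0.
  apply/matrixP => a b; rewrite !mxE; case: split_ordP => a' ->; rewrite !mxE.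
    by rewrite (inj_eq (@lshift_inj _ _)).
  by rewrite eq_rlshift.
have [u gu [d]] := sp_column_first (g *m e); rewrite -eE mulmxA => ud.
have : u *m g \in @Sp_int n.+1 by apply: Sp_int_mul => //; exact: sp_gen_Sp.
rewrite inE => /eqP hs.
(* The first column of [u *m g] is [d] times a basis vector, so [d] divides all its symplectic
   pairings with the other columns. One of these pairings is 1. *)
have : (d %| (1%R : int))%Z.
  have := congr1 (fun X => (e^T *m X *m (symplectic_form n.+1)^T *m e) 0 0) hs.
  have -> : e^T *m symplectic_form n.+1 *m (symplectic_form n.+1)^T *m e = 1%:M.
    rewrite -[_ *m _ *m _^T]mulmxA (_ : symplectic_form _ *m _ = 1%:M); last first.
      rewrite /symplectic_form tr_block_mx !trmx0 trmx1 linearN /= trmx1 mulmx_block.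
      rewrite !mulmx0 !mul0mx !mulmx1 !mulNmx mulmxN mul1mx opprK !addr0 !add0r.
      by rewrite -scalar_mx_block.
    by rewrite mulmx1 eE trmx_delta mul_delta_mx; apply/matrixP => a b; rewrite !mxE !ord1 eqxx.
  rewrite [RHS]mxE eqxx mulr1n => <-.
  have -> : e^T *m ((u *m g)^T *m symplectic_form n.+1 *m (u *m g)) =
      d *: (e^T *m symplectic_form n.+1 *m (u *m g)).
    by rewrite !mulmxA -trmx_mul ud linearZ /= -!scalemxAl.
  by rewrite -!scalemxAl mxE dvdz_mulr// dvdzz.
move=> dd; have : (d %| 1)%Z by exact: dd.
rewrite dvdz1 => /eqP d1; case: d d1 ud {dd} => [[|[|k]]|[|k]]// _ ud.
  by exists u => //; rewrite ud scale1r.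
(* For [d = -1] the sign is removed by the congruence with [U = -1]. *)
exists (block_mx (- 1%:M) 0 0 (- 1%:M)^T *m u).
  by apply: sp_gen_mul => //; apply: sp_gen_U; rewrite mulmxN mulNmx mulmx1 opprK.
rewrite -!mulmxA [u *m _]mulmxA ud linearN /= trmx1.
have -> : block_mx (- 1%:M) 0 0 (- 1%:M) = - 1%:M :> 'M[int]_(n.+1 + n.+1).
  by rewrite [in RHS](scalar_mx_block n.+1 n.+1) opp_block_mx !oppr0.
by rewrite mulNmx mul1mx -scaleNr scale1r.
Qed.

Theorem Sp_int_generated n (g : 'M[int]_(n + n)) : g \in @Sp_int n -> sp_gen g.
Proof.
elim: n g => [|n IH] g hg.
  by have -> : g = 1%:M; [apply/matrixP => -[]|exact: sp_gen1].
have [u gu] := Sp_int_first_column hg.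
have {hg} : u *m g \in @Sp_int n.+1 by apply: Sp_int_mul => //; exact: sp_gen_Sp.
move=> hs he; apply: (sp_gen_cancell gu); move: (u *m g) hs he => {g u gu}.
rewrite -[n.+1]/(1 + n)%N => g hs.
set e : 'cV[int]_(1 + n) := delta_mx 0 0 => he.
have eT : e^T = row_mx 1%:M 0.
  apply/matrixP => a b; rewrite !mxE !ord1; case: split_ordP => b' ->; rewrite !mxE ?ord1.
    by rewrite !eqxx.
  by rewrite -val_eqE.
have eE : e = col_mx 1%:M 0 by rewrite -[e]trmxK eT tr_row_mx trmx1 trmx0.
pose J := symplectic_form (1 + n).
have Je : J *m col_mx e 0 = col_mx 0 (- e).
  by rewrite mul_block_col !mulmx0 mul0mx !addr0 mulNmx mul1mx.
(* Since g fixes the first basis vector, the symplectic relation determines the dual row. *)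
have row_fix h : h \in @Sp_int (1 + n) -> h *m col_mx e 0 = col_mx e 0 ->
    row_mx 0 e^T *m h = row_mx 0 e^T.
  move=> /[!inE]/eqP hh he'.
  have Je' : (col_mx e 0)^T *m J = row_mx 0 e^T.
    by rewrite tr_col_mx trmx0 mul_row_block !mulmx0 mul0mx !addr0 mulmx1.
  by rewrite -Je' -{1}he' trmx_mul -!mulmxA [h^T *m _]mulmxA hh.
have := row_fix _ hs he.
rewrite -[g]submxK in hs he *; move: (ulsubmx g) (ursubmx g) (dlsubmx g) (drsubmx g) hs he => A B C D hs.
rewrite mul_block_col !mulmx0 !addr0 => /eq_col_mx[Ae Ce].
rewrite mul_row_block !mul0mx !add0r => /eq_row_mx[eC eD].
have ee : e^T *m e = 1%:M by rewrite eT eE mul_row_col mulmx1 mulmx0 addr0.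
have left_col (v : 'rV[int]_(1 + n)) : v = row_mx (v *m e) (rsubmx v).
  by rewrite -{1 2}[v]hsubmxK eE mul_row_col mulmx1 mulmx0 addr0.
pose a := rsubmx (e^T *m A).
have eA : e^T *m A = row_mx 1%:M a by rewrite [LHS]left_col -mulmxA Ae ee.
(* The first row of [A] is [(1, a)]; multiplying by [U] on the right clears [a] and keeps the first
   basis vector. *)
pose U : 'M[int]_(1 + n) := block_mx 1%:M (- a) 0 1%:M.
pose V : 'M[int]_(1 + n) := block_mx 1%:M a 0 1%:M.
have UV : U *m V = 1%:M.
  rewrite /U /V mulmx_block !mulmx0 !mul0mx !mulmx1 !mul1mx !addr0 !add0r subrr.
  by rewrite -scalar_mx_block.
have Ue : U *m e = e by rewrite eE mul_block_col !mulmx0 !mul0mx !addr0 mulmx1.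
have eV : e^T *m V^T = e^T.
  by rewrite -trmx_mul; congr trmx; rewrite eE mul_block_col !mulmx0 !mul0mx !addr0 mulmx1.
apply: (sp_gen_cancelr (sp_gen_U UV)).
have {hs}: block_mx A B C D *m block_mx U 0 0 V^T \in @Sp_int (1 + n).
  by apply: Sp_int_mul => //; exact: sp_gen_Sp (sp_gen_U UV).
rewrite mulmx_block !mulmx0 !addr0 !add0r.
have {eA}: e^T *m (A *m U) = e^T.
  by rewrite mulmxA eA mul_row_block !mulmx1 mulmx0 addr0 mulmxN mul1mx addNr eT.
have {Ae}: A *m U *m e = e by rewrite -mulmxA Ue.
have {Ce}: C *m U *m e = 0 by rewrite -mulmxA Ue.
have {eC}: e^T *m (C *m U) = 0 by rewrite mulmxA eC mul0mx.
have {eD}: e^T *m (D *m V^T) = e^T by rewrite mulmxA eD.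
move: (A *m U) (B *m V^T) (C *m U) (D *m V^T) => A1 B1 C1 D1 eD eC Ce Ae eA hs {A B C D a U V UV Ue eV}.
move: A1 B1 C1 D1 eD eC Ce Ae eA hs => A B C D eD eC Ce Ae eA hs.
pose b1 := (e^T *m B) *m e; pose b2 := rsubmx (e^T *m B).
have eB : e^T *m B = row_mx b1 b2 by exact: left_col.
(* A symmetric matrix whose first row is minus that of [B]. As the first row of [A] is now a basis
   vector, the translation by [S] clears the first row of [B]. *)
pose S : 'M[int]_(1 + n) := block_mx (- b1) (- b2) (- b2)^T 0.
have sS : S^T = S.
  rewrite /S tr_block_mx trmxK trmx0; congr block_mx.
  by apply/matrixP => i j; rewrite !mxE !ord1.
have eS : e^T *m S = row_mx (- b1) (- b2).
  by rewrite eT mul_row_block !mul1mx !mul0mx !addr0.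
apply: (sp_gen_cancelr (sp_gen_T sS)).
have {hs}: block_mx A B C D *m block_mx 1%:M S 0 1%:M \in @Sp_int (1 + n).
  by apply: Sp_int_mul => //; exact: sp_gen_Sp (sp_gen_T sS).
rewrite mulmx_block !mulmx0 !mulmx1 !addr0.
have {eB}: e^T *m (A *m S + B) = 0.
  by rewrite mulmxDr mulmxA eA eS eB add_row_mx !addNr row_mx0.
have {eD}: e^T *m (C *m S + D) = e^T by rewrite mulmxDr mulmxA eC mul0mx add0r.
move: (A *m S + B) (C *m S + D) => B1 D1 eD eB hs {B D b1 b2 S sS eS}.
move: B1 D1 eD eB hs => B D eD eB hs.
(* The cleared rows say that the transpose fixes the first basis vector. Applying [row_fix] to the
   transpose yields the first columns of [B] and [D], after which all four blocks split. *)
have hsT : (block_mx A B C D)^T \in @Sp_int (1 + n).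
  by rewrite inE trmxK; apply/eqP; exact: Sp_int_dual.
have fixT : (block_mx A B C D)^T *m col_mx e 0 = col_mx e 0.
  by rewrite tr_block_mx mul_block_col !mulmx0 !addr0 -[e]trmxK -!trmx_mul eA eB trmx0.
have := row_fix _ hsT fixT; rewrite tr_block_mx mul_row_block !mul0mx !add0r.
move=> /eq_row_mx[/(congr1 trmx) + /(congr1 trmx)].
rewrite !trmx_mul !trmxK trmx0 => Be De.
have split_block (X : 'M[int]_(1 + n)) (k : int) : X *m e = k *: e -> e^T *m X = k *: e^T ->
    X = block_mx k%:M 0 0 (drsubmx X).
  move=> h1 h2; rewrite -[LHS]submxK; congr block_mx.
  - move: h1; rewrite eE -{1}[X]submxK mul_block_col !mulmx0 !addr0 !mulmx1 scale_col_mx.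
    by move=> /eq_col_mx[-> _]; rewrite scalemx1.
  - move: h2; rewrite eT -{1}[X]submxK mul_row_block !mul0mx !addr0 !mul1mx scale_row_mx scaler0.
    by move=> /eq_row_mx[_ ->].
  - move: h1; rewrite eE -{1}[X]submxK mul_block_col !mulmx0 !addr0 !mulmx1 scale_col_mx scaler0.
    by move=> /eq_col_mx[_ ->].
have AE := split_block A 1; have BE := split_block B 0.
have CE := split_block C 0; have DE := split_block D 1.
have z0 : 0%:M = 0 :> 'M[int]_1 by apply/matrixP => i j; rewrite !mxE mul0rn.
rewrite !scale1r !scale0r ?z0 in AE BE CE DE.
move: hs; rewrite (AE Ae eA) (BE Be eB) (CE Ce eC) (DE De eD) -sp_embed_block.
by move=> /sp_embed_Sp /IH /sp_embed_gen.
Qed.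

End SymplecticGenerators.

(** * Theta series *)

#[local] Existing Instance summability.totally_filter.

Section ThetaSeries.
Variable R : realType.

Lemma has_sum_cvg (I : choiceType) (f : I -> (R[i])^o) (s : (R[i])^o) :
  has_sum (f : I -> R[i]) s -> summability.partial_sum f @ summability.totally --> s.
Proof.
move=> hs; apply/cvgrPdist_lt => e e0.
(* In [R[i]] regarded as a normed space over itself the tolerance is a positive complex number,
   hence real. *)
have /[dup] eR : e = (Re e)%:C by rewrite RRe_real// ger0_real// ltW.
rewrite eR ltcR in e0 * => _; have [A hA] := hs _ e0.
exists A => // B AB /=; rewrite [X in X < _](normc_cabs _) ltcR cabsC.
by rewrite /summability.partial_sum -(big_seq_fsetE _ _ xpredT f); exact: hA.
Qed.

Lemma asum_cvg (I : choiceType) (f : I -> (R[i])^o) : asum (f : I -> R[i]) ->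
  cvg (summability.partial_sum f @ summability.totally).
Proof. by move=> /asum_has_sum /has_sum_cvg h; apply/cvg_ex; exists (csum f). Qed.

Lemma sum_csum (I : choiceType) (f : I -> (R[i])^o) : asum (f : I -> R[i]) ->
  summability.sum f = csum (f : I -> R[i]).
Proof.
by move=> /asum_has_sum /has_sum_cvg h; exact: cvg_lim.
Qed.

(** For invertible [c] the two families are summable together. If neither is, both sides are the
    default value 0. *)
Lemma csumZ_neq0 (I : choiceType) (f : I -> R[i]) c : c != 0 ->
  csum (fun i => c * f i) = c * csum f.
Proof.
move=> c0; have [[s hs]|nos] := pselect (exists s, has_sum f s).
  by rewrite (has_sum_csum hs) (has_sum_csum (has_sumZ c hs)).
rewrite /csum !xgetPN ?mulr0// => s hs; apply: nos; first by exists s.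
exists (c^-1 * s); have := has_sumZ c^-1 hs; congr has_sum.
by apply/funext => i; rewrite mulKf.
Qed.

Lemma map_intr_real p q (X : 'M[int]_(p, q)) :
  map_mx intr X = map_mx (real_complex R) (map_mx intr X) :> 'M[R[i]]_(p, q).
Proof. by apply/matrixP => i j; rewrite !mxE rmorph_int. Qed.

Lemma complex_mx_decomp p q (W : 'M[R[i]]_(p, q)) :
  W = map_mx (real_complex R) (map_mx Re W) + 'i *: map_mx (real_complex R) (map_mx Im W).
Proof. by apply/matrixP => i j; rewrite !mxE; exact: complexE. Qed.

Definition tform m n (S : 'M[int]_m) (Om : 'M[R[i]]_n) (X : 'M[int]_(m, n)) : R[i] :=
  \tr (map_mx intr S *m map_mx intr X *m Om *m (map_mx intr X)^T).

Lemma tformD m n (S : 'M[int]_m) (O1 O2 : 'M[R[i]]_n) X :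
  tform S (O1 + O2) X = tform S O1 X + tform S O2 X.
Proof. by rewrite /tform mulmxDr mulmxDl raddfD. Qed.

Lemma tformZ m n (S : 'M[int]_m) a (Om : 'M[R[i]]_n) X :
  tform S (a *: Om) X = a * tform S Om X.
Proof. by rewrite /tform -scalemxAr -scalemxAl mxtraceZ. Qed.

Lemma tform_real m n (S : 'M[int]_m) (W : 'M[R]_n) X :
  tform S (map_mx (real_complex R) W) X =
  (\tr (map_mx intr S *m map_mx intr X *m W *m (map_mx intr X)^T))%:C.
Proof.
by rewrite /tform !map_intr_real !map_trmx -!map_mxM trace_map_mx.
Qed.

Lemma Im_tform m n (S : 'M[int]_m) (Om : 'M[R[i]]_n) X :
  Im (tform S Om X) =
  \tr (map_mx intr S *m map_mx intr X *m map_mx Im Om *m (map_mx intr X)^T).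
Proof.
rewrite {1}[Om]complex_mx_decomp tformD tformZ !tform_real /=.
by rewrite !(mul0r, mul1r, add0r, addr0).
Qed.

Lemma cabs_theta (t : R[i]) : cabs (cexp (pi%:C * 'i * t)) = expR (- (pi * Im t)).
Proof. by rewrite cabs_cexp; case: t => a b /=; congr expR; ring. Qed.

Section Lattice.
Variables (m : nat) (S : 'M[int]_m).
Hypothesis hS : even_unimodular_posdef R S.

Let sS : S^T = S. Proof. by case: hS. Qed.
Let sSR : (map_mx intr S : 'M[R]_m)^T = map_mx intr S. Proof. by rewrite map_trmx sS. Qed.
Let pS : posdefmx (map_mx intr S : 'M[R]_m). Proof. by case: hS. Qed.
Let dS : \det S = 1. Proof. by case: hS. Qed.

Definition theta n (Om : 'M[R[i]]_n) : R[i] :=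
  csum (fun X : 'M[int]_(m, n) => cexp (pi%:C * 'i * tform S Om X)).

Lemma theta_asum n (Om : 'M[R[i]]_n) : siegel Om ->
  asum (fun X : 'M[int]_(m, n) => cexp (pi%:C * 'i * tform S Om X)).
Proof.
move=> [sO pO].
have sY : (map_mx Im Om)^T = map_mx Im Om by rewrite map_trmx sO.
have [c c0 hc] := @trace_form_lower R m n _ _ sSR pS sY pO.
have p0 : 0 < pi :> R := pi_gt0 R.
apply: asum_le1 (@asum_gauss_mx R m n (pi * c) (mulr_gt0 p0 c0)) => X.
rewrite cabs_theta cabs_real gtr0_norm ?expR_gt0// ler_expR lerN2 -mulrA ler_pM2l//.
by rewrite Im_tform.
Qed.

(** [T] is the strict upper triangle of [S] plus half of its diagonal; evenness of the form makes
    these halves integral. *)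
Lemma even_split : exists T : 'M[int]_m, S = T + T^T.
Proof.
have [_ _ eS _] := hS.
have diag i : (2 %| S i i)%Z.
  have := eS (delta_mx i 0); rewrite trmx_delta -mulmxA -rowE -colE.
  by rewrite !mxE.
exists (\matrix_(i, j) (if (i < j)%N then S i j else if i == j then divz (S i i) 2 else 0)).
apply/matrixP => i j; rewrite !mxE [j == i]eq_sym.
case: (ltngtP i j) => ij.
- by rewrite (_ : i == j = false) ?addr0// -val_eqE /= ltn_eqF.
- rewrite (_ : i == j = false) ?add0r; last by rewrite -val_eqE /= gtn_eqF.
  by rewrite -{1}sS mxE.
- have {}ij : i = j by exact/val_inj.
  by rewrite ij eqxx -{1}(divzK (diag j)) mulz2.
Qed.

(** Modulo 2, [S = T + T^T] agrees with the integral skew matrix [T - T^T], whose determinant is 0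
    in odd size; but [\det S = 1]. Hence [m %/ 2] is exactly half of [m]. *)
Lemma unimodular_even_rank : ~~ odd m.
Proof.
have [T ST] := even_split; apply/negP => om.
have K0 : \det (T - T^T) = 0.
  have : \det (T - T^T) = - \det (T - T^T).
    rewrite -{1}det_tr linearB /= trmxK -opprB -scaleN1r detZ.
    by rewrite -signr_odd om expr1 mulN1r.
  lia.
have F2 (x : 'F_2) : - x = x by apply/eqP; case: x => [[|[|]]].
have : \det (map_mx intr S : 'M['F_2]_m) = \det (map_mx intr (T - T^T) : 'M['F_2]_m).
  congr (\det _); apply/matrixP => i j; rewrite ST !mxE intrD intrB.
  by rewrite -[in LHS](F2 (T j i)%:~R).
rewrite !det_map_mx dS K0 => /eqP.
by rewrite rmorph1 rmorph0 oner_eq0.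
Qed.

Lemma tform_int_even n (S' : 'M[int]_n) X : S'^T = S' ->
  exists k : int, tform S (map_mx intr S') X = (2 * k)%:~R.
Proof.
move=> sS'; have [T ST] := even_split.
exists (\tr (T *m (X *m S' *m X^T))).
have -> : 2 * \tr (T *m (X *m S' *m X^T)) = \tr (S *m X *m S' *m X^T).
  rewrite -!mulmxA ST mulmxDl mxtraceD mulr2n mulrDl mul1r; congr (_ + _).
  by rewrite -[RHS]mxtrace_tr !trmx_mul !trmxK sS' mxtrace_mulC !mulmxA.
by rewrite /tform map_trmx -!map_mxM -trace_map_mx.
Qed.

Lemma cexp_pi_even (k : int) : cexp (pi%:C * 'i * (2 * k)%:~R) = 1 :> R[i].
Proof.
transitivity (unit_exp k%:~R : R[i]); last exact: unit_exp_int.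
rewrite -[RHS]/(cexp (2 * pi%:C * 'i * (k%:~R)%:C)); congr cexp.
rewrite intrM rmorph_int; ring.
Qed.

Lemma theta_translate n (Om : 'M[R[i]]_n) (S' : 'M[int]_n) : S'^T = S' ->
  theta (Om + map_mx intr S') = theta Om.
Proof.
move=> sS'; apply: eq_csum => X; rewrite tformD mulrDr cexpD.
by have [k ->] := tform_int_even X sS'; rewrite cexp_pi_even mulr1.
Qed.

Lemma theta_congr n (Om : 'M[R[i]]_n) (U V : 'M[int]_n) : U *m V = 1%:M -> siegel Om ->
  theta (map_mx intr U *m Om *m (map_mx intr U)^T) = theta Om.
Proof.
move=> UV sO; rewrite /theta.
have bU : bijective (fun X : 'M[int]_(m, n) => X *m U).
  exists (fun X => X *m V) => X; rewrite -mulmxA ?UV ?mulmx1//.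
  by rewrite (mulmx1C UV) mulmx1.
rewrite -[RHS](csum_reindex bU (theta_asum sO)); apply: eq_csum => X /=.
by rewrite /tform map_mxM trmx_mul !mulmxA.
Qed.

End Lattice.
End ThetaSeries.

(** * The transformation law for the inversion of one variable *)

Section PartialInversionLaw.
Variable R : realType.

(** [Re (al ^+ 2) > 0] means [|Im al| < |Re al|]; the sign of the root is then chosen so that
    [Re al > 0]. *)
Lemma sqrt_sector (z : R[i]) : 0 < Re z ->
  exists2 al : R[i], `|Im al| < Re al & al ^+ 2 = z.
Proof.
move=> z0; have e := sqr_sqrtc z; move: (sqrtc z) e => al e.
have h : `|Im al| < `|Re al|.
  rewrite -(@ltr_pXn2r _ 2) ?nnegrE ?normr_ge0// !real_normK ?num_real//.
  by move: z0; rewrite -e; case: (al) => a b /=; rewrite subr_gt0 -!expr2.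
have [a0|a0] := ltP 0 (Re al).
  by exists al => //; rewrite (gtr0_norm a0) in h.
exists (- al); last by rewrite sqrrN.
by move: h; rewrite (ler0_norm a0); case: (al) => a b /=; rewrite normrN.
Qed.

Lemma Re_i_div (om : R[i]) : 0 < Im om -> 0 < Re ('i / om).
Proof.
case: om => p q /= q0; rewrite !(mul0r, mul1r, sub0r, mulNr, opprK).
by rewrite divr_gt0// ltr_wpDl ?sqr_ge0// exprn_gt0.
Qed.

Variables (m : nat) (S : 'M[int]_m).
Hypothesis hS : even_unimodular_posdef R S.

Let sS : S^T = S. Proof. by case: hS. Qed.
Let SR : 'M[R]_m := map_mx intr S.
Let SC : 'M[R[i]]_m := map_mx intr S.
Let sSR : SR^T = SR. Proof. by rewrite /SR map_trmx sS. Qed.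
Let sSC : SC^T = SC. Proof. by rewrite /SC map_trmx sS. Qed.
Let pS : posdefmx SR. Proof. by case: hS. Qed.
Let dS : \det S = 1. Proof. by case: hS. Qed.

Definition cform (u v : 'cV[R[i]]_m) : R[i] := (u^T *m SC *m v) 0 0.
Definition rform (u v : 'cV[R]_m) : R := (u^T *m SR *m v) 0 0.

Lemma cformC u v : cform u v = cform v u.
Proof.
rewrite /cform -[u^T *m SC *m v]trmxK mxE !trmx_mul trmxK sSC mulmxA.
by [].
Qed.

Lemma cformDl u1 u2 v : cform (u1 + u2) v = cform u1 v + cform u2 v.
Proof. by rewrite /cform linearD /= !mulmxDl mxE. Qed.

Lemma cformZl a u v : cform (a *: u) v = a * cform u v.
Proof. by rewrite /cform linearZ /= -!scalemxAl mxE. Qed.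

Lemma cformDr u v1 v2 : cform u (v1 + v2) = cform u v1 + cform u v2.
Proof. by rewrite cformC cformDl ![cform _ u]cformC. Qed.

Lemma cformZr a u v : cform u (a *: v) = a * cform u v.
Proof. by rewrite cformC cformZl [cform _ u]cformC. Qed.

Lemma cform_real (y z : 'cV[R]_m) :
  cform (map_mx (real_complex R) y) (map_mx (real_complex R) z) = (rform y z)%:C.
Proof. by rewrite /cform /SC map_intr_real map_trmx -!map_mxM mxE. Qed.

Lemma rformC u v : rform u v = rform v u.
Proof.
rewrite /rform -[u^T *m SR *m v]trmxK mxE !trmx_mul trmxK sSR mulmxA.
by [].
Qed.

Lemma rformDl u1 u2 v : rform (u1 + u2) v = rform u1 v + rform u2 v.
Proof. by rewrite /rform linearD /= !mulmxDl mxE. Qed.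

Lemma rformDr u v1 v2 : rform u (v1 + v2) = rform u v1 + rform u v2.
Proof. by rewrite rformC rformDl ![rform _ u]rformC. Qed.

Lemma lattice_inversion (om al : R[i]) (w : 'cV[R[i]]_m) :
  0 < Im om -> `|Im al| < Re al -> al ^+ 2 = 'i / om ->
  csum (fun x : 'cV[int]_m => cexp (pi%:C * 'i *
    (- om^-1 * cform (map_mx intr x - w) (map_mx intr x - w)))) =
  (al^-1) ^+ m * csum (fun x : 'cV[int]_m => cexp (pi%:C * 'i *
    (om * cform (map_mx intr x) (map_mx intr x) + 2 * cform (map_mx intr x) w))).
Proof.
move=> q0 sal al2.
have om0 : om != 0 by apply: contraTneq q0 => ->; rewrite /= ltxx.
have i2 : ('i : R[i]) ^+ 2 = -1 by exact: sqr_i.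
have i0 : ('i : R[i]) != 0 by rewrite eq_complex /= oner_eq0 andbF.
have al2V : al^-1 ^+ 2 = - 'i * om.
  rewrite exprVn al2 invfM invrK; congr (_ * _).
  by apply: (mulfI i0); rewrite divff// mulrN -expr2 i2 opprK.
pose toC := map_mx (real_complex R) : 'cV[R]_m -> 'cV[R[i]]_m.
(* Since [Im om > 0], 1 and [om] form a real basis of the complex numbers. The component [b] becomes
   the shift and [s] becomes the phase [c], up to a constant factor. *)
have [s [b wE]] : exists s b : 'cV[R]_m, w = - 1 *: toC b + om *: toC s.
  exists ((Im om)^-1 *: map_mx Im w).
  exists (- map_mx Re w + Re om *: ((Im om)^-1 *: map_mx Im w)).
  rewrite scaleN1r; apply/matrixP => i j; rewrite !mxE; move: q0; case: (om) => p q /= q0.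
  apply/eqP; rewrite eq_complex; case: (w i j) => u v /=.
  by apply/andP; split; apply/eqP; field; rewrite gt_eqF.
pose c : 'cV[R]_m := SR *m s.
have lfE y : lf c y = rform s y by rewrite /lf /c trmx_mul sSR.
have qfE y : qf SR y = rform y y by [].
have termL (x : 'cV[int]_m) : cexp (pi%:C * 'i *
    (- om^-1 * cform (map_mx intr x - w) (map_mx intr x - w))) =
    cexp (- (pi%:C * 'i * om * (rform s s)%:C)) *
    gexp (al ^+ 2) (qf SR (map_mx intr x + b)) (lf c (map_mx intr x + b)).
  have -> : map_mx intr x - w = toC (map_mx intr x + b) + (- om) *: toC s.
    rewrite wE map_intr_real /toC map_mxD; apply/matrixP => i j; rewrite !mxE; ring.
  rewrite lfE qfE; move: (map_mx intr x + b) => y.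
  rewrite /gexp -[unit_exp _]/(cexp (2 * pi%:C * 'i * (rform s y)%:C)) -!cexpD.
  congr cexp.
  rewrite !(cformDl, cformDr, cformZl, cformZr) [cform (toC s) (toC y)]cformC !cform_real.
  by rewrite (rformC s y) al2; field.
rewrite (eq_csum termL) csumZ_neq0 ?cexp_neq0// poisson_lattice//.
rewrite det_map_mx dS rmorph1 sqrtr1 invr1 mulr1 mulrCA; congr (_ * _).
have uS : S \in unitmx by rewrite unitmxE dS unitr1.
have uSR : SR \in unitmx by exact: posdef_unit.
(* Unimodularity makes the lattice its own dual: substituting [- S x] for the dual variable turns
   the inverse form into [S] itself. The sign matches the term [+ 2 cform x w]. *)
have bS : bijective (fun x : 'cV[int]_m => - (S *m x)).
  exists (fun x => - (invmx S *m x)) => x; rewrite mulmxN opprK mulmxA.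
    by rewrite mulVmx// mul1mx.
  by rewrite mulmxV// mul1mx.
have ak : asum (fun k : 'cV[int]_m =>
    gexp (al^-1 ^+ 2) (qf (invmx SR) (map_mx intr k - c)) (lf b (map_mx intr k))).
  apply: (gexp_qf_asum (- c)); first exact: sectorV.
    by rewrite trmx_inv sSR.
  exact: posdef_inv.
rewrite -(csum_reindex bS ak) -csumZ_neq0 ?cexp_neq0//; apply: eq_csum => x /=.
have -> : map_mx intr (- (S *m x)) = - (SR *m map_mx intr x) :> 'cV[R]_m.
  by rewrite map_mxN map_mxM.
set y : 'cV[R]_m := map_mx intr x.
have -> : map_mx intr x = toC y by exact: map_intr_real.
have -> : qf (invmx SR) (- (SR *m y) - c) = rform (y + s) (y + s).
  rewrite /c -opprD -mulmxDr; move: (y + s) => u.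
  have -> : - (SR *m u) = (- 1%:M *m SR) *m u by rewrite !mulNmx mul1mx.
  rewrite -qf_congr trmx_mul sSR linearN /= trmx1 !mulmxN !mulNmx mulmxN opprK mulmx1 mul1mx.
  rewrite /qf /rform mulmxA.
  by rewrite mulmxV// ?mul1mx ?mulmx1.
have -> : lf b (- (SR *m y)) = - rform b y.
  by rewrite /lf mulmxN mxE mulmxA.
rewrite /gexp -[unit_exp _]/(cexp (2 * pi%:C * 'i * (- rform b y)%:C)) -!cexpD.
congr cexp; rewrite wE.
rewrite !(cformDr, cformZr) !cform_real !(rformDl, rformDr) (rformC s y) (rformC y b).
by rewrite al2V !realCD realCN; ring.
Qed.

Section Block.
Variables (n : nat) (Om : 'M[R[i]]_(1 + n)).
Hypothesis sO : siegel Om.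

Let om := Om 0 0.
Let r : 'rV[R[i]]_n := ursubmx Om.
Let Om' : 'M[R[i]]_n := drsubmx Om.

(** The image of [Om] under [partial_inversion 0], written out in blocks; [theta_law_J0] makes the
    identification. *)
Definition partial_inverse : 'M[R[i]]_(1 + n) :=
  block_mx (- om^-1)%:M (om^-1 *: r) (om^-1 *: r^T) (Om' - om^-1 *: (r^T *m r)).

Lemma siegel_corner : 0 < Im om.
Proof. by have [_ pO] := sO; have := schur_pivot_gt0 pO; rewrite /schur_pivot mxE. Qed.

Let om0 : om != 0.
Proof. by apply: contraTneq siegel_corner => ->; rewrite /= ltxx. Qed.

Let OmE : Om = block_mx om%:M r r^T Om'.
Proof.
have [tO _] := sO; rewrite -[LHS]submxK; congr block_mx.
  by apply/matrixP => i j; rewrite !mxE !ord1 eqxx mulr1n; congr (Om _ _); exact/val_inj.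
by rewrite /r trmx_ursub tO.
Qed.

Lemma block_quadratic (p : nat) (a : R[i]) (b : 'rV[R[i]]_n) (D : 'M[R[i]]_n)
    (x : 'cV[R[i]]_p) (y : 'M[R[i]]_(p, n)) :
  row_mx x y *m block_mx a%:M b b^T D *m (row_mx x y)^T =
  a *: (x *m x^T) + x *m (y *m b^T)^T + (y *m b^T) *m x^T + y *m D *m y^T.
Proof.
rewrite mul_row_block tr_row_mx mul_row_col !mulmxDl mul_mx_scalar -scalemxAl.
by rewrite trmx_mul trmxK !mulmxA -!addrA; congr (_ + _); rewrite addrCA.
Qed.

Lemma tform_block (x : 'cV[int]_m) (y : 'M[int]_(m, n)) (w := map_mx intr y *m r^T) :
  tform S Om (row_mx x y) = (om * cform (map_mx intr x) (map_mx intr x)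
    + 2 * cform (map_mx intr x) w) + tform S Om' y.
Proof.
have tr1 (u v : 'cV[R[i]]_m) : \tr (SC *m (u *m v^T)) = cform v u.
  by rewrite mulmxA mxtrace_mulC mulmxA trace_mx11.
rewrite /tform -!mulmxA [_ *m (Om *m _)]mulmxA map_row_mx OmE block_quadratic.
rewrite !mulmxDr -scalemxAr !mxtraceD mxtraceZ !tr1 -/w (cformC w) !mulmxA.
by ring.
Qed.

(** The correction [- om^-1 r^T r] in the last block is what completes the square: the remaining
    columns [y] enter the first variable only through [w]. *)
Lemma tform_block_inv (x : 'cV[int]_m) (y : 'M[int]_(m, n)) (w := map_mx intr y *m r^T) :
  tform S partial_inverse (row_mx x y) =
  - om^-1 * cform (map_mx intr x - w) (map_mx intr x - w) + tform S Om' y.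
Proof.
have tr1 (u v : 'cV[R[i]]_m) : \tr (SC *m (u *m v^T)) = cform v u.
  by rewrite mulmxA mxtrace_mulC mulmxA trace_mx11.
rewrite /tform -!mulmxA [_ *m (partial_inverse *m _)]mulmxA map_row_mx /partial_inverse.
rewrite (_ : om^-1 *: r^T = (om^-1 *: r)^T); last by rewrite linearZ.
have lin (A B C D E : 'M[R[i]]_m) a b c d :
    \tr (SC *m (a *: A + b *: B + c *: C + (E + d *: D))) =
    a * \tr (SC *m A) + b * \tr (SC *m B) + c * \tr (SC *m C)
      + (\tr (SC *m E) + d * \tr (SC *m D)).
  by rewrite !mulmxDr -!scalemxAr !mxtraceD !mxtraceZ.
set yC := map_mx intr y in w *; set xC := map_mx intr x.
have e1 : yC *m (om^-1 *: r)^T = om^-1 *: w by rewrite linearZ /= -scalemxAr.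
have e2 : yC *m (Om' - om^-1 *: (r^T *m r)) *m yC^T =
    yC *m Om' *m yC^T + (- om^-1) *: (w *m w^T).
  by rewrite scaleNr mulmxBr mulmxBl -scalemxAr -scalemxAl /w trmx_mul trmxK !mulmxA.
rewrite block_quadratic e1 e2 linearZ /= -[xC *m (om^-1 *: _)]scalemxAr -[(om^-1 *: w) *m _]scalemxAl.
rewrite lin (tr1 xC xC) (tr1 xC w) (tr1 w xC) (tr1 w w).
rewrite -[- w]scaleN1r !(cformDl, cformDr, cformZl, cformZr) (cformC w xC).
rewrite !mulmxA; ring.
Qed.

Lemma csum_first_column (F : 'M[int]_(m, 1 + n) -> R[i]) : asum F ->
  csum F = csum (fun y : 'M[int]_(m, n) => csum (fun x : 'cV[int]_m => F (row_mx x y))).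
Proof.
move=> aF; have bj : bijective (fun p : 'cV[int]_m * 'M[int]_(m, n) => row_mx p.1 p.2).
  exists (fun X => (lsubmx X, rsubmx X)) => [[x y]|X] /=; last by rewrite hsubmxK.
  by rewrite row_mxKl row_mxKr.
rewrite -(csum_reindex bj aF) -csum_fubiniC//.
by apply: asum_reindex aF; exact: bij_inj.
Qed.

Lemma theta_partial_inverse : siegel partial_inverse ->
  theta S partial_inverse = (- 'i) ^+ (m %/ 2) * om ^+ (m %/ 2) * theta S Om.
Proof.
move=> sO'; have [al sal al2] := sqrt_sector (Re_i_div siegel_corner).
have al0 := sector_neq0 sal.
have i2 : ('i : R[i]) ^+ 2 = -1 by exact: sqr_i.
have i0 : ('i : R[i]) != 0 by rewrite eq_complex /= oner_eq0 andbF.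
(* As [m] is even, the power depends only on [al ^+ 2 = 'i / om], and the choice of the root
   disappears. *)
have -> : (- 'i) ^+ (m %/ 2) * om ^+ (m %/ 2) = al^-1 ^+ m.
  rewrite -exprMn -[in RHS](divnK (_ : 2 %| m)%N); last first.
    by rewrite dvdn2; exact: unimodular_even_rank hS.
  rewrite mulnC exprM exprVn al2; congr (_ ^+ _).
  rewrite invfM invrK; congr (_ * _).
  by apply: (mulfI i0); rewrite divff// mulrN -expr2 i2 opprK.
rewrite /theta (csum_first_column (theta_asum hS sO)) (csum_first_column (theta_asum hS sO')).
rewrite -csumZ_neq0; last by rewrite expf_neq0// invr_eq0.
apply: eq_csum => y /=; set E := cexp (pi%:C * 'i * tform S Om' y).
pose w := map_mx intr y *m r^T : 'cV[R[i]]_m.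
transitivity (E * csum (fun x : 'cV[int]_m => cexp (pi%:C * 'i *
    (- om^-1 * cform (map_mx intr x - w) (map_mx intr x - w))))).
  rewrite -csumZ_neq0 ?cexp_neq0//; apply: eq_csum => x.
  by rewrite tform_block_inv mulrDr cexpD mulrC.
rewrite (lattice_inversion w siegel_corner sal al2) mulrCA; congr (_ * _).
rewrite -csumZ_neq0 ?cexp_neq0//; apply: eq_csum => x.
by rewrite tform_block -/r -/w /E -cexpD -mulrDr addrC.
Qed.

Lemma Im_real_quadratic k (W : 'M[R[i]]_k) (z : 'cV[R]_k) :
  qf (map_mx Im W) z = Im (((map_mx (real_complex R) z)^T *m W *m map_mx (real_complex R) z) 0 0).
Proof.
rewrite [in RHS](complex_mx_decomp W) mulmxDr mulmxDl -scalemxAr -scalemxAl.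
rewrite !map_trmx -!map_mxM mxE [X in X + _]mxE [X in _ + X]mxE [X in _ * X]mxE /=.
by rewrite !(mul0r, mul1r, add0r, addr0).
Qed.

(** For [z = (a, z')] put [d = (a - r z') / om]. The new imaginary part at [z] is the value of the
    old one at [(Re d, z')] plus its value at [(Im d, 0)]. Both vanish only if [d = 0] and [z' = 0],
    and then [a = 0]. *)
Lemma siegel_partial_inverse : siegel partial_inverse.
Proof.
have [tO pO] := sO; have q0 := siegel_corner.
have tO' : Om'^T = Om' by rewrite /Om' trmx_drsub tO.
split.
  have sD : (Om' - om^-1 *: (r^T *m r))^T = Om' - om^-1 *: (r^T *m r).
    by rewrite linearB /= tO' linearZ /= trmx_mul trmxK.
  by rewrite /partial_inverse tr_block_mx tr_scalar_mx sD !linearZ /= trmxK.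
move=> z z0; rewrite -/(qf _ z).
pose a := z 0 0; pose z' : 'cV[R]_n := dsubmx z.
have zE : z = col_mx a%:M z'.
  rewrite -[LHS]vsubmxK; congr col_mx; rewrite [LHS]mx11_scalar; congr (_%:M).
  by rewrite mxE; congr (z _ _); exact/val_inj.
pose toC k := map_mx (real_complex R) : 'cV[R]_k -> 'cV[R[i]]_k.
pose Z := ((toC _ z')^T *m Om' *m toC _ z') 0 0.
pose rho := (r *m toC _ z') 0 0.
have quad (e : R[i]) (b : 'rV[R[i]]_n) (D : 'M[R[i]]_n) (k : R) :
    ((toC _ (col_mx k%:M z'))^T *m block_mx e%:M b b^T D *m toC _ (col_mx k%:M z')) 0 0
    = e * k%:C ^+ 2 + 2 * k%:C * (b *m toC _ z') 0 0
      + ((toC _ z')^T *m D *m toC _ z') 0 0.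
  have -> : toC _ (col_mx k%:M z') = (row_mx (k%:C)%:M (toC _ z')^T)^T.
    by rewrite tr_row_mx trmxK tr_scalar_mx /toC map_col_mx map_scalar_mx.
  have addE (A B : 'M[R[i]]_1) : (A + B) 0 0 = A 0 0 + B 0 0 by rewrite mxE.
  have scalarE (x : R[i]) : (x%:M : 'M[R[i]]_1) 0 0 = x by rewrite mxE eqxx mulr1n.
  rewrite trmxK block_quadratic.
  have -> : (toC _ z')^T *m b^T = ((b *m toC _ z') 0 0)%:M.
    by rewrite -trmx_mul [_ *m _]mx11_scalar tr_scalar_mx scalarE.
  rewrite !tr_scalar_mx -!scalar_mxM trmxK scale_scalar_mx !addE !scalarE.
  by rewrite expr2; ring.
pose c := a%:C - rho; pose d := c / om.
have cE : c = d * om by rewrite /d divfK.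
rewrite Im_real_quadratic zE -/(toC _ _) /partial_inverse.
rewrite (_ : om^-1 *: r^T = (om^-1 *: r)^T); last by rewrite linearZ.
have hr : (om^-1 *: r *m toC _ z') 0 0 = om^-1 * rho by rewrite -scalemxAl mxE.
rewrite quad hr.
have -> : ((toC _ z')^T *m (Om' - om^-1 *: (r^T *m r)) *m toC _ z') 0 0 = Z - om^-1 * rho ^+ 2.
  rewrite mulmxBr mulmxBl -scalemxAr -scalemxAl mxE; congr (_ + _).
  rewrite 2!mxE; congr (- (_ * _)); rewrite !mulmxA -[_ *m r *m _]mulmxA -trmx_mul.
  by rewrite mxE big_ord1 mxE -/rho.
have -> : - om^-1 * a%:C ^+ 2 + 2 * a%:C * (om^-1 * rho) + (Z - om^-1 * rho ^+ 2) =
    Z - d ^+ 2 * om.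
  by rewrite /d /c; field.
pose Y := map_mx Im Om.
have Yq k : qf Y (col_mx k%:M z') = Im om * k ^+ 2 + 2 * k * Im rho + Im Z.
  rewrite Im_real_quadratic {1}OmE -/(toC _ _) quad -/rho -/Z.
  case: (om) (rho) (Z) => p q [u v] [x y] /=; ring.
have sY : Y^T = Y by rewrite /Y map_trmx tO.
have Yq0 l : qf Y (col_mx l%:M 0) = Im om * l ^+ 2.
  rewrite schur_qf// /schur_pivot [Y 0 0]mxE /lf /qf !mulmx0 !mxE addr0.
  by rewrite addr0.
(* Because [a] is real, [Im (d om) = - Im rho], which eliminates [rho] from the cross term. *)
have -> : Im (Z - d ^+ 2 * om) = qf Y (col_mx (Re d)%:M z') + qf Y (col_mx (Im d)%:M 0).
  rewrite Yq Yq0; have : Im (d * om) = - Im rho by rewrite -cE /c; case: (rho) => u v /=; ring.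
  move: (Im rho) => v; case: (om) (d) (Z) => p q [k l] [x y] /= h.
  have -> : v = - (k * q + l * p) by lra.
  ring.
have Y0 y : 0 <= qf Y y by exact: posdef_ge0.
have Ypos y : y != 0 -> 0 < qf Y y by exact: pO.
have [z'0|z'0] := eqVneq z' 0; last first.
  rewrite ltr_wpDr//; apply: Ypos; apply: contra_neq z'0 => /(congr1 dsubmx).
  by rewrite col_mxKd linear0.
have [l0|l0] := eqVneq (Im d) 0; last first.
  by rewrite ltr_wpDl// Yq0 mulr_gt0// lt_def sqr_ge0 sqrf_eq0 l0.
rewrite ltr_wpDr//; apply: Ypos; apply: contra_neq z0 => /(congr1 usubmx).
rewrite col_mxKu linear0 => /matrixP/(_ 0 0); rewrite !mxE eqxx mulr1n => k0.
have d0 : d = 0 by apply/eqP; rewrite eq_complex k0 l0 !eqxx.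
have rho0 : rho = 0 by rewrite /rho z'0 /toC map_mx0 mulmx0 mxE.
have a0 : a = 0.
  by move: cE; rewrite d0 mul0r /c rho0 subr0 => /(congr1 Re).
have e0 : 0%:M = 0 :> 'M[R]_1 by apply/matrixP => i j; rewrite !mxE mul0rn.
by rewrite zE a0 z'0 e0 col_mx0.
Qed.

End Block.
End PartialInversionLaw.

(** * The transformation law on the whole symplectic group *)

Section Covariance.
Variables (R : realType) (m : nat) (S : 'M[int]_m).
Hypothesis hS : even_unimodular_posdef R S.

Definition moebius_num n (g : 'M[int]_(n + n)) (Om : 'M[R[i]]_n) : 'M[R[i]]_n :=
  map_mx intr (ulsubmx g) *m Om + map_mx intr (ursubmx g).
Definition moebius_den n (g : 'M[int]_(n + n)) (Om : 'M[R[i]]_n) : 'M[R[i]]_n :=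
  map_mx intr (dlsubmx g) *m Om + map_mx intr (drsubmx g).
Definition moebius n (g : 'M[int]_(n + n)) (Om : 'M[R[i]]_n) : 'M[R[i]]_n :=
  moebius_num g Om *m invmx (moebius_den g Om).

(** Invertibility of the denominator and stability of the half plane travel with the law, so that
    they too are proved only on generators. The modulus condition is what later gives the eighth
    power equal to 1. *)
Definition theta_law n (g : 'M[int]_(n + n)) (c : R[i]) :=
  cabs c = 1 /\ forall Om : 'M[R[i]]_n, siegel Om ->
  [/\ moebius_den g Om \in unitmx, siegel (moebius g Om) &
      theta S (moebius g Om) = c * \det (moebius_den g Om) ^+ (m %/ 2) * theta S Om].

Lemma theta_law_mul n (g h : 'M[int]_(n + n)) c d :
  theta_law g c -> theta_law h d -> theta_law (g *m h) (c * d).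
Proof.
move=> [c1 hg] [d1 hh]; split=> [|Om sO]; first by rewrite cabsM c1 d1 mulr1.
have [uh sh th] := hh Om sO; have [ug sg tg] := hg _ sh.
have numE : moebius_num h Om = moebius h Om *m moebius_den h Om.
  by rewrite /moebius -mulmxA mulVmx// mulmx1.
have blockE : g *m h = block_mx
    (ulsubmx g *m ulsubmx h + ursubmx g *m dlsubmx h)
    (ulsubmx g *m ursubmx h + ursubmx g *m drsubmx h)
    (dlsubmx g *m ulsubmx h + drsubmx g *m dlsubmx h)
    (dlsubmx g *m ursubmx h + drsubmx g *m drsubmx h).
  by rewrite -mulmx_block !submxK.
(* One identity serves for numerator and denominator: both rows of [g *m h] factor through the
   denominator of [h]. *)
have lin (A B : 'M[int]_n) :
    map_mx intr (A *m ulsubmx h + B *m dlsubmx h) *m Om +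
    map_mx intr (A *m ursubmx h + B *m drsubmx h) =
    (map_mx intr A *m moebius h Om + map_mx intr B) *m moebius_den h Om.
  rewrite mulmxDl -[_ *m moebius h Om *m _]mulmxA -numE /moebius_num /moebius_den.
  by rewrite !map_mxD !map_mxM !mulmxDl !mulmxDr !mulmxA addrACA.
have denE : moebius_den (g *m h) Om = moebius_den g (moebius h Om) *m moebius_den h Om.
  by rewrite /moebius_den blockE block_mxKdl block_mxKdr lin.
have numE' : moebius_num (g *m h) Om = moebius_num g (moebius h Om) *m moebius_den h Om.
  by rewrite {1}/moebius_num blockE block_mxKul block_mxKur lin.
have u : moebius_den (g *m h) Om \in unitmx by rewrite denE unitmx_mul ug uh.
have actE : moebius (g *m h) Om = moebius g (moebius h Om).
  rewrite -[RHS]mulmx1 -(mulmxV u) mulmxA; congr (_ *m _).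
  rewrite numE' denE mulmxA; congr (_ *m _).
  by rewrite -mulmxA mulVmx// mulmx1.
rewrite actE denE; split; [by rewrite unitmx_mul ug uh|exact: sg|].
rewrite det_mulmx exprMn tg th.
by move: (_ ^+ _) (_ ^+ _) (theta _ _) => x y t; ring.
Qed.

Lemma theta_law_T n (S' : 'M[int]_n) : S'^T = S' -> theta_law (block_mx 1%:M S' 0 1%:M) 1.
Proof.
move=> sS'; split=> [|Om sO]; first exact: cabs1.
have d1 : moebius_den (block_mx 1%:M S' 0 1%:M) Om = 1%:M.
  by rewrite /moebius_den block_mxKdl block_mxKdr map_mx0 mul0mx add0r map_mx1.
have actE : moebius (block_mx 1%:M S' 0 1%:M) Om = Om + map_mx intr S'.
  by rewrite /moebius d1 invmx1 mulmx1 /moebius_num block_mxKul block_mxKur map_mx1 mul1mx.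
rewrite actE d1 unitmx1 det1 expr1n !mul1r theta_translate//; split => //.
have [tO pO] := sO; split; first by rewrite linearD /= tO map_trmx sS'.
rewrite (_ : map_mx Im _ = map_mx Im Om)//; apply/matrixP => i j; rewrite !mxE.
by rewrite -(rmorph_int (real_complex R)); case: (Om i j) => a b /=; rewrite addr0.
Qed.

Lemma siegel_congr n (Om : 'M[R[i]]_n) (U V : 'M[int]_n) : U *m V = 1%:M ->
  siegel Om -> siegel (map_mx intr U *m Om *m (map_mx intr U)^T).
Proof.
move=> UV [tO pO]; split; first by rewrite !trmx_mul trmxK tO mulmxA.
move=> z z0; rewrite -/(qf _ z) Im_real_quadratic.
set zC := map_mx _ z; set UC := map_mx intr U.
have -> : zC^T *m (UC *m Om *m UC^T) *m zC = (UC^T *m zC)^T *m Om *m (UC^T *m zC).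
  by rewrite trmx_mul trmxK !mulmxA.
rewrite /UC /zC map_intr_real map_trmx -map_mxM -Im_real_quadratic; apply: pO.
apply: contra_neq z0 => h.
have <- : (map_mx intr V)^T *m ((map_mx intr U)^T *m z) = z.
  by rewrite mulmxA -trmx_mul -map_mxM UV map_mx1 trmx1 mul1mx.
by rewrite h mulmx0.
Qed.

Lemma theta_law_U n (U V : 'M[int]_n) : U *m V = 1%:M ->
  exists c, theta_law (block_mx U 0 0 V^T) c.
Proof.
move=> UV; have VU := mulmx1C UV.
have uV : \det V \is a GRing.unit.
  by apply/unitrP; exists (\det U); rewrite -!det_mulmx VU UV det1.
have aV : cabs ((\det V)%:~R : R[i]) = 1.
  rewrite -(rmorph_int (real_complex R)) cabs_real.
  have : (\det V == 1) || (\det V == - 1) := uV.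
  by move=> /orP[/eqP ->|/eqP ->]; rewrite ?mulrN1z ?normrN normr1.
(* The series itself is invariant under a congruence, so the constant only cancels the automorphy
   factor. It has modulus 1 because [\det V] is a unit of Z. *)
exists (((\det V)%:~R) ^+ (m %/ 2))^-1; split=> [|Om sO].
  by rewrite cabsV cabsX aV expr1n invr1.
have dE : moebius_den (block_mx U 0 0 V^T) Om = (map_mx intr V)^T.
  by rewrite /moebius_den block_mxKdl block_mxKdr map_mx0 mul0mx add0r map_trmx.
have UVC : (map_mx intr V)^T *m (map_mx intr U)^T = 1%:M :> 'M[R[i]]_n.
  by rewrite -trmx_mul -map_mxM UV map_mx1 trmx1.
have [uD _] := mulmx1_unit UVC.
have actE : moebius (block_mx U 0 0 V^T) Om = map_mx intr U *m Om *m (map_mx intr U)^T.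
  rewrite /moebius dE /moebius_num block_mxKul block_mxKur map_mx0 addr0.
  by congr (_ *m _); rewrite -[LHS]mulmx1 -UVC mulmxA mulVmx// mul1mx.
rewrite actE dE uD; split => //; first exact: siegel_congr UV sO.
rewrite (theta_congr hS UV sO) det_tr det_map_mx mulVf ?mul1r//.
by rewrite expf_neq0// -cabs_eq0 aV oner_eq0.
Qed.

Lemma theta_law_J0 n : theta_law (partial_inversion (0 : 'I_n.+1)) ((- 'i) ^+ (m %/ 2)).
Proof.
split=> [|Om]; first by rewrite cabsX cabsN cabs_i expr1n.
move: Om; rewrite -[n.+1]/(1 + n)%N => Om sO.
have q0 := siegel_corner sO; have [tO _] := sO.
set om := Om 0 0 in q0.
have om0 : om != 0 by apply: contraTneq q0 => ->; rewrite /= ltxx.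
have OmE : Om = block_mx om%:M (ursubmx Om) (ursubmx Om)^T (drsubmx Om).
  rewrite -[LHS]submxK; congr block_mx; last by rewrite trmx_ursub tO.
  by apply/matrixP => i j; rewrite !mxE !ord1 eqxx mulr1n; congr (Om _ _); exact/val_inj.
have E0 : map_mx intr (delta_mx 0 0 : 'M[int]_(1 + n)) = block_mx 1%:M 0 0 0 :> 'M[R[i]]_(1 + n).
  rewrite -[LHS]submxK; congr block_mx; apply/matrixP => i j; rewrite !mxE ?ord1 ?rmorph1//.
have E1 : map_mx intr (1%:M - delta_mx 0 0 : 'M[int]_(1 + n)) = block_mx 0 0 0 1%:M :> 'M[R[i]]_(1 + n).
  rewrite map_mxB E0 map_mx1 (scalar_mx_block 1) opp_block_mx add_block_mx.
  by rewrite subrr !oppr0 !addr0.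
have denE : moebius_den (partial_inversion 0) Om = block_mx om%:M (ursubmx Om) 0 1%:M.
  rewrite /moebius_den /partial_inversion block_mxKdl block_mxKdr E0 E1 {1}OmE.
  by rewrite (@mulmx_block _ 1 n 1 n 1 n) !mul0mx !mul1mx !addr0 (@add_block_mx _ 1 n 1 n) !addr0 add0r.
have numE : moebius_num (partial_inversion 0) Om = partial_inverse Om *m moebius_den (partial_inversion 0) Om.
  rewrite denE /moebius_num /partial_inversion block_mxKul block_mxKur E1 map_mxN E0 {1}OmE.
  rewrite (@mulmx_block _ 1 n 1 n 1 n) !mul0mx !mul1mx !addr0 !add0r.
  rewrite (@opp_block_mx _ 1 n 1 n) (@add_block_mx _ 1 n 1 n) !oppr0 !addr0 !add0r.
  rewrite /partial_inverse (@mulmx_block _ 1 n 1 n 1 n) !mulmx0 !mulmx1 !addr0 -!scalar_mxM mulNr mulVf//.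
  have -> : (- 1)%:M = - 1%:M :> 'M[R[i]]_1.
    by apply/matrixP => i j; rewrite !mxE; case: (i == j); rewrite ?mulNrn.
  rewrite -/om mul_scalar_mx scaleNr addNr mul_mx_scalar scalerA mulfV// scale1r.
  by rewrite -scalemxAl [_ + (_ - _)]addrC subrK.
have detE : \det (moebius_den (partial_inversion 0) Om) = om.
  by rewrite denE (@det_ublock _ 1 n) det1 mulr1 det_scalar1.
have uD : moebius_den (partial_inversion 0) Om \in unitmx by rewrite unitmxE detE unitfE.
have actE : moebius (partial_inversion 0) Om = partial_inverse Om.
  by rewrite /moebius numE -mulmxA mulmxV// mulmx1.
have sP := siegel_partial_inverse sO.
by rewrite actE detE; split => //; exact: theta_partial_inverse.
Qed.

(** Conjugation by the permutation matrix exchanging 0 and [i], which is its own inverse and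
    transpose, reduces to the first coordinate. *)
Lemma theta_law_J n (i : 'I_n) : exists c, theta_law (partial_inversion i) c.
Proof.
case: n i => [[]//|n] i.
pose s := tperm 0 i; pose P : 'M[int]_n.+1 := perm_mx s.
have PT : P^T = P by rewrite tr_perm_mx tpermV.
have PP : P *m P = 1%:M by rewrite -perm_mxM tperm2 perm_mx1.
have PE : P *m delta_mx 0 0 *m P = delta_mx i i.
  have -> : P *m delta_mx 0 0 *m P = row_perm s (col_perm s (delta_mx 0 0)).
    by rewrite row_permE col_permE tpermV mulmxA.
  apply/matrixP => a b; rewrite !mxE.
  have t k : (s k == 0) = (k == i).
    by rewrite -(inj_eq (@perm_inj _ s)) tpermK tpermL.
  by rewrite !t.
have [c hc] := theta_law_U PP; rewrite PT in hc.
have e : partial_inversion i = block_mx P 0 0 P *m partial_inversion 0 *m block_mx P 0 0 P.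
  rewrite /partial_inversion !mulmx_block !mulmx0 !mul0mx !addr0 !add0r.
  by rewrite !(mulmxBr, mulmxBl, mulmxN, mulNmx) !mulmx1 PP PE.
rewrite e; exists (c * (- 'i) ^+ (m %/ 2) * c).
exact: theta_law_mul (theta_law_mul hc (theta_law_J0 n)) hc.
Qed.

Lemma Sp_int_theta_law n (g : 'M[int]_(n + n)) : g \in @Sp_int n -> exists c, theta_law g c.
Proof.
move=> /Sp_int_generated; elim=> [S' sS'|U V UV|i|g1 g2 _ [c1 h1] _ [c2 h2]].
- by exists 1; exact: theta_law_T.
- exact: theta_law_U.
- exact: theta_law_J.
- by exists (c1 * c2); exact: theta_law_mul.
Qed.

(** At this point all terms of the theta series are positive reals, so its value can be divided
    by. *)
Definition theta_base n : 'M[R[i]]_n := 'i *: 1%:M.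

Lemma siegel_base n : siegel (theta_base n).
Proof.
split; first by rewrite linearZ /= trmx1.
move=> z z0; rewrite -/(qf _ z).
have -> : map_mx Im (theta_base n) = 1%:M.
  by apply/matrixP => i j; rewrite !mxE; case: (i == j) => /=; rewrite ?mulr1n ?mulr0n /=; ring.
rewrite /qf mulmx1 -trace_mx11 mxtrace_mulC frob2_trace lt_def frob2_ge0 andbT.
by apply: contra_neq z0; exact: frob2_eq0.
Qed.

Lemma theta_base_neq0 n : theta S (theta_base n) != 0.
Proof.
pose q (X : 'M[int]_(m, n)) : R :=
  \tr (map_mx intr S *m map_mx intr X *m 1%:M *m (map_mx intr X)^T).
apply: (@nonneg_sum_neq0 _ _ (fun X => expR (- (pi * q X))) 0).
- by move=> X; exact: expR_ge0.
- exact: expR_gt0.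
- rewrite (_ : (fun X => _) = (fun X : 'M[int]_(m, n) =>
      cexp (pi%:C * 'i * tform S (theta_base n) X))).
    by apply: asum_has_sum; apply: theta_asum => //; exact: siegel_base.
  apply/funext => X; rewrite -cexp_real; congr cexp.
  have m1 : map_mx (real_complex R) 1%:M = 1%:M :> 'M[R[i]]_n.
    by apply/matrixP => i j; rewrite !mxE; case: (i == j).
  have := tform_real S (1%:M : 'M[R]_n) X; rewrite m1 -/(q X) => tq.
  rewrite /theta_base tformZ tq realCN realCM.
  have i2 : ('i : R[i]) ^+ 2 = -1 by exact: sqr_i.
  by rewrite mulrA -[X in _ = X * _]mulrA -expr2 i2 mulrN1 mulNr.
Qed.

End Covariance.

Theorem theorem17p2 (R : realType) (m n : nat) (hm : (0 < m)%N) (hn : (0 < n)%N)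
    (M : 'M[R[i]]_m)
    (hM : exists2 S : 'M[int]_m,
            2 *: M = map_mx intr S & even_unimodular_posdef R S) :
  (forall Omega : 'M[R[i]]_n, siegel Omega -> theta_summable M Omega) /\
  exists rho : 'M[int]_(n + n) -> R[i],
    [/\ Sp_character rho,
        {in @Sp_int n, forall g, `|rho g| ^+ 8 = 1} &
        forall A B C D : 'M[int]_n, block_mx A B C D \in @Sp_int n ->
        forall Omega : 'M[R[i]]_n, siegel Omega ->
          let J := map_mx intr C *m Omega + map_mx intr D in
          Theta M ((map_mx intr A *m Omega + map_mx intr B) *m invmx J)
          = rho (block_mx A B C D) * \det J ^+ (m %/ 2) * Theta M Omega].
Proof.
have [S MS hS] := hM.
(* The factor 2 of [2 pi i] is absorbed in [S = 2 M]. *)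
have termE (Om : 'M[R[i]]_n) :
    theta_term M Om = (fun X => cexp (pi%:C * 'i * tform S Om X)) :> (_ -> R[i]).
  apply/funext => X; congr cexp.
  rewrite /tform -MS -!scalemxAl mxtraceZ -!mulmxA; ring.
have term_asum (Om : 'M[R[i]]_n) : siegel Om -> asum (theta_term M Om : 'M[int]_(m, n) -> R[i]).
  by move=> sO; have := theta_asum hS sO; rewrite -(termE Om).
have ThetaE (Om : 'M[R[i]]_n) : siegel Om -> Theta M Om = theta S Om.
  by move=> sO; rewrite /Theta (sum_csum (term_asum Om sO)) /theta -(termE Om).
split=> [Om sO|]; first exact: asum_cvg (term_asum Om sO).
pose B := theta_base R n; have B0 : theta S B != 0 := theta_base_neq0 hS n.
have sB : siegel B := siegel_base R n.
(* The law at the base point is solved for its constant, which makes the constant unique.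
   Multiplicativity then follows by comparing with [theta_law_mul]. *)
pose rho (g : 'M[int]_(n + n)) :=
  theta S (moebius g B) / (\det (moebius_den g B) ^+ (m %/ 2) * theta S B).
have rhoE g c : theta_law S g c -> rho g = c.
  move=> [_ /(_ B sB)[u _ e]]; rewrite /rho e -[X in X / _]mulrA mulfK//.
  by rewrite mulf_neq0// expf_neq0// -unitfE -unitmxE.
have rho1 g : g \in @Sp_int n -> theta_law S g (rho g).
  by move=> /(Sp_int_theta_law hS)[c hc]; rewrite (rhoE _ _ hc).
exists rho; split.
- split=> [g hg|g h hg hh].
    by have [c1 _] := rho1 g hg; rewrite -cabs_eq0 c1 oner_eq0.
  by apply: rhoE; apply: theta_law_mul; exact: rho1.
- by move=> g hg; have [c1 _] := rho1 g hg; rewrite normc_cabs c1 expr1n.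
- move=> A B' C D hg Om sO J.
  have [_ /(_ Om sO)[_ sg e]] := rho1 _ hg.
  move: sg e; rewrite /moebius /moebius_num /moebius_den.
  rewrite block_mxKul block_mxKur block_mxKdl block_mxKdr -/J => sg e.
  by rewrite !ThetaE.
Qed.
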